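(* Let $m=m(n)$ be positive integers with $m\le n/2+O(n^{2/3})$, let $P=P(n,m)$ be a graph chosen uniformly at random from the class of all vertex-labelled simple planar graphs on vertex set $\{1,\dots,n\}$ with $m$ edges, and let $\varepsilon>0$. Then with probability tending to $1$ as $n\to\infty$, $$\lfloor \nu(n,2m)-\varepsilon\rfloor\le \Delta(P)\le \lfloor \nu(n,2m)+\varepsilon\rfloor .$$ In particular, with probability tending to $1$, $\Delta(P)\in\{D,D+1\}$, where $D=D(n):=\lfloor \nu(n,2m)-1/3\rfloor$.
   Context: $\Delta(H)$ denotes the maximum degree of a graph $H$; $\log$ is the natural logarithm. For $n,k\in\mathbb N$, $\nu(n,k)$ is defined as the unique positive zero of the function $f_{n,k}(x)=x\log k+x-(x+1/2)\log x-(x-1)\log n$ (this zero exists and is unique). All asymptotics are as $n\to\infty$. *)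

(* Defs.v *)
From HB Require Import structures.
From mathcomp Require Import all_boot all_order all_algebra.
From mathcomp Require Import all_classical all_reals all_analysis.
From mathcomp Require Import ring lra.
Import numFieldNormedType.Exports.
Import Order.TTheory GRing.Theory Num.Theory.

Set Implicit Arguments.
Unset Strict Implicit.
Unset Printing Implicit Defensive.

Local Open Scope classical_set_scope.
Local Open Scope ring_scope.

(* A graph with vertex set V is given by its set of edges, an edge being the
   set of its two endpoints. *)
Definition simple_graph (V : finType) (E : {set {set V}}) : bool :=
  [forall e in E, #|e| == 2].

Definition degree (V : finType) (E : {set {set V}}) (v : V) : nat :=
  #|[set e in E | v \in e]|.

Definition max_degree (V : finType) (E : {set {set V}}) : nat :=
  (\max_(v : V) degree E v)%N.

(* Drawings in the plane R * R (with the product topology): distinct vertices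
   are distinct points, and every edge e is the simple arc arc e @` `[0, 1]
   joining its two endpoints.  The interior of an arc contains no vertex and
   meets no other arc; as the endpoints of arcs are vertices, two arcs can
   therefore only meet in a common endpoint. *)
Record plane_drawing (R : realType) (V : finType) (E : {set {set V}})
    (pos : V -> R * R) (arc : {set V} -> R -> R * R) : Prop := PlaneDrawing {
  drawing_pos_inj : injective pos;
  drawing_arc_continuous : forall e, e \in E ->
    {within `[0, 1], continuous (arc e)};
  drawing_arc_inj : forall e, e \in E -> {in `[0, 1] &, injective (arc e)};
  drawing_arc_ends : forall e, e \in E ->
    exists u v, [/\ e = [set u; v]%SET, arc e 0 = pos u & arc e 1 = pos v];
  drawing_arc_vertex : forall e t v, e \in E -> t \in `]0, 1[ ->
    arc e t <> pos v;
  drawing_arc_arc : forall e e' t t', e \in E -> e' \in E -> e != e' ->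
    t \in `]0, 1[ -> t' \in `]0, 1[ -> arc e t <> arc e' t' }.

Definition planar (R : realType) (V : finType) (E : {set {set V}}) : Prop :=
  exists pos arc, @plane_drawing R V E pos arc.

(* The vertex set {1, ..., n} is represented by 'I_n = {0, ..., n - 1}. *)
Definition planar_graphs (R : realType) (n m : nat) : {set {set {set 'I_n}}} :=
  [set E | [&& simple_graph E, #|E| == m & `[< planar R E >]]]%SET.

(* The probability of the event A for the uniform distribution on the finite
   set S (by convention 0 if S is empty). *)
Definition uniform_pr (R : realType) (T : finType) (S : {set T}) (A : pred T)
    : R :=
  #|[set x in S | A x]%SET|%:R / #|S|%:R.

Definition nu_fun (R : realType) (n k : nat) (x : R) : R :=
  x * ln k%:R + x - (x + 1 / 2) * ln x - (x - 1) * ln n%:R.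

(* The positive zero of nu_fun n k, which exists and is unique for n, k > 0
   (nu_gt0, nu_root and nu_unique below); the value for n = 0 or k = 0 is
   irrelevant. *)
Definition nu (R : realType) (n k : nat) : R :=
  xget 0 [set x : R | 0 < x /\ nu_fun n k x = 0].

Section NuTheory.
Variables (R : realType) (n k : nat).
Hypotheses (n_gt0 : (0 < n)%N) (k_gt0 : (0 < k)%N).

Lemma nu_fun_zero_exists : exists x : R, 0 < x /\ nu_fun n k x = 0.
Proof.
have n1 : 1 <= n%:R :> R by rewrite ler1n.
have k1 : 1 <= k%:R :> R by rewrite ler1n.
have n0 : 0 < n%:R :> R by rewrite ltr0n.
have k0 : 0 < k%:R :> R by rewrite ltr0n.
have ln_n : 0 <= ln n%:R :> R by exact: ln_ge0.
have ln_k : 0 <= ln k%:R :> R by exact: ln_ge0.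
pose b : R := expR 2 * k%:R * n%:R.
have e1 : 1 <= expR 2 :> R by rewrite -expR0 ler_expR.
have b1 : 1 <= b by rewrite /b !mulr_ege1.
have ln_b : ln b = 2 + ln k%:R + ln n%:R.
  by rewrite /b !lnM ?posrE ?mulr_gt0 ?expR_gt0// expRK.
have f1 : 0 <= nu_fun n k (1 : R) by rewrite /nu_fun ln1; lra.
have fb : nu_fun n k b <= 0.
  rewrite /nu_fun ln_b; move: ln_n ln_k b1; clear.
  move: b (ln k%:R) (ln n%:R) => b p q q0 p0 b1.
  have bq : q <= b * q by rewrite ler_peMl.
  lra.
have [| |x /itvP xb fx0] := @IVT R (nu_fun n k) 1 b 0 b1.
- apply: continuous_in_subspaceT => x /[!inE] /= /itvP xb.
  have x0 : 0 < x by apply: (@lt_le_trans _ _ 1) => //; rewrite xb.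
  have cln : {for x, continuous (@ln R)} by exact: continuous_ln.
  have cid : {for x, continuous (fun y : R => y)} by exact: cvg_id.
  apply: cvgB; first apply: cvgB; first apply: cvgD => //.
  + by apply: cvgM => //; exact: cvg_cst.
  + by apply: cvgM => //; apply: cvgD => //; exact: cvg_cst.
  + by apply: cvgM; [apply: cvgB => //|]; exact: cvg_cst.
- by rewrite ge_min fb orbT /= le_max f1.
by exists x; split=> //; apply: (@lt_le_trans _ _ 1) => //; rewrite xb.
Qed.

Lemma nu_gt0 : 0 < nu R n k.
Proof.
rewrite /nu; case: xgetP => [x _ []//|] /forallNP [].
exact: nu_fun_zero_exists.
Qed.

Lemma nu_root : nu_fun n k (nu R n k) = 0.
Proof.
rewrite /nu; case: xgetP => [x _ []//|] /forallNP [].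
exact: nu_fun_zero_exists.
Qed.

(* x |-> nu_fun n k x / x is strictly decreasing. *)
Lemma nu_fun_decr (x y : R) : 0 < x -> x < y ->
  x * nu_fun n k y < y * nu_fun n k x.
Proof.
move=> x0 xy; have y0 : 0 < y by lra.
have n1 : 1 <= n%:R :> R by rewrite ler1n.
have ln_n : 0 <= ln n%:R :> R by exact: ln_ge0.
have ln_x : ln x <= x - 1.
  have -> : ln x = ln (1 + (x - 1)) by congr ln; ring.
  by apply: le_ln1Dx; lra.
have ln_yx : y - x <= y * (ln y - ln x).
  have xy0 : 0 < x / y by rewrite divr_gt0.
  have h : ln x - ln y <= x / y - 1.
    rewrite -ln_div ?posrE//; have -> : ln (x / y) = ln (1 + (x / y - 1)).
      by congr ln; ring.
    by apply: le_ln1Dx; lra.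
  have : y * (ln x - ln y) <= y * (x / y - 1) by rewrite ler_pM2l.
  have -> : y * (x / y - 1) = x - y by field; lra.
  lra.
have ln_xy : ln x < ln y by rewrite ltr_ln ?posrE.
rewrite -subr_gt0 /nu_fun.
have -> : y * (x * ln k%:R + x - (x + 1 / 2) * ln x - (x - 1) * ln n%:R) -
  x * (y * ln k%:R + y - (y + 1 / 2) * ln y - (y - 1) * ln n%:R) =
  x * (y * (ln y - ln x)) + (x * (ln y - ln x) - (y - x) * ln x) / 2
  + (y - x) * ln n%:R by field.
have h1 : x * (y - x) <= x * (y * (ln y - ln x)) by rewrite ler_pM2l.
have h2 : (y - x) * ln x <= (y - x) * (x - 1) by rewrite ler_pM2l// subr_gt0.
have h3 : 0 <= (y - x) * ln n%:R by rewrite mulr_ge0//; lra.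
have h4 : 0 < x * (ln y - ln x) by rewrite mulr_gt0// subr_gt0.
have h5 : 0 < x * (y - x) by rewrite mulr_gt0// subr_gt0.
nra.
Qed.

Lemma nu_unique (x : R) : 0 < x -> nu_fun n k x = 0 -> x = nu R n k.
Proof.
move=> x0 fx0; have y0 := nu_gt0; have fy0 := nu_root.
case: (ltgtP x (nu R n k)) => // [/(nu_fun_decr x0)|/(nu_fun_decr y0)];
  by rewrite fx0 fy0 !mulr0 ltxx.
Qed.

End NuTheory.

(* Main.v *)
Require Import Defs.
From mathcomp Require Import all_boot all_order all_algebra.
From mathcomp Require Import all_classical all_reals all_analysis.
From mathcomp Require Import ring lra zify fintype finset.
Import numFieldNormedType.Exports.
Import Order.TTheory GRing.Theory Num.Theory.

(** Let G(n,m) be the uniform random graph with n vertices and m edges, and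
    G(n,p) the binomial one. In the range m <= n/2 + O(n^(2/3)) the graph G(n,m)
    is planar with probability bounded away from 0, so that it suffices to prove
    the concentration of the maximum degree for G(n,m).

    Planarity. Planarity is replaced by the decreasing property A that the
    graph has a straight-line drawing with all its vertices on a parabola. For
    p = (1 - 2 n^(-1/3))/n, a first moment computation shows that with
    probability at least 3/4 no component has two cycles, which implies A. The
    edge probabilities are then raised to (1 + D n^(-1/3))/n one after the
    other. An edge uv can only destroy A if u and v are already connected. This
    is an increasing event, so by Harris' inequality conditioning on A does not
    make it more likely. The total cost is therefore governed by the sum over
    u, v of the probabilities that u and v are connected, which is O(n^(4/3))
    because the expected size of a component is O(n^(1/3)); the latter follows
    from a supermartingale of the exploration process. As A is decreasing, the
    bound can be transferred from G(n,p) to G(n,m).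

    Degrees. The expected number of vertices of degree at least d is about
    n (2m/n)^d / d!, which is exp (nu_fun n (2m) d) up to a constant factor. The
    slope of nu_fun at its zero nu tends to minus infinity uniformly in m. Hence
    this number tends to 0 for d >= nu + eps, and to infinity for d <= nu - eps,
    where the second moment method in G(n,p) applies. *)

Set Implicit Arguments.
Unset Strict Implicit.
Unset Printing Implicit Defensive.

Local Open Scope set_scope.
Local Open Scope ring_scope.

(** * Random subsets whose elements are chosen independently *)

Section ProductMeasure.
Variables (R : realFieldType) (T : finType).
Implicit Types (p q : T -> R) (f g : {set T} -> R) (E : {set T}) (e : T).

(** Topological planarity is awkward to follow while edges are added. An order of the vertices
    without interleaved chords is a finite object: it can be rotated cyclically and concatenated
    with another one, which suffices to add an edge between two components. The two ends of the
    sprinkling are dictated by the window. The first moment of the obstructions is of order t / (1 -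
    n t)^3, which stays bounded only if 1 - n t is at least of order n^(-1/3). At the upper end the
    number of edges has standard deviation of order n^(1/2), far below n^(2/3), so D = 2 C + 4 puts
    its mean safely above m. The edge probabilities thus rise by O(n^(-4/3)), which just balances
    the sum O(n^(4/3)). As m is an arbitrary function of n and may even stay bounded, all estimates
    concern a fixed pair (n, m) with explicit constants, and limits are taken only at the very end.
    The second moment method needs d^2 / m to be small, which fails for small m. It is used only for
    d >= 2, where d <= nu already forces m to be of order n^(1/2) at least; the lower bound 1 for
    the maximum degree is trivial, because there is an edge. *)

Definition weight p E : R := \prod_e (if e \in E then p e else 1 - p e).

Definition expec p f : R := \sum_(E : {set T}) weight p E * f E.

Definition pr p (A : pred {set T}) : R := expec p (fun E => (A E)%:R).

(** The conditional expectation of [f] given the state of all elements other than [e]. Averaging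
    over one element at a time reduces the results below to statements about two points, by
    induction on the list of averaged elements. *)
Definition avg p e f : {set T} -> R :=
  fun E => p e * f (e |: E) + (1 - p e) * f (E :\ e).

Definition is_prob p := forall e, 0 <= p e <= 1.

Definition increasing f := forall E E' : {set T}, E \subset E' -> f E <= f E'.
Definition decreasing f := forall E E' : {set T}, E \subset E' -> f E' <= f E.

Lemma sum_split_set e f :
  \sum_E f E = \sum_(E : {set T} | e \notin E) (f E + f (e |: E)).
Proof.
rewrite (bigID (fun E : {set T} => e \notin E)) /= big_split /=; congr (_ + _).
rewrite (reindex_onto (fun E => e |: E) (fun E => E :\ e)) /=.
  apply: eq_bigl => E; rewrite negbK setU11 /=.
  by apply/eqP/idP => [<-|eE]; [rewrite setD11 | rewrite setU1K].
by move=> E; rewrite negbK => eE; rewrite setD1K.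
Qed.

Lemma weightD1 p e E : weight p E =
  (if e \in E then p e else 1 - p e)
  * \prod_(i | i != e) (if i \in E then p i else 1 - p i).
Proof. by rewrite /weight (bigD1 e). Qed.

Lemma setD1_notin e E : e \notin E -> E :\ e = E.
Proof.
move=> eE; apply/setP => x; rewrite !inE; case: eqP => // ->.
by rewrite (negbTE eE).
Qed.

Lemma setU1D1 e E : e |: (E :\ e) = e |: E.
Proof. by apply/setP => x; rewrite !inE; case: eqP. Qed.

Lemma setD1U1 e E : (e |: E) :\ e = E :\ e.
Proof. by apply/setP => x; rewrite !inE; case: eqP. Qed.

Lemma expec_avg p e f : expec p (avg p e f) = expec p f.
Proof.
rewrite /expec !(sum_split_set e); apply: eq_bigr => E eE.
rewrite !(weightD1 p e) setU11 (negbTE eE).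
have -> : \prod_(i | i != e) (if i \in e |: E then p i else 1 - p i) =
    \prod_(i | i != e) (if i \in E then p i else 1 - p i).
  by apply: eq_bigr => i ie; rewrite !inE (negbTE ie).
rewrite /avg setUA setUid setU1K // setD1_notin //; ring.
Qed.

Lemma expec_sum p (I : Type) (r : seq I) (P : pred I) (F : I -> {set T} -> R) :
  expec p (fun E => \sum_(i <- r | P i) F i E) =
  \sum_(i <- r | P i) expec p (F i).
Proof.
rewrite /expec exchange_big /=; apply: eq_bigr => E _.
by rewrite mulr_sumr.
Qed.

Lemma expecD p f g :
  expec p (fun E => f E + g E) = expec p f + expec p g.
Proof. by rewrite /expec -big_split /=; apply: eq_bigr => E _; rewrite mulrDr. Qed.

Lemma expecZ p (c : R) f : expec p (fun E => c * f E) = c * expec p f.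
Proof. by rewrite /expec mulr_sumr; apply: eq_bigr => E _; rewrite mulrCA. Qed.

Lemma eq_expec p f g : f =1 g -> expec p f = expec p g.
Proof. by move=> fg; apply: eq_bigr => E _; rewrite fg. Qed.

Lemma weight_ge0 p E : is_prob p -> 0 <= weight p E.
Proof.
move=> pp; apply: prodr_ge0 => e _; have /andP[h1 h2] := pp e.
by case: ifP => // _; rewrite subr_ge0.
Qed.

Lemma le_expec p f g : is_prob p -> (forall E, f E <= g E) ->
  expec p f <= expec p g.
Proof.
move=> pp fg; apply: ler_sum => E _; rewrite ler_wpM2l //.
exact: weight_ge0.
Qed.

Lemma expec_foldr p (s : seq T) f : expec p (foldr (avg p) f s) = expec p f.
Proof. by elim: s f => //= x s IH f; rewrite expec_avg. Qed.

Lemma expec_prod p (c : T -> bool -> R) :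
  expec p (fun E => \prod_e c e (e \in E)) =
  \prod_e (p e * c e true + (1 - p e) * c e false).
Proof.
transitivity (\sum_(E : {set T}) \prod_e
    ((if e \in E then p e else 1 - p e) * c e (e \in E))).
  by apply: eq_bigr => E _; rewrite /weight -big_split.
under [RHS]eq_bigr => e _.
  rewrite (_ : _ + _ = \sum_(b : bool) (if b then p e else 1 - p e) * c e b).
    over.
  by rewrite big_bool.
rewrite bigA_distr_bigA /=.
rewrite (reindex (fun f : {ffun T -> bool} => [set e | f e])) /=.
  by apply: eq_bigr => f _; apply: eq_bigr => e _; rewrite inE.
exists (fun E => [ffun e => e \in E]) => [f _|E _].
  by apply/ffunP => e; rewrite ffunE inE.
by apply/setP => e; rewrite inE ffunE.
Qed.

Lemma expec_cst p (c : R) : expec p (fun=> c) = c.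
Proof.
rewrite (@eq_expec _ _ (fun E => c * \prod_(e : T) 1)); last first.
  by move=> E; rewrite big1_eq mulr1.
rewrite expecZ (expec_prod p (fun _ _ => 1)) big1 ?mulr1 // => e _.
by rewrite !mulr1 subrKC.
Qed.

Lemma foldr_avg_indep p (s : seq T) f E E' :
  (forall e, e \notin s -> (e \in E) = (e \in E')) ->
  foldr (avg p) f s E = foldr (avg p) f s E'.
Proof.
elim: s E E' => [|x s IH] E E' h /=.
  by congr f; apply/setP => e; apply: h.
rewrite /avg; congr (_ * _ + _ * _); apply: IH => e es; rewrite !inE;
  case: eqP => //= /eqP ex; apply: h; by rewrite inE (negbTE ex).
Qed.

(** Once all elements are averaged out the function is constant, so [set0] is an arbitrary point of
    evaluation. *)
Lemma expecE p f : expec p f = foldr (avg p) f (enum T) set0.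
Proof.
rewrite -(expec_foldr p (enum T)).
rewrite -[RHS](expec_cst p); apply: eq_expec => E.
by apply: foldr_avg_indep => e; rewrite mem_enum.
Qed.

Lemma avg_increasing p e f : is_prob p -> increasing f -> increasing (avg p e f).
Proof.
move=> pp inc E E' EE'; have /andP[h1 h2] := pp e.
by apply: lerD; apply: ler_wpM2l; rewrite ?subr_ge0 //; apply: inc;
  [apply: setUS | apply: setSD].
Qed.

Lemma avg_decreasing p e f : is_prob p -> decreasing f -> decreasing (avg p e f).
Proof.
move=> pp inc E E' EE'; have /andP[h1 h2] := pp e.
by apply: lerD; apply: ler_wpM2l; rewrite ?subr_ge0 //; apply: inc;
  [apply: setUS | apply: setSD].
Qed.

(** Averaging preserves monotonicity, so it is enough to treat one element, where the covariance is
    [t * (1 - t)] times the product of the two increments, and these have opposite signs. *)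
Lemma harris p f g : is_prob p -> increasing f -> decreasing g ->
  expec p (fun E => f E * g E) <= expec p f * expec p g.
Proof.
move=> pp inc dec; rewrite !expecE.
suff: forall s, [/\ increasing (foldr (avg p) f s),
    decreasing (foldr (avg p) g s) &
    forall E, foldr (avg p) (fun E => f E * g E) s E <=
       foldr (avg p) f s E * foldr (avg p) g s E].
  by move=> /(_ (enum T))[].
elim=> [|x s [IH1 IH2 IH3]] //=; split.
- exact: avg_increasing.
- exact: avg_decreasing.
move=> E; have /andP[h1 h2] := pp x.
set F := foldr _ f s in IH1 IH3 *; set G := foldr _ g s in IH2 IH3 *.
have sub : E :\ x \subset x |: E by rewrite subDset setUA setUid subsetUr.
have F01 := IH1 _ _ sub; have G01 := IH2 _ _ sub.
apply: (@le_trans _ _ (avg p x (fun E => F E * G E) E)).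
  by apply: lerD; apply: ler_wpM2l; rewrite ?subr_ge0.
rewrite /avg; move: F01 G01 h1 h2; clear.
move: (F (x |: E)) (F (E :\ x)) (G (x |: E)) (G (E :\ x)) (p x) =>
  f1 f0 g1 g0 t F01 G01 h1 h2.
rewrite -subr_ge0.
have -> : (t * f1 + (1 - t) * f0) * (t * g1 + (1 - t) * g0)
   - (t * (f1 * g1) + (1 - t) * (f0 * g0)) = t * (1 - t) * ((f1 - f0) * (g0 - g1)).
  by ring.
by rewrite mulr_ge0 // mulr_ge0 // subr_ge0.
Qed.

(** Every element lies either in [S] or outside of it, so at each averaging step one of the two
    factors ignores it and can be pulled out. *)
Lemma expec_indep p (S : {set T}) f g :
  (forall E E' : {set T}, E :&: S = E' :&: S -> f E = f E') ->
  (forall E E' : {set T}, E :\: S = E' :\: S -> g E = g E') ->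
  expec p (fun E => f E * g E) = expec p f * expec p g.
Proof.
move=> fS gS; rewrite !expecE.
suff: forall s, [/\ forall E E' : {set T}, E :&: S = E' :&: S ->
      foldr (avg p) f s E = foldr (avg p) f s E',
    forall E E' : {set T}, E :\: S = E' :\: S ->
      foldr (avg p) g s E = foldr (avg p) g s E' &
    forall E, foldr (avg p) (fun E => f E * g E) s E =
       foldr (avg p) f s E * foldr (avg p) g s E].
  by move=> /(_ (enum T))[].
elim=> [|x s [IH1 IH2 IH3]] //=; split.
- move=> E E' EE'; rewrite /avg; congr (_ * _ + _ * _); apply: IH1.
    by rewrite !setIUl EE'.
  by rewrite setIDAC EE' setIDAC.
- move=> E E' EE'; rewrite /avg; congr (_ * _ + _ * _); apply: IH2.
    by rewrite !setDUl EE'.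
  by rewrite !setDDl setUC -!setDDl EE'.
move=> E; rewrite /avg !IH3.
have [xS|xS] := boolP (x \in S).
  have gE : forall E', foldr (avg p) g s (x |: E') = foldr (avg p) g s (E' :\ x).
    by move=> E'; apply: IH2; apply/setP => y; rewrite !inE; case: eqP => // ->; rewrite xS.
  by rewrite gE; ring.
have fE : forall E', foldr (avg p) f s (x |: E') = foldr (avg p) f s (E' :\ x).
  move=> E'; apply: IH1; apply/setP => y; rewrite !inE; case: eqP => // ->.
  by rewrite (negbTE xS) !andbF.
by rewrite fE; ring.
Qed.

Lemma foldr_avg_invar p (s : seq T) e f :
  (forall E, f (e |: E) = f (E :\ e)) ->
  forall E, foldr (avg p) f s (e |: E) = foldr (avg p) f s (E :\ e).
Proof.
move=> fe; elim: s => [|x s IH] E //=; rewrite /avg.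
have [->|xe] := eqVneq x e.
  by rewrite setUA setUid setU1D1 setD1U1 !setDDl setUid.
congr (_ * _ + _ * _).
  rewrite setUCA IH; congr (foldr _ _ _ _); apply/setP => y; rewrite !inE.
  by case: (eqVneq y x) => [->|_] //=; rewrite xe.
have -> : (e |: E) :\ x = e |: (E :\ x).
  apply/setP => y; rewrite !inE; case: (eqVneq y x) => [->|_] /=; by rewrite ?(negbTE xe).
by rewrite IH !setDDl setUC.
Qed.

Lemma foldr_avg_change p q (s : seq T) e f :
  (forall x, x != e -> p x = q x) -> (forall E, f (e |: E) = f (E :\ e)) ->
  forall E, foldr (avg p) f s E = foldr (avg q) f s E.
Proof.
move=> pq fe; elim: s => [|x s IH] E //=.
have [->|xe] := eqVneq x e; last by rewrite /avg !IH pq.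
rewrite /avg !IH !(foldr_avg_invar _ _ fe); ring.
Qed.

Lemma expec_change p q e f : (forall x, x != e -> p x = q x) ->
  (forall E, f (e |: E) = f (E :\ e)) -> expec p f = expec q f.
Proof. by move=> pq fe; rewrite !expecE; apply: foldr_avg_change fe _. Qed.

Lemma expec_split p e f : expec p f =
  p e * expec p (fun E => f (e |: E)) + (1 - p e) * expec p (fun E => f (E :\ e)).
Proof. by rewrite -(expec_avg p e) -!expecZ -expecD. Qed.

Lemma expec_mono p q f : is_prob p -> is_prob q -> (forall e, p e <= q e) ->
  increasing f -> expec p f <= expec q f.
Proof.
move=> pp qq pq inc; rewrite !expecE.
suff: forall s, increasing (foldr (avg p) f s) /\
    forall E, foldr (avg p) f s E <= foldr (avg q) f s E.
  by move=> /(_ (enum T))[].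
elim=> [|x s [IH1 IH2]] //=; split; first exact: avg_increasing.
move=> E; have /andP[h1 h2] := pp x; have /andP[h3 h4] := qq x.
have sub : E :\ x \subset x |: E by rewrite subDset setUA setUid subsetUr.
have := IH1 _ _ sub; have := IH2 (x |: E); have := IH2 (E :\ x); have := pq x.
rewrite /avg; move: h1 h2 h3 h4; clear.
move: (foldr (avg p) _ _ (E :\ x)) (foldr (avg q) _ _ (E :\ x)) => f0 g0.
move: (foldr (avg p) _ _ _) (foldr (avg q) _ _ _) => f1 g1.
move: (p x) (q x) => a b a0 a1 b0 b1 ab fg0 fg1 f01.
apply: (@le_trans _ _ (b * f1 + (1 - b) * f0)); last first.
  by apply: lerD; apply: ler_wpM2l => //; rewrite subr_ge0.
rewrite -subr_ge0.
have -> : b * f1 + (1 - b) * f0 - (a * f1 + (1 - a) * f0) = (b - a) * (f1 - f0).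
  by ring.
by rewrite mulr_ge0 // subr_ge0.
Qed.

End ProductMeasure.

(** * Probabilities of events, sprinkling, variance *)

Section Probability.
Variables (R : realFieldType) (T : finType).
Implicit Types (p q : T -> R) (f g : {set T} -> R) (E : {set T}) (e : T).
Implicit Types (A B : pred {set T}).

Definition down_closed A := forall E E' : {set T}, E \subset E' -> A E' -> A E.
Definition up_closed A := forall E E' : {set T}, E \subset E' -> A E -> A E'.

Lemma down_closed_decreasing A : down_closed A ->
  decreasing (fun E => (A E)%:R : R).
Proof.
move=> dA E E' /dA; case: (A E') (A E) => [] [] //= h.
by have := h isT.
Qed.

Lemma up_closed_increasing A : up_closed A ->
  increasing (fun E => (A E)%:R : R).
Proof.
move=> dA E E' /dA; case: (A E') (A E) => [] [] //= h.
by have := h isT.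
Qed.

Lemma expec_ge0 p f : is_prob p -> (forall E, 0 <= f E) -> 0 <= expec p f.
Proof. by move=> pp f0; rewrite -(expec_cst p 0); apply: le_expec. Qed.

Lemma pr_ge0 p A : is_prob p -> 0 <= pr p A.
Proof. by move=> pp; apply: expec_ge0. Qed.

Lemma le_pr p A B : is_prob p -> (forall E, A E -> B E) -> pr p A <= pr p B.
Proof.
move=> pp AB; apply: le_expec => // E; rewrite ler_nat.
by case: (A E) (AB E) => // ->.
Qed.

Lemma pr_le1 p A : is_prob p -> pr p A <= 1.
Proof.
by move=> pp; rewrite -(expec_cst p 1); apply: le_expec => // E; rewrite lern1 leq_b1.
Qed.

Lemma prC p A : pr p (fun E => ~~ A E) = 1 - pr p A.
Proof.
apply/eqP; rewrite eq_sym subr_eq -expecD; apply/eqP.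
by rewrite -[LHS](expec_cst p 1); apply: eq_expec => E; case: (A E); rewrite /= ?addr0 ?add0r.
Qed.

Lemma pr_bound_sum p (I : Type) (r : seq I) (P : pred I) A
    (B : I -> pred {set T}) : is_prob p ->
  (forall E, A E -> has (fun i => P i && B i E) r) ->
  pr p A <= \sum_(i <- r | P i) pr p (B i).
Proof.
move=> pp AB; rewrite /pr -expec_sum; apply: le_expec => // E.
have [/AB|_] := boolP (A E); last by rewrite sumr_ge0.
elim: r {AB} => //= i r IH /orP[/andP[Pi Bi]|/IH h]; rewrite big_cons.
  by rewrite Pi Bi lerDl sumr_ge0.
by case: ifP => // _; apply: le_trans h _; rewrite lerDr.
Qed.

Lemma natr_prod_bool (P : pred T) (b : T -> bool) :
  \prod_(e | P e) (b e)%:R = [forall e, P e ==> b e]%:R :> R.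
Proof.
have [/forallP h|/forallPn[x]] := boolP [forall e, P e ==> b e].
  by rewrite big1 // => e Pe; have := h e; rewrite Pe /= => ->.
rewrite negb_imply => /andP[Px bx].
by rewrite (bigD1 x) //= (negbTE bx) mul0r.
Qed.

Lemma pr_inter p (D S : {set T}) : D \subset S ->
  pr p (fun E => E :&: S == D) =
  \prod_(e in S) (if e \in D then p e else 1 - p e).
Proof.
move=> DS.
transitivity (expec p (fun E =>
    \prod_e (if e \in S then (e \in E) == (e \in D) else true)%:R)).
  apply: eq_expec => E; rewrite natr_prod_bool; congr (_%:R); congr nat_of_bool.
  apply/eqP/forallP => [<- e|h]; first by rewrite inE; case: (e \in S); rewrite ?andbT ?eqxx.
  apply/setP => e; rewrite inE; have := h e; case: ifP => [_ /eqP -> |eS _].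
    by rewrite andbT.
  by rewrite andbF; apply/esym/negbTE/negP => /(subsetP DS); rewrite eS.
rewrite (expec_prod p (fun e b => (if e \in S then b == (e \in D) else true)%:R)).
rewrite [RHS]big_mkcond; apply: eq_bigr => e _.
by case: (e \in S); case: (e \in D) => /=; ring.
Qed.

Lemma pr_subset p (S : {set T}) : pr p (fun E => S \subset E) = \prod_(e in S) p e.
Proof.
rewrite (eq_bigr (fun e => if e \in S then p e else 1 - p e)); last first.
  by move=> e ->.
rewrite -pr_inter //; apply: eq_expec => E; congr (_%:R); congr nat_of_bool.
by rewrite (sameP setIidPr eqP).
Qed.

Lemma pr_mem p e : pr p (fun E => e \in E) = p e.
Proof.
have <- : \prod_(i in [set e]) p i = p e by rewrite big_set1.
rewrite -pr_subset; by apply: eq_expec => E; rewrite sub1set.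
Qed.

(** The ratio [(q e - p e) / (1 - p e)] is the probability that [e] is added, given that it was
    absent. Each element costs one factor; since [B e] is increasing, its probability under every
    intermediate measure is at most that under [q]. *)
Lemma sprinkling p q A (B : T -> pred {set T}) :
  is_prob p -> is_prob q -> (forall e, p e <= q e) -> (forall e, p e < 1) ->
  down_closed A -> (forall e, up_closed (B e)) ->
  (forall E e, A E -> ~~ A (e |: E) -> B e E) ->
  (forall e, (q e - p e) / (1 - p e) * pr q (B e) <= 1) ->
  pr p A * \prod_e (1 - (q e - p e) / (1 - p e) * pr q (B e)) <= pr q A.
Proof.
move=> pp qq pq p1 dA uB AB small.
(* The intermediate measure in which exactly the elements of [s] have been raised from [p] to
   [q]. *)
pose r (s : seq T) e := if e \in s then q e else p e.
have rr s : is_prob (r s) by move=> e; rewrite /r; case: ifP.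
suff: forall s, uniq s ->
    pr p A * \prod_(e <- s) (1 - (q e - p e) / (1 - p e) * pr q (B e))
    <= pr (r s) A.
  move=> /(_ _ (enum_uniq T)); rewrite big_enum /= => /le_trans; apply.
  rewrite /pr /expec le_eqVlt; apply/orP; left; apply/eqP; apply: eq_bigr => E _.
  by congr (_ * _); apply: eq_bigr => e _; rewrite /r mem_enum.
elim=> [_|x s IH /= /andP[xs /IH{}IH]].
  by rewrite big_nil mulr1 /pr /expec; apply: ler_sum => E _.
rewrite big_cons mulrCA.
set b := pr q (B x); set t := (q x - p x) / (1 - p x).
apply: (@le_trans _ _ ((1 - t * b) * pr (r s) A)).
  by rewrite ler_wpM2l // subr_ge0; apply: small.
have rx : r s x = p x by rewrite /r (negbTE xs).
have rx' : r (x :: s) x = q x by rewrite /r inE eqxx.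
(* Conditioned on the state of [x], the event no longer depends on the probability of [x], so [F1]
   and [F0] are the same before and after raising it. *)
have chg f : (forall E, f (x |: E) = f (E :\ x)) ->
    expec (r s) f = expec (r (x :: s)) f.
  apply: expec_change => e ex; rewrite /r inE (negbTE ex) //.
pose f E := (A E)%:R : R.
have e1 : pr (r s) A = p x * expec (r (x :: s)) (fun E => f (x |: E)) +
   (1 - p x) * expec (r (x :: s)) (fun E => f (E :\ x)).
  rewrite /pr (expec_split _ x) rx; congr (_ * _ + _ * _); apply: chg => E.
    by rewrite setU1D1 setUA setUid.
  by rewrite setD1U1 setDDl setUid.
have e2 : pr (r (x :: s)) A = q x * expec (r (x :: s)) (fun E => f (x |: E)) +
   (1 - q x) * expec (r (x :: s)) (fun E => f (E :\ x)).
  by rewrite /pr (expec_split _ x) rx'.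
rewrite e1 e2.
set F1 := expec _ (fun E => f (x |: E)); set F0 := expec _ (fun E => f (E :\ x)).
(* [F0 - F1] is the probability that adding [x] destroys [A]. In that case [B x] holds, and Harris'
   inequality separates it from the decreasing event [A (E :\ x)]. *)
have F10 : F0 - F1 <= b * F0.
  apply: (@le_trans _ _ (expec (r (x :: s)) (fun E => (B x E)%:R * f (E :\ x)))).
    rewrite lerBlDr -expecD; apply: le_expec => // E; rewrite /f.
    have [A0|A0] := boolP (A (E :\ x)); last by rewrite mulr0 addr_ge0.
    rewrite mulr1; have [A1|A1] := boolP (A (x |: E)); first by rewrite lerDr.
    have -> : B x E; last by rewrite addr0.
    apply: (uB x (E :\ x)); first exact: subD1set.
    by apply: AB; rewrite // setU1D1.
  apply: (@le_trans _ _ (pr (r (x :: s)) (B x) * F0)).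
    apply: harris => //; first exact: up_closed_increasing.
    move=> E E' EE'; apply: (down_closed_decreasing dA); exact: setSD.
  apply: ler_wpM2r; first by apply: expec_ge0.
  apply: expec_mono => //; last exact: up_closed_increasing.
  by move=> e; rewrite /r; case: ifP.
have F1p : 0 <= F1 by apply: expec_ge0.
have F0p : 0 <= F0 by apply: expec_ge0.
have bp : 0 <= b by apply: pr_ge0.
have /andP[p0 _] := pp x; have /andP[q0 _] := qq x.
have tE : t * (1 - p x) = q x - p x by rewrite /t divfK // subr_eq0 eq_sym lt_eqF.
have t0 : 0 <= t.
  by rewrite /t mulr_ge0 ?invr_ge0 ?subr_ge0 // ltW.
have h1 : (q x - p x) * (F0 - F1) <= (q x - p x) * (b * F0).
  by rewrite ler_wpM2l // subr_ge0.
rewrite -subr_ge0.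
have -> : q x * F1 + (1 - q x) * F0 - (1 - t * b) * (p x * F1 + (1 - p x) * F0) =
   (t * b) * (p x * F1) + b * (t * (1 - p x)) * F0 - (q x - p x) * (F0 - F1) by ring.
rewrite tE.
have h2 : 0 <= t * b * (p x * F1) by apply: mulr_ge0; apply: mulr_ge0.
have -> : t * b * (p x * F1) + b * (q x - p x) * F0 - (q x - p x) * (F0 - F1) =
  t * b * (p x * F1) + ((q x - p x) * (b * F0) - (q x - p x) * (F0 - F1)) by ring.
by rewrite addr_ge0 // subr_ge0.
Qed.

Lemma expec_var p :
  expec p (fun E => (\sum_e ((e \in E)%:R - p e)) ^+ 2) = \sum_e p e * (1 - p e).
Proof.
under eq_expec do rewrite expr2 mulr_suml; rewrite expec_sum.
apply: eq_bigr => e _.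
under eq_expec do rewrite mulr_sumr; rewrite expec_sum (bigD1 e) //= big1.
  rewrite addr0.
  rewrite (@eq_expec _ _ _ _ (fun E => (1 - 2 * p e) * (e \in E)%:R + p e ^+ 2)).
    by rewrite expecD expecZ [expec _ _]pr_mem expec_cst; ring.
  by move=> E; case: (e \in E) => /=; ring.
move=> e' ee'.
have Z x : expec p (fun E => (x \in E)%:R - p x) = 0.
  by rewrite expecD [expec _ _]pr_mem expec_cst subrr.
rewrite (@expec_indep _ _ p [set e] (fun E => (e \in E)%:R - p e)
   (fun E => (e' \in E)%:R - p e')) ?Z ?mul0r // => E E' /setP.
  by move=> /(_ e); rewrite !inE eqxx !andbT => ->.
by move=> /(_ e'); rewrite !inE ee' /= => ->.
Qed.

Lemma pr_markov p f (a : R) : is_prob p -> 0 < a -> (forall E, 0 <= f E) ->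
  pr p (fun E => a <= f E) <= expec p f / a.
Proof.
move=> pp a0 f0; rewrite ler_pdivlMr // mulrC -expecZ; apply: le_expec => // E.
by case: (leP a (f E)) => h; rewrite ?mulr1 ?mulr0.
Qed.

End Probability.

(** * Binomial random sets versus uniform random sets of a given size *)

Section Binomial.
Variables (R : realFieldType) (T : finType) (K : {set T}).
Implicit Types (A B : pred {set T}) (E : {set T}) (e : T) (t : R).

Definition draws m : {set {set T}} := [set E : {set T} | E \subset K & #|E| == m].

Definition draw_pr m A : R := #|[set E in draws m | A E]|%:R / #|draws m|%:R.

(** Elements outside of [K] have probability 0. For graphs the ground type consists of all vertex
    sets, and [K] of those with two elements. *)
Definition unif t : T -> R := fun e => if e \in K then t else 0.

Lemma unif_prob t : 0 <= t <= 1 -> is_prob (unif t).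
Proof. by move=> ht e; rewrite /unif; case: ifP => // _; rewrite lexx ler01. Qed.

Lemma card_draws_bin m : #|draws m| = 'C(#|K|, m).
Proof. by rewrite -cards_draws. Qed.

Lemma weight_unif t E : E \subset K ->
  weight (unif t) E = t ^+ #|E| * (1 - t) ^+ (#|K| - #|E|).
Proof.
move=> EK; rewrite /weight (bigID (fun e => e \in E)) /=; congr (_ * _).
  rewrite -prodr_const; apply: eq_bigr => e eE.
  by rewrite eE /unif (subsetP EK).
rewrite (bigID (fun e => e \in K)) /= mulrC big1 ?mul1r.
  have -> : (#|K| - #|E| = #|K :\: E|)%N by rewrite cardsD (setIidPr EK).
  rewrite -prodr_const; apply: eq_big => [e|e /andP[/negbTE-> eK]].
    by rewrite inE.
  by rewrite /unif eK.
by move=> e /andP[/negbTE-> /negbTE]; rewrite /unif => ->; rewrite subr0.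
Qed.

Lemma weight_unif0 t E : ~~ (E \subset K) -> weight (unif t) E = 0.
Proof.
move=> /subsetPn[e eE eK]; rewrite /weight (bigD1 e) //= eE /unif (negbTE eK).
by rewrite mul0r.
Qed.

Lemma pr_layer t m A : pr (unif t) (fun E => A E && (#|E| == m)) =
  #|[set E in draws m | A E]|%:R * (t ^+ m * (1 - t) ^+ (#|K| - m)).
Proof.
rewrite /pr /expec (bigID (fun E => (E \in draws m) && A E)) /=.
rewrite [X in _ + X]big1 ?addr0.
  rewrite (eq_bigr (fun=> t ^+ m * (1 - t) ^+ (#|K| - m))); last first.
    move=> E; rewrite inE => /andP[/andP[EK /eqP Em] AE].
    by rewrite AE Em eqxx mulr1 weight_unif // Em.
  rewrite sumr_const mulr_natl; congr (_ *+ _).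
  by apply: eq_card => E; rewrite [RHS]inE.
move=> E; rewrite inE => h.
have [EK|/weight_unif0->] := boolP (E \subset K); last by rewrite mul0r.
rewrite EK /= in h; have -> : A E && (#|E| == m) = false; last by rewrite mulr0.
by apply/negbTE; rewrite andbC.
Qed.

Lemma draws_gt0 m : (m <= #|K|)%N -> 0 < #|draws m|%:R :> R.
Proof. by move=> mK; rewrite ltr0n card_draws_bin bin_gt0. Qed.

Lemma draw_pr_layer t m A : (m <= #|K|)%N ->
  pr (unif t) (fun E => A E && (#|E| == m)) =
  draw_pr m A * pr (unif t) (fun E => #|E| == m).
Proof.
move=> mK.
have := pr_layer t m xpredT; rewrite /= => ->; rewrite pr_layer /draw_pr.
have -> : [set E in draws m | true] = draws m by apply/setP => E; rewrite inE andbT.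
by rewrite [RHS]mulrA divfK // gt_eqF // draws_gt0.
Qed.

(** Double counting of pairs: removing [e] from a set [E] of size [m.+1] in [A] leaves a set of size
    [m] that is still in [A], and the pair of the smaller set and [e] determines [E]. *)
Lemma draw_count_step m A : down_closed A ->
  (m.+1 * #|[set E in draws m.+1 | A E]| <=
   (#|K| - m) * #|[set E in draws m | A E]|)%N.
Proof.
move=> dA.
pose P (x : {set T} * T) := [&& x.1 \in draws m.+1, A x.1 & x.2 \in x.1].
pose Q (x : {set T} * T) := [&& x.1 \in draws m, A x.1, x.2 \in K & x.2 \notin x.1].
have -> : (m.+1 * #|[set E in draws m.+1 | A E]| = #|[set x | P x]|)%N.
  rewrite -[RHS]sum1_card mulnC -sum_nat_const.
  rewrite (eq_bigr (fun E : {set T} => \sum_(e in E) 1)%N); last first.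
    by move=> E; rewrite !inE => /andP[/andP[_ /eqP <-]] _; rewrite sum1_card.
  rewrite pair_big_dep /=; apply: eq_bigl => -[E e]; by rewrite !inE /P /= !inE -!andbA.
have -> : ((#|K| - m) * #|[set E in draws m | A E]| = #|[set x | Q x]|)%N.
  rewrite -[RHS]sum1_card mulnC -sum_nat_const.
  rewrite (eq_bigr (fun E : {set T} => \sum_(e in K :\: E) 1)%N); last first.
    move=> E; rewrite !inE => /andP[/andP[EK /eqP <-]] _.
    by rewrite sum1_card cardsD (setIidPr EK).
  rewrite pair_big_dep /=; apply: eq_bigl => -[E e]; rewrite !inE /Q /= !inE -!andbA.
  by rewrite [(e \notin E) && _]andbC.
pose F (x : {set T} * T) := (x.1 :\ x.2, x.2).
rewrite -(card_in_imset (f := F) (D := [set x | P x])); last first.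
  move=> [E e] [E' e']; rewrite !inE /P /F /= => /and3P[_ _ eE] /and3P[_ _ eE'].
  by move=> [EE ee]; subst e'; rewrite -(setD1K eE) -(setD1K eE') EE.
apply: subset_leq_card; apply/subsetP => _ /imsetP[[E e] + ->].
rewrite !inE /P /Q /F /= => /and3P[]; rewrite !inE eqxx /= => /andP[EK /eqP Em] AE eE.
rewrite (subset_trans (subD1set _ _) EK) (subsetP EK) // !andbT.
rewrite (dA _ _ (subD1set _ _) AE) andbT /=.
by rewrite -eqSS -Em (cardsD1 e E) eE.
Qed.

(** The local LYM inequality: the double count is compared with the identity [mul_bin_left], which
    is its equality case for all draws. *)
Lemma draw_pr_decr A m m' : down_closed A -> (m <= m')%N -> (m' <= #|K|)%N ->
  draw_pr m' A <= draw_pr m A.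
Proof.
move=> dA; elim: m' => [|m' IH]; first by rewrite leqn0 => /eqP ->.
rewrite leq_eqVlt => /predU1P[->//|]; rewrite ltnS => mm' m'K.
apply: le_trans (IH mm' (ltnW m'K)).
rewrite /draw_pr ler_pdivrMr ?draws_gt0 // mulrAC ler_pdivlMr ?draws_gt0 1?ltnW //.
rewrite -!natrM ler_nat !card_draws_bin.
have e2 := draw_count_step m' dA; have e1 := mul_bin_left #|K| m'.
have d0 : (0 < #|K| - m')%N by rewrite subn_gt0.
rewrite -(leq_pmul2l d0) -(leq_pmul2l (ltn0Sn m')).
move: e1 e2; set d := (#|K| - m')%N; set a := #|[set E in draws m'.+1 | _]|.
set b := #|[set E in draws m' | _]|.
set c := 'C(_, m'.+1); set c' := 'C(_, m') => e1 e2.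
have -> : (m'.+1 * (d * (a * c')) = (d * c') * (m'.+1 * a))%N by ring.
have -> : (m'.+1 * (d * (b * c)) = (m'.+1 * c) * (d * b))%N by ring.
by rewrite -e1 leq_mul2l e2 orbT.
Qed.

Lemma draw_pr_ge0 m A : 0 <= draw_pr m A.
Proof. by rewrite /draw_pr divr_ge0. Qed.

Lemma pr_card_sum t A : pr (unif t) A =
  \sum_(m < #|K|.+1) pr (unif t) (fun E => A E && (#|E| == m)).
Proof.
rewrite -expec_sum; apply: eq_bigr => E _.
have [EK|/weight_unif0->] := boolP (E \subset K); last by rewrite !mul0r.
congr (_ * _); rewrite (bigD1 (inord #|E|)) //= inordK ?ltnS ?subset_leq_card //.
rewrite eqxx andbT big1 ?addr0 // => i ie.
case: eqP; rewrite ?andbF // => Ei; move: ie.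
by rewrite -val_eqE /= inordK ?Ei ?eqxx // ltnS -Ei subset_leq_card.
Qed.

(** Given its size, a binomial set is a uniform draw. On the sizes at least [m] the event is at most
    as likely as at size [m]. *)
Lemma pr_le_draw t m A : 0 <= t <= 1 -> down_closed A -> (m <= #|K|)%N ->
  pr (unif t) A <= pr (unif t) (fun E => (#|E| < m)%N) + draw_pr m A.
Proof.
move=> ht dA mK; have pp := unif_prob ht.
apply: (@le_trans _ _ (pr (unif t) (fun E => (#|E| < m)%N) +
    pr (unif t) (fun E => A E && (m <= #|E|)%N))).
  rewrite -expecD; apply: le_expec => // E; rewrite -natrD ler_nat.
  by case: ltnP; case: (A E).
rewrite lerD2l pr_card_sum.
apply: (@le_trans _ _ (\sum_(j < #|K|.+1) draw_pr m A * pr (unif t) (fun E => #|E| == j))).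
  apply: ler_sum => j _; have [mj|jm] := leqP m j; last first.
    rewrite (_ : pr _ _ = 0); first by rewrite mulr_ge0 ?draw_pr_ge0 ?pr_ge0.
    rewrite /pr -(expec_cst (unif t) 0); apply: eq_expec => E.
    by case: eqP => [->|_]; rewrite ?andbF // leqNgt jm andbF.
  have jK : (j <= #|K|)%N by rewrite -ltnS.
  apply: (@le_trans _ _ (pr (unif t) (fun E => A E && (#|E| == j)))).
    by apply: le_pr => // E /andP[/andP[-> _] ->].
  by rewrite draw_pr_layer // ler_wpM2r ?pr_ge0 // draw_pr_decr.
rewrite -mulr_sumr -[leRHS]mulr1 ler_wpM2l ?draw_pr_ge0 //.
have := pr_card_sum t xpredT; rewrite /= => <-; exact: pr_le1.
Qed.

(** The reverse transfer: only the sizes at most [m] are kept, where the event is at least as likely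
    as at size [m]. *)
Lemma draw_pr_le t m A : 0 <= t <= 1 -> down_closed A -> (m <= #|K|)%N ->
  pr (unif t) (fun E => (#|E| <= m)%N) * draw_pr m A <= pr (unif t) A.
Proof.
move=> ht dA mK; have pp := unif_prob ht.
rewrite (pr_card_sum _ A) (pr_card_sum _ (fun E => (#|E| <= m)%N)) mulr_suml.
apply: ler_sum => j _; have [jm|mj] := leqP j m; last first.
  rewrite (_ : pr _ _ = 0); first by rewrite mul0r pr_ge0.
  rewrite /pr -(expec_cst (unif t) 0); apply: eq_expec => E.
  by case: eqP => [->|_]; rewrite ?andbF // leqNgt mj.
have jK : (j <= #|K|)%N by rewrite -ltnS.
rewrite (draw_pr_layer _ A jK) mulrC; apply: ler_pM; rewrite ?draw_pr_ge0 ?pr_ge0 //.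
  exact: draw_pr_decr.
by apply: le_pr => // E /andP[].
Qed.

(** Chebyshev's inequality, with the variance bounded by the mean. *)
Lemma pr_card_dev t (P : pred {set T}) (a : R) : 0 <= t <= 1 -> 0 < a ->
  (forall E, E \subset K -> P E -> a <= `|#|E|%:R - #|K|%:R * t|) ->
  pr (unif t) P <= #|K|%:R * t / a ^+ 2.
Proof.
move=> ht a0 hP; have pp := unif_prob ht.
have a2 : 0 < a ^+ 2 by rewrite exprn_gt0.
have dev E : E \subset K ->
    \sum_e ((e \in E)%:R - unif t e) = #|E|%:R - #|K|%:R * t.
  move=> EK; rewrite sumrB; congr (_ - _).
    by rewrite -sum1_card natr_sum [in RHS]big_mkcond; apply: eq_bigr => e _; case: (e \in E).
  by rewrite /unif -big_mkcond sumr_const mulr_natl.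
apply: (@le_trans _ _ (pr (unif t)
    (fun E => a ^+ 2 <= (\sum_e ((e \in E)%:R - unif t e)) ^+ 2))).
  apply: ler_sum => E _.
  have [EK|/weight_unif0->] := boolP (E \subset K); last by rewrite !mul0r.
  apply: ler_wpM2l; first exact: weight_ge0.
  rewrite ler_nat dev //; case: (P E) (hP E EK) => // /(_ isT) h.
  suff -> : a ^+ 2 <= (#|E|%:R - #|K|%:R * t) ^+ 2 by [].
  by rewrite -[leRHS]real_normK ?num_real // ler_sqr ?nnegrE ?(ltW a0).
apply: le_trans (pr_markov (f := fun E => (\sum_e ((e \in E)%:R - unif t e)) ^+ 2)
  pp a2 _) _; first by move=> E; exact: sqr_ge0.
rewrite expec_var ler_pM2r ?invr_gt0 // /unif.
rewrite (eq_bigr (fun e => if e \in K then t * (1 - t) else 0)); last first.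
  by move=> e _; case: ifP => //; rewrite mul0r.
rewrite -big_mkcond sumr_const -[leLHS]mulr_natl ler_wpM2l // ler_piMr //; lra.
Qed.

End Binomial.

(** * Straight-line drawings on a parabola *)

Section Outerplanar.
Variable (V : finType).
Implicit Types (E : {set {set V}}) (s : seq V) (u v x y : V).

Definition adj E x y := [set x; y] \in E.

Lemma adjC E x y : adj E x y = adj E y x.
Proof. by rewrite /adj setUC. Qed.

Lemma sub_adj E E' x y : E \subset E' -> adj E x y -> adj E' x y.
Proof. by move=> /subsetP; apply. Qed.

Lemma adj_neq E x y : simple_graph E -> adj E x y -> x != y.
Proof. by move=> /forall_inP h /h; rewrite cards2; case: (x != y). Qed.

Lemma simple_graph_sub E E' : E \subset E' -> simple_graph E' -> simple_graph E.
Proof.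
move=> /subsetP s /forall_inP h; apply/forall_inP => e eE; exact: h (s _ eE).
Qed.

(* Graphs with a drawing on the parabola: the vertices are the points
   (r v, (r v)^2) and the edges are the chords. *)
Definition outerplanar E := exists r : V -> nat, injective r /\
  forall a b c d, adj E a b -> adj E c d -> ~~ [&& r a < r c, r c < r b & r b < r d]%N.

Lemma outerplanar_sub E E' : E \subset E' -> outerplanar E' -> outerplanar E.
Proof.
move=> EE' [r [rI h]]; exists r; split=> // a b c d ab cd.
by apply: h; apply: sub_adj; eauto.
Qed.

(** [(x - a) * (b - x)] is the height above the parabola, at abscissa [x], of the chord whose ends
    have abscissas [a] and [b]. Two chords with a common interior point therefore coincide or have
    interleaved ends. *)
Lemma chord_cross (R : realFieldType) (a b c d x : R) : a < b -> c < d ->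
  a < x < b -> c < x < d -> (x - a) * (b - x) = (x - c) * (d - x) ->
  [|| (a == c) && (b == d), [&& a < c, c < b & b < d] | [&& c < a, a < d & d < b]].
Proof.
move=> ab cd /andP[ax xb] /andP[cx xd] h.
have [ac|ac|ac] := ltgtP a c; have [bd|bd|bd] := ltgtP b d => //=.
- by apply/orP; left; apply/andP; split => //; apply: lt_trans xb.
- exfalso; nra.
- exfalso; subst d; nra.
- exfalso; nra.
- by rewrite andbT; apply: lt_trans ax xd.
- exfalso; subst d; nra.
- exfalso; subst c; nra.
- exfalso; subst c; nra.
Qed.

Lemma outerplanar_planar (R : realType) E : simple_graph E -> outerplanar E ->
  planar R E.
Proof.
move=> sE [r [rI ncr]].
pose x v : R := (r v)%:R.
have xI : injective x by move=> u v /eqP; rewrite eqr_nat => /eqP /rI.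
pose pos v : R * R := (x v, x v ^+ 2).
pose seg (w : V * V) (t : R) : R * R :=
  ((1 - t) * x w.1 + t * x w.2, (1 - t) * x w.1 ^+ 2 + t * x w.2 ^+ 2).
pose ends (e : {set V}) :=
  [pick w : V * V | (r w.1 < r w.2)%N && (e == [set w.1; w.2])].
pose arc e t := if ends e is Some w then seg w t else 0.
have arcE e : e \in E -> exists u v, [/\ x u < x v, e = [set u; v] &
    forall t, arc e t = seg (u, v) t].
  move=> eE; rewrite /arc /ends; case: pickP => [[u v] /= /andP[uv /eqP ->]|h].
    by exists u, v; split=> //; rewrite ltr_nat.
  exfalso; have /cards2P[u [v [uv e_uv]]] := forall_inP sE e eE.
  have [uv'|vu|/rI uv'] := ltngtP (r u) (r v).
  - by have := h (u, v); rewrite /= uv' e_uv eqxx.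
  - by have := h (v, u); rewrite /= vu e_uv setUC eqxx.
  - by rewrite uv' eqxx in uv.
have in1 (u v : V) t : x u < x v -> 0 < t < 1 ->
    x u < (1 - t) * x u + t * x v < x v.
  by move=> uv /andP[t0 t1]; apply/andP; split; nra.
(* The height of a point of the chord above the parabola. It is positive in the interior, so that no
   vertex lies there, and it provides the equation required by [chord_cross]. *)
have gap (u v : V) t : (1 - t) * x u ^+ 2 + t * x v ^+ 2 -
    ((1 - t) * x u + t * x v) ^+ 2 =
    (((1 - t) * x u + t * x v) - x u) * (x v - ((1 - t) * x u + t * x v)).
  by ring.
exists pos, arc; split.
- by move=> u v [] /xI.
- move=> e /arcE[u [v [_ _ h]]].
  have -> : arc e = (fun t => seg (u, v) t) by apply/funext.
  have cvx (a b : R) : continuous (fun t : R => (1 - t) * a + t * b).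
    move=> t; apply: cvgD; apply: cvgM; try exact: cvg_cst; last exact: cvg_id.
    by apply: cvgB; [exact: cvg_cst|exact: cvg_id].
  apply: continuous_subspaceT => t.
  exact: cvg_pair (cvx (x u) (x v) t) (cvx (x u ^+ 2) (x v ^+ 2) t).
- move=> e /arcE[u [v [uv _ h]]] t t' _ _; rewrite !h => -[+ _] => /eqP.
  rewrite -subr_eq0 (_ : _ - _ = (t - t') * (x v - x u)); last by ring.
  by rewrite mulf_eq0 [_ - x u == 0]gt_eqF ?subr_gt0 // orbF subr_eq0 => /eqP.
- move=> e /arcE[u [v [uv e_uv h]]]; exists u, v; rewrite !h; split=> //;
    rewrite /seg /pos /=; congr (_, _); ring.
- move=> e t w /arcE[u [v [uv _ h]]] /itvP ht; rewrite h => -[h1 h2].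
  have := gap u v t; rewrite h1 h2 subrr -h1 => /esym/eqP.
  rewrite mulf_eq0 !subr_eq0.
  have /andP[i1 i2] : x u < (1 - t) * x u + t * x v < x v.
    by apply: in1 => //; rewrite !ht.
  by rewrite [_ == x u]gt_eqF // [x v == _]gt_eqF.
- move=> e e' t t' eE e'E ee' ht ht' eq.
  have [u [v [uv e_uv h]]] := arcE e eE; have [u' [v' [uv' e_uv' h']]] := arcE e' e'E.
  move: eq; rewrite h h' => -[h1 h2].
  have i1 : x u < (1 - t) * x u + t * x v < x v.
    by apply: in1 => //; rewrite !(itvP ht).
  have i2 : x u' < (1 - t') * x u' + t' * x v' < x v'.
    by apply: in1 => //; rewrite !(itvP ht').
  have := gap u v t; rewrite h1 h2 gap => /esym /= hh.
  rewrite -h1 in hh i2.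
  have := chord_cross uv uv' i1 i2 hh; rewrite !ltr_nat => /or3P[].
  + move=> /andP[/eqP/xI uu /eqP/xI vv].
    by rewrite e_uv e_uv' uu vv eqxx in ee'.
  + by apply/negP; apply: ncr; rewrite /adj -?e_uv -?e_uv'.
  + by apply/negP; apply: ncr; rewrite /adj -?e_uv -?e_uv'.
Qed.

End Outerplanar.

(** * Adding an edge between two components *)

Section Unicyclic.
Variable (V : finType).
Implicit Types (E : {set {set V}}) (s : seq V) (u v x y : V).

Lemma adj_sym E : symmetric (adj E).
Proof. by move=> x y; rewrite adjC. Qed.

Lemma adj_connect_sym E : connect_sym (adj E).
Proof. by apply: sym_connect_sym; apply: adj_sym. Qed.

Lemma adjU1 E u v x y : adj ([set u; v] |: E) x y ->
  [\/ adj E x y, x = u /\ y = v | x = v /\ y = u].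
Proof.
rewrite /adj in_setU1 => /orP[/eqP e|]; last by constructor 1.
have : x \in [set u; v] by rewrite -e !inE eqxx.
have : y \in [set u; v] by rewrite -e !inE eqxx orbT.
have : u \in [set x; y] by rewrite e !inE eqxx.
have : v \in [set x; y] by rewrite e !inE eqxx orbT.
rewrite !inE => /orP[]/eqP-> /orP[]/eqP-> /orP[]/eqP + /orP[]/eqP; intuition;
  subst; by [constructor 2|constructor 3].
Qed.

Lemma nat_bounded (r : V -> nat) : exists B, forall v, (r v < B)%N.
Proof.
exists (\max_v r v).+1 => v; rewrite ltnS; exact: (leq_bigmax v).
Qed.

Lemma modn_rot B a c : (a < B)%N -> (c <= B)%N ->
  ((a + c) %% B = if a + c < B then a + c else a + c - B)%N.
Proof.
move=> aB cB; case: ifP => [/modn_small //|/negbT]; rewrite -leqNgt => h.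
rewrite -{1}(subnK h) modnDr modn_small //; lia.
Qed.

Lemma modn_rot_inj B a b k : (a < B)%N -> (b < B)%N -> (k <= B)%N ->
  ((a + k) %% B = (b + k) %% B -> a = b)%N.
Proof. by move=> ? ? ?; rewrite !modn_rot //; do 2 case: ifP; lia. Qed.

(** Crossing is a cyclic notion: four ranks that interleave after a rotation interleave before it,
    up to a cyclic shift of the roles of the four ends. *)
Lemma modn_rot_cross B a b c d k :
  (a < B)%N -> (b < B)%N -> (c < B)%N -> (d < B)%N -> (k <= B)%N ->
  [&& (a + k) %% B < (c + k) %% B, (c + k) %% B < (b + k) %% B
    & (b + k) %% B < (d + k) %% B]%N ->
  [|| [&& a < c, c < b & b < d], [&& c < b, b < d & d < a],
      [&& b < d, d < a & a < c] | [&& d < a, a < c & c < b]]%N.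
Proof.
move=> aB bB cB dB kB; rewrite !modn_rot //.
by case: (ltnP (a + k)) => ha; case: (ltnP (c + k)) => hc;
  case: (ltnP (b + k)) => hb; case: (ltnP (d + k)) => hd; lia.
Qed.

(* Rotate the two orders so that u is the last vertex outside of the component
   of v, and v the first vertex inside, and concatenate them. *)
Lemma outerplanar_bridge E u v : outerplanar E -> ~~ connect (adj E) u v ->
  outerplanar ([set u; v] |: E).
Proof.
move=> [r [rI ncr]] uv; have [B rB] := nat_bounded r.
pose C x := connect (adj E) v x.
have CE x y : adj E x y -> C x = C y.
  move=> xy; rewrite /C; apply/idP/idP => h; apply: connect_trans h (connect1 _) => //.
  by rewrite adj_sym.
have Cu : C u = false by rewrite /C adj_connect_sym (negbTE uv).
have Cv : C v by exact: connect0.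
pose r' x := if C x then (B + (r x + (B - r v)) %% B)%N
             else ((r x + (B - (r u).+1)) %% B)%N.
have r'T x : C x -> r' x = (B + (r x + (B - r v)) %% B)%N by rewrite /r' => ->.
have r'F x : C x = false -> r' x = ((r x + (B - (r u).+1)) %% B)%N.
  by rewrite /r' => ->.
have r'lt x : C x = false -> (r' x < B)%N.
  by move=> /r'F ->; rewrite ltn_pmod //; have := rB x; case: (B).
have r'ge x : C x -> (B <= r' x)%N by move=> /r'T ->; exact: leq_addr.
exists r'; split.
  move=> x y; case: (boolP (C x)) (boolP (C y)) => [Cx|/negbTE Cx] [Cy|/negbTE Cy].
  - by rewrite !r'T // => /addnI /(modn_rot_inj (rB _) (rB _) (leq_subr _ _)) /rI.
  - by move=> h; have := r'ge x Cx; rewrite h leqNgt r'lt.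
  - by move=> h; have := r'ge y Cy; rewrite -h leqNgt r'lt.
  - by rewrite !r'F // => /(modn_rot_inj (rB _) (rB _) (leq_subr _ _)) /rI.
have same a b c d : adj E a b -> adj E c d ->
    ~~ [&& r' a < r' c, r' c < r' b & r' b < r' d]%N.
  move=> ab cd; have Cab := CE _ _ ab; have Ccd := CE _ _ cd.
  have ba : adj E b a by rewrite adj_sym.
  have dc : adj E d c by rewrite adj_sym.
  have rot k : (k <= B)%N -> ~~ [&& (r a + k) %% B < (r c + k) %% B,
      (r c + k) %% B < (r b + k) %% B & (r b + k) %% B < (r d + k) %% B]%N.
    move=> kB; apply/negP => /(modn_rot_cross (rB _) (rB _) (rB _) (rB _) kB).
    move=> /or4P[]; apply/negP; exact: ncr.
  case: (boolP (C a)) (boolP (C c)) => [Ca|/negbTE Ca] [Cc|/negbTE Cc].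
  - rewrite !r'T -?Cab -?Ccd // !ltn_add2l; apply: rot; exact: leq_subr.
  - apply/negP => /and3P[h _ _]; move: h; apply/negP; rewrite -leqNgt.
    by rewrite ltnW // (leq_trans (r'lt c Cc)) // r'ge.
  - apply/negP => /and3P[_ h _]; move: h; apply/negP; rewrite -leqNgt.
    by rewrite ltnW // (leq_trans (r'lt b _)) ?r'ge // -Cab.
  - rewrite !r'F -?Cab -?Ccd //; apply: rot; exact: leq_subr.
have r'u : r' u = B.-1.
  rewrite /r' Cu subnS -subn1; have := rB u => ?.
  have -> : (r u + (B - r u - 1) = B.-1)%N by lia.
  by rewrite modn_small //; lia.
have r'v : r' v = B.
  by rewrite /r' Cv; have := rB v => ?; rewrite subnKC ?modnn ?addn0 // ltnW.
have B0 : (0 < B)%N by have := rB v; lia.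
(* The new edge joins the consecutive ranks [B.-1] and [B], so no rank lies strictly between its
   ends and it crosses nothing. *)
move=> a b c d /adjU1 [ab|[-> ->]|[-> ->]] /adjU1 [cd|[-> ->]|[-> ->]];
  rewrite ?r'u ?r'v; try lia; exact: same.
Qed.

End Unicyclic.

(** * Graphs with at most one cycle in each component *)

Section NoTwoCycles.
Variable (V : finType) (x0 : V).
Implicit Types (E : {set {set V}}) (s : seq V) (u v x y : V).

(* A path s together with a chord from each of its two ends; every component
   with at least two cycles contains such a subgraph. *)
Definition bichord E s i j :=
  [&& uniq s, sorted (adj E) s,
      [&& 1 < i, i < size s, j.+2 < size s & (0 < j) || (i.+1 < size s)]%N,
      adj E (nth x0 s 0) (nth x0 s i) &
      adj E (nth x0 s (size s).-1) (nth x0 s j)].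

Definition nobichord E := forall s i j, ~~ bichord E s i j.

Lemma sorted_sub E E' s : E \subset E' -> sorted (adj E) s -> sorted (adj E') s.
Proof. by move=> EE'; apply: sub_sorted => x y; apply: sub_adj. Qed.

Lemma nobichord_sub E E' : E \subset E' -> nobichord E' -> nobichord E.
Proof.
move=> EE' nb s i j; apply/negP => /and5P[us ss ij h1 h2].
have /negP := nb s i j; apply; apply/and5P; split=> //; first exact: sorted_sub ss.
  exact: sub_adj h1.
exact: sub_adj h2.
Qed.

Definition longest E s := [/\ uniq s, sorted (adj E) s &
  forall s', uniq s' -> sorted (adj E) s' -> (size s' <= size s)%N].

Lemma longest_rev E s : longest E s -> longest E (rev s).
Proof.
move=> [us ss ms]; split.
- by rewrite rev_uniq.
- by rewrite rev_sorted; apply: sub_sorted ss => x y; rewrite adjC.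
- by move=> s'; rewrite size_rev; apply: ms.
Qed.

(** Otherwise [y] could be put in front of the path. *)
Lemma longest_head E s y : longest E s -> (0 < size s)%N ->
  adj E (nth x0 s 0) y -> y \in s.
Proof.
move=> [us ss ms]; case: s us ss ms => // x s us ss ms _ /= xy.
case: (boolP (y \in x :: s)) => // ys.
have := ms [:: y, x & s]; rewrite /= ltnn => h; apply/h.
  by rewrite -[_ && _]/(uniq (y :: x :: s)) cons_uniq ys.
by rewrite -[adj _ _ _ && _]/(path (adj E) y (x :: s)) /= adjC xy.
Qed.

Lemma longest_exists E x y : simple_graph E -> adj E x y ->
  exists s, longest E s /\ (1 < size s)%N.
Proof.
move=> sE xy; have xNy := adj_neq sE xy.
pose P k := [exists s : k.-tuple V, uniq s && sorted (adj E) s].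
have P2 : P 2%N.
  by apply/existsP; exists [tuple x; y]; rewrite /= inE xNy xy.
have Pb k : P k -> (k <= #|V|)%N.
  move=> /existsP[s /andP[us _]]; rewrite -(size_tuple s) -(card_uniqP us).
  exact: max_card.
case: (ex_maxnP (ex_intro P 2%N P2) Pb) => k /existsP[s /andP[us ss]] maxk.
exists s; rewrite size_tuple; split; last exact: maxk.
split=> // s' us' ss'; rewrite size_tuple; apply: maxk.
by apply/existsP; exists (in_tuple s'); rewrite us'.
Qed.

Definition bridgeless E := forall u v, adj E u v ->
  connect (adj (E :\ [set u; v])) u v.

(** The first edge of the path is not a bridge, so the first vertex has a second neighbour, which
    lies on the path by maximality. *)
Lemma bridgeless_chord E s : simple_graph E -> bridgeless E -> longest E s ->
  (1 < size s)%N ->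
  exists i, [/\ (1 < i)%N, (i < size s)%N & adj E (nth x0 s 0) (nth x0 s i)].
Proof.
move=> sE bl ls; have [us ss ms] := ls; move=> s1.
have e01 : adj E (nth x0 s 0) (nth x0 s 1).
  by move: ss s1; case: (s) => [|a [|b t]] //= /andP[].
have /connectP[[/= _ e|y p /= /andP[xy _] _]] := bl _ _ e01.
  by move: (adj_neq sE e01); rewrite e eqxx.
have xy' : adj E (nth x0 s 0) y by apply: sub_adj xy; exact: subD1set.
have ys : y \in s by apply: longest_head xy'; rewrite // ltnW.
exists (index y s); rewrite index_mem nth_index //; split=> //.
rewrite ltn_neqAle eq_sym lt0n; apply/andP; split; apply/eqP => h.
  by move: xy; rewrite /adj -(nth_index x0 ys) h !inE eqxx.
by have := adj_neq sE xy'; rewrite -(nth_index x0 ys) h eqxx.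
Qed.

(** Both ends of the path have chords. Without a bichord the two chords must be the same edge, which
    closes the path to a cycle. *)
Lemma longest_closed E s : simple_graph E -> bridgeless E -> nobichord E ->
  longest E s -> (1 < size s)%N ->
  (2 < size s)%N /\ adj E (nth x0 s (size s).-1) (nth x0 s 0).
Proof.
move=> sE bl nb ls s1; have [us ss _] := ls.
have [i [i1 i2 i3]] := bridgeless_chord sE bl ls s1.
have [|j] := bridgeless_chord sE bl (longest_rev ls); rewrite size_rev //.
move=> [j1 j2]; have s0 : (0 < size s)%N by lia.
rewrite !nth_rev // subn1 => j3.
have := nb s i (size s - j.+1)%N; rewrite /bichord us ss i3 j3 i1 i2 /= !andbT.
rewrite negb_and -leqNgt negb_or -!leqNgt => h.
have e1 : (size s - j.+1 = 0)%N by lia.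
by rewrite e1 in j3; split=> //; lia.
Qed.

(** The closing edge serves as the second chord ([j = 0]), so any further chord at the first vertex
    would give a bichord. *)
Lemma longest_head_nbr E s y : simple_graph E -> bridgeless E -> nobichord E ->
  longest E s -> (1 < size s)%N -> adj E (nth x0 s 0) y ->
  exists i, [/\ (i < size s)%N, y = nth x0 s i & (i == 1) || (i.+1 == size s)]%N.
Proof.
move=> sE bl nb ls s1 xy; have [us ss _] := ls.
have ys : y \in s by apply: longest_head xy; rewrite // ltnW.
have [s2 cl] := longest_closed sE bl nb ls s1.
exists (index y s); rewrite index_mem nth_index //; split=> //.
have := nb s (index y s) 0%N; rewrite /bichord us ss cl nth_index // xy /= andbT.
rewrite index_mem ys s2 /=.
have : index y s != 0%N.
  by apply/eqP => h; have := adj_neq sE xy; rewrite -h nth_index // eqxx.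
have := ys; rewrite -index_mem; move: (index y s) (size s) => i n; lia.
Qed.

Lemma sorted_rot E s n : sorted (adj E) s ->
  adj E (nth x0 s (size s).-1) (nth x0 s 0) -> sorted (adj E) (rot n s).
Proof.
case: s => // x s ss cl.
have : cycle (adj E) (x :: s).
  rewrite /= rcons_path; apply/andP; split=> //.
  by move: cl; rewrite /= -[size s]/((size (x :: s)).-1) nth_last.
by rewrite -(rot_cycle n); case: (rot n _) => //= a t; rewrite rcons_path => /andP[].
Qed.

Lemma nth_rot s n i : (n < size s)%N -> (i < size s)%N ->
  nth x0 (rot n s) i = nth x0 s (if n + i < size s then n + i else n + i - size s)%N.
Proof.
move=> ns is'; rewrite /rot nth_cat size_drop; case: ifP => h1; case: ifP => h2.
- by rewrite nth_drop.
- by exfalso; lia.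
- by exfalso; lia.
- rewrite nth_take; [congr nth|]; lia.
Qed.

(** The cycle can be rotated so that [x] becomes its first vertex; the rotated path is again a
    longest one. Hence the cycle has no chords and is a whole component. *)
Lemma longest_nbr E s x y : simple_graph E -> bridgeless E -> nobichord E ->
  longest E s -> (1 < size s)%N -> x \in s -> adj E x y ->
  y \in s /\ [|| index y s == (index x s).+1, index x s == (index y s).+1,
    (index x s == 0) && ((index y s).+1 == size s) |
    (index y s == 0) && ((index x s).+1 == size s)]%N.
Proof.
move=> sE bl nb ls s1 xs xy; have [us ss ms] := ls.
have [s2 cl] := longest_closed sE bl nb ls s1.
set n := index x s; have ns : (n < size s)%N by rewrite index_mem.
have s0 : (0 < size s)%N by lia.
have lr : longest E (rot n s).
  split; rewrite ?rot_uniq ?sorted_rot //.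
  by move=> s' us' ss'; rewrite size_rot; apply: ms.
have h0 : nth x0 (rot n s) 0 = x by rewrite nth_rot // addn0 ns nth_index.
have := @longest_head_nbr E (rot n s) y sE bl nb lr; rewrite size_rot h0.
move=> /(_ s1 xy)[i [is' -> i1]]; rewrite nth_rot //.
have hi : ((if n + i < size s then n + i else n + i - size s) < size s)%N.
  by case: ifP; lia.
rewrite mem_nth // index_uniq //; split=> //.
move: i1; case: ifP => h; lia.
Qed.

Lemma cycle_noncross n i j k l :
  (i < n -> j < n -> k < n -> l < n ->
  [|| j == i.+1, i == j.+1, (i == 0) && (j.+1 == n) | (j == 0) && (i.+1 == n)] ->
  [|| l == k.+1, k == l.+1, (k == 0) && (l.+1 == n) | (l == 0) && (k.+1 == n)] ->
  ~~ [&& i < k, k < j & j < l])%N.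
Proof.
move=> ? ? ? ? h1 h2; apply/negP => /and3P[ik kj jl].
case/or4P: h1 => [/eqP h|/eqP h|/andP[/eqP h /eqP h']|/andP[/eqP h /eqP h']]; lia.
Qed.

(** Induction on the number of edges. A bridge is removed and put back by [outerplanar_bridge].
    Without bridges, a longest path spans a component that is a chordless cycle; its vertices are
    placed in cyclic order behind all the others. *)
Lemma nobichord_outerplanar E : simple_graph E -> nobichord E -> outerplanar E.
Proof.
have [k] := ubnP #|E|; elim: k E => // k IH E; rewrite ltnS => Ek sE nb.
have IH' (u v : V) : adj E u v -> outerplanar (E :\ [set u; v]).
  move=> uv; have sub := subD1set E [set u; v].
  apply: IH; [|exact: simple_graph_sub sE|exact: nobichord_sub nb].
  apply: leq_trans Ek; rewrite [ltnRHS](cardsD1 [set u; v]).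
  by rewrite -[_ \in E]/(adj E u v) uv.
have [/existsP[u /existsP[v /andP[uv nc]]]|nbr] := boolP
    [exists u, exists v, adj E u v && ~~ connect (adj (E :\ [set u; v])) u v].
  by rewrite -(setD1K uv); apply: outerplanar_bridge nc; exact: IH'.
have bl : bridgeless E.
  move=> u v uv; move: nbr; rewrite negb_exists => /forallP/(_ u).
  by rewrite negb_exists => /forallP/(_ v); rewrite uv /= negbK.
have [/existsP[u /existsP[v uv]]|ne] := boolP [exists u, exists v, adj E u v]; last first.
  exists (fun v => enum_rank v : nat); split; first by move=> u v /val_inj/enum_rank_inj.
  move=> a b c d ab; move: ne; rewrite negb_exists => /forallP/(_ a).
  by rewrite negb_exists => /forallP/(_ b); rewrite ab.
have [s [ls s1]] := longest_exists sE uv; have [us ss _] := ls.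
have [s2 cl] := longest_closed sE bl nb ls s1.
(* Deleting the closing edge makes the induction hypothesis applicable. Of the resulting order only
   the part outside of the cycle [s] is used. *)
have [r [rI ncr]] := IH' _ _ cl; have [B rB] := nat_bounded r.
have nbrs x y := @longest_nbr E s x y sE bl nb ls s1.
exists (fun x => if x \in s then B + index x s else r x)%N; split.
  move=> x y; case: ifP => xs; case: ifP => ys.
  - by move/addnI => h; rewrite -(nth_index x0 xs) h nth_index.
  - by move=> h; have := rB y; rewrite -h; lia.
  - by move=> h; have := rB x; rewrite h; lia.
  - exact: rI.
have ms x y : adj E x y -> (x \in s) = (y \in s).
  move=> xy; apply/idP/idP => h; first by have [] := nbrs x y h xy.
  by rewrite adjC in xy; have [] := nbrs y x h xy.
move=> a b c d ab cd; rewrite -(ms _ _ ab) -(ms _ _ cd).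
case: ifPn => as'; case: ifPn => cs.
- rewrite !ltn_add2l; have [bs h1] := nbrs a b as' ab; have [ds h2] := nbrs c d cs cd.
  by apply: cycle_noncross h1 h2; rewrite index_mem.
- apply/negP => /andP[h _]; move: h; apply/negP; rewrite -leqNgt.
  by rewrite ltnW // (leq_trans (rB c)) // leq_addr.
- apply/negP => /and3P[_ h _]; move: h; apply/negP; rewrite -leqNgt.
  by rewrite ltnW // (leq_trans (rB b)) // leq_addr.
- apply: ncr; rewrite /adj in_setD1; apply/andP; split=> //; apply/eqP => e.
    have : a \in [set a; b] by rewrite !inE eqxx.
    rewrite e !inE => /orP[]/eqP ea; move: as'; rewrite ea mem_nth //;
      by rewrite ?prednK // ltnW // ltnW.
  have : c \in [set c; d] by rewrite !inE eqxx.
  rewrite e !inE => /orP[]/eqP ea; move: cs; rewrite ea mem_nth //;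
    by rewrite ?prednK // ltnW // ltnW.
Qed.

End NoTwoCycles.

(** * Exploration of a component, one vertex at a time *)

Section Exploration.
Variables (R : realFieldType) (V : finType).
Implicit Types (E : {set {set V}}) (A F N : {set V}) (a u v x y : V).

Definition pairs : {set {set V}} := [set e : {set V} | #|e| == 2%N].

(** [A] holds the active and [F] the undiscovered vertices. Steps must enter [F], so edges between
    active vertices are never examined. *)
Definition radj A F E x y := [&& adj E x y, x \in A :|: F & y \in F].

Definition reach A F E : {set V} :=
  [set x in F | [exists a in A, connect (radj A F E) a x]].

Definition nbr a F E : {set V} := [set x in F | adj E a x].

Definition star a F : {set {set V}} := [set [set a; x] | x in F].

Lemma connect_invariant (e : rel V) (Z : {set V}) x y :
  (forall x y, x \in Z -> e x y -> y \in Z) -> x \in Z -> connect e x y -> y \in Z.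
Proof.
move=> clo xZ /connectP[p + ->]; elim: p x xZ => //= z p IH x xZ /andP[/(clo _ _ xZ)].
exact: IH.
Qed.

(** One step of the exploration: [a] is retired, and its neighbours in [F] become active. *)
Lemma reach_step A F E a : a \in A -> [disjoint A & F] ->
  reach A F E \subset nbr a F E :|: reach (A :\ a :|: nbr a F E) (F :\: nbr a F E) E.
Proof.
move=> aA dAF; set N := nbr a F E; set A' := A :\ a :|: N; set F' := F :\: N.
have NF x : x \in N -> x \in F by rewrite inE => /andP[].
have clo x y : x \in A :|: N :|: reach A' F' E -> radj A F E x y ->
    y \in A :|: N :|: reach A' F' E.
  move=> xZ /and3P[xy xAF yF]; rewrite [in X in _ X]/= !in_setU.
  have [yN|yN] := boolP (y \in N); first by rewrite orbT.
  have yF' : y \in F' by rewrite inE yN yF.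
  suff -> : y \in reach A' F' E by rewrite !orbT.
  have [xa|xa] := eqVneq x a.
    by rewrite xa in xy; rewrite inE yF xy in yN.
  rewrite inE yF' /=; move: xZ; rewrite in_setU => /orP[xA|].
    have xA' : x \in A' by move: xA; rewrite !in_setU in_setD1 xa.
    apply/existsP; exists x; rewrite xA' /=; apply: connect1.
    by rewrite /radj xy yF' in_setU xA'.
  rewrite inE => /andP[xF' /existsP[b /andP[bA cbx]]].
  apply/existsP; exists b; rewrite bA /=; apply: connect_trans cbx _.
  by apply: connect1; rewrite /radj xy yF' in_setU xF' orbT.
apply/subsetP => x; rewrite inE => /andP[xF /existsP[b /andP[bA cbx]]].
have := connect_invariant clo _ cbx; rewrite !in_setU bA => /(_ isT) /orP[/orP[xA|->]|->] //.
  by have := disjointFr dAF xA; rewrite xF.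
by rewrite orbT.
Qed.

Lemma in_star a F x : (a \notin F) -> ([set a; x] \in star a F) = (x \in F).
Proof.
move=> aF; apply/imsetP/idP => [[y yF e]|xF]; last by exists x.
have : y \in [set a; x] by rewrite e !inE eqxx orbT.
rewrite !inE => /orP[]/eqP yx; last by rewrite -yx.
by rewrite yx (negbTE aF) in yF.
Qed.

Lemma star_inj a F : a \notin F -> {in F &, injective (fun x => [set a; x])}.
Proof.
move=> aF x y xF yF e.
have : x \in [set a; y] by rewrite -e !inE eqxx orbT.
by rewrite !inE => /orP[]/eqP // xa; rewrite -xa xF in aF.
Qed.

Lemma card_star a F : a \notin F -> #|star a F| = #|F|.
Proof. by move=> aF; rewrite card_in_imset //; apply: star_inj. Qed.

Lemma star_pairs a F : a \notin F -> star a F \subset pairs.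
Proof.
move=> aF; apply/subsetP => _ /imsetP[x xF ->]; rewrite inE cards2.
have -> // : a != x by apply/eqP => ax; rewrite ax xF in aF.
Qed.

Lemma card_nbr a F E : a \notin F -> #|nbr a F E| = #|E :&: star a F|.
Proof.
move=> aF; rewrite -(card_in_imset (f := fun x => [set a; x])); last first.
  by move=> x y; rewrite !inE => /andP[+ _] /andP[+ _]; apply: star_inj.
apply: eq_card => e; rewrite inE; apply/imsetP/andP => [[x + ->]|[eE /imsetP[x xF ex]]].
  by rewrite inE => /andP[xF xE]; split=> //; rewrite in_star.
by exists x => //; rewrite inE xF /adj -ex.
Qed.

Lemma nbr_star a F E E' : a \notin F -> E :&: star a F = E' :&: star a F ->
  nbr a F E = nbr a F E'.
Proof.
move=> aF e; apply/setP => x; rewrite !inE; case: (boolP (x \in F)) => //= xF.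
by move/setP: e => /(_ [set a; x]); rewrite !inE in_star // xF !andbT.
Qed.

(** Once [a] is retired its edges are never examined again. The remaining exploration is thus
    independent of the neighbours found at [a]. *)
Lemma reach_star a F A' F' E E' : a \notin F -> a \notin A' -> a \notin F' ->
  E :\: star a F = E' :\: star a F -> reach A' F' E = reach A' F' E'.
Proof.
move=> aF aA' aF' e.
suff h : radj A' F' E =2 radj A' F' E'.
  apply/setP => x; rewrite !inE; congr andb; apply: eq_existsb => b.
  by rewrite (eq_connect h).
move=> x y; rewrite /radj /adj.
have [xs|] := boolP (x \in A' :|: F'); last by rewrite !andbF.
have [ys|] := boolP (y \in F'); last by rewrite !andbF.
rewrite !andbT; have ns : [set x; y] \notin star a F.
  apply/negP => /imsetP[z zF exy].
  have : a \in [set x; y] by rewrite exy !inE eqxx.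
  rewrite !inE => /orP[]/eqP ea; last by rewrite ea ys in aF'.
  by move: xs; rewrite -ea in_setU (negbTE aA') (negbTE aF').
by move/setP: e => /(_ [set x; y]); rewrite !inE ns.
Qed.

(* Phi is a supersolution of the recursion which explores one vertex at a time;
   its two arguments count the active and the undiscovered vertices. *)
Lemma expec_reach (t : R) (Phi : nat -> nat -> R) (n : nat) : 0 <= t <= 1 ->
  (forall f, 0 <= Phi 0%N f) ->
  (forall a F (i : nat), a \notin F -> (i.+1 + #|F| <= n)%N ->
    expec (unif pairs t) (fun E => Phi (i + #|nbr a F E|) (#|F| - #|nbr a F E|)%N) + 1
    <= Phi i.+1 #|F|) ->
  forall A F, [disjoint A & F] -> (#|A| + #|F| <= n)%N ->
  expec (unif pairs t) (fun E => #|reach A F E|%:R) + #|A|%:R <= Phi #|A| #|F|.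
Proof.
move=> ht Phi0 PhiS A F; have pp := unif_prob pairs ht.
have [k] := ubnP (#|A| + #|F|); elim: k A F => // k IH A F; rewrite ltnS => AFk dAF AFn.
have [->|[a aA]] := set_0Vmem A.
  rewrite cards0 addr0 (@eq_expec _ _ _ _ (fun=> 0)) ?expec_cst // => E.
  rewrite (_ : reach _ _ _ = set0) ?cards0 //; apply/setP => x; rewrite !inE.
  apply/negbTE; rewrite negb_and; apply/orP; right.
  by apply/existsPn => b; rewrite inE.
have aF : a \notin F by rewrite (disjointFr dAF aA).
have cA : #|A| = (#|A :\ a|).+1 by rewrite (cardsD1 a) aA.
rewrite cA; set i := #|A :\ a|.
apply: le_trans (PhiS a F i aF _); last by rewrite -cA.
rewrite -natr1 addrA lerD2r.
pose AN N := A :\ a :|: N; pose FN N := F :\: N.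
have cAN N : N \subset F -> #|AN N| = (i + #|N|)%N.
  move=> NF; rewrite /AN cardsU (_ : _ :&: _ = set0) ?cards0 ?subn0 //.
  apply/setP => x; rewrite !inE; apply/negbTE/negP => /andP[/andP[_ xA] /(subsetP NF)].
  by rewrite (disjointFr dAF xA).
have cFN N : N \subset F -> #|FN N| = (#|F| - #|N|)%N.
  by move=> NF; rewrite /FN cardsD (setIidPr NF).
(* For a fixed set [N], the event that [N] is the set of new neighbours depends only on the star of
   [a], and [g] only on the other edges. *)
have ind N (g : {set {set V}} -> R) :
    (forall E E' : {set {set V}}, E :\: star a F = E' :\: star a F -> g E = g E') ->
    expec (unif pairs t) (fun E => (nbr a F E == N)%:R * g E) =
    pr (unif pairs t) (fun E => nbr a F E == N) * expec (unif pairs t) g.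
  move=> gS; apply: (@expec_indep _ _ _ (star a F)) => // E E' e.
  by rewrite (nbr_star aF e).
apply: (@le_trans _ _ (\sum_(N : {set V} | N \subset F)
   pr (unif pairs t) (fun E => nbr a F E == N) *
   Phi (i + #|N|)%N (#|F| - #|N|)%N)); last first.
  rewrite (eq_bigr (fun N => expec (unif pairs t) (fun E => (nbr a F E == N)%:R *
     Phi (i + #|N|)%N (#|F| - #|N|)%N))); last first.
    by move=> N NF; rewrite (ind N (fun=> _)) // expec_cst.
  rewrite -expec_sum; apply: le_expec => // E.
  rewrite (bigD1 (nbr a F E)) /=; last by apply/subsetP => x; rewrite inE => /andP[].
  rewrite eqxx mul1r big1 ?addr0 // => N /andP[_ /negbTE NE].
  by rewrite eq_sym NE mul0r.
have tot : \sum_(N : {set V} | N \subset F)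
   pr (unif pairs t) (fun E => nbr a F E == N) = 1.
  rewrite -expec_sum -[RHS](expec_cst (unif pairs t)); apply: eq_expec => E.
  rewrite (bigD1 (nbr a F E)) /=; last by apply/subsetP => x; rewrite inE => /andP[].
  rewrite eqxx big1 ?addr0 // => N /andP[_ /negbTE NE]; by rewrite eq_sym NE.
apply: (@le_trans _ _ (\sum_(N : {set V} | N \subset F)
   (pr (unif pairs t) (fun E => nbr a F E == N) *
    (#|N|%:R + expec (unif pairs t) (fun E => #|reach (AN N) (FN N) E|%:R)) +
    pr (unif pairs t) (fun E => nbr a F E == N) * i%:R))); last first.
  apply: ler_sum => N NF; rewrite -mulrDr ler_wpM2l ?pr_ge0 //.
  have := IH (AN N) (FN N); rewrite cAN // cFN // => IHN.
  have cN : (#|N| <= #|F|)%N by apply: subset_leq_card.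
  have {}IHN := IHN _ _ _; apply: le_trans (IHN _ _ _); first by rewrite natrD; lra.
  - by move: AFk; rewrite cA -/i; lia.
  - rewrite -setI_eq0; apply/eqP/setP => x; rewrite !inE.
    case: (boolP (x \in N)); rewrite //= ?orbF ?andbF // => _.
    by apply/negbTE/negP => /andP[/andP[_ xA]]; rewrite (disjointFr dAF xA).
  - by move: AFn; rewrite cA -/i; lia.
rewrite big_split /= -mulr_suml tot mul1r lerD2r.
rewrite (eq_bigr (fun N => expec (unif pairs t) (fun E => (nbr a F E == N)%:R *
   (#|N|%:R + #|reach (AN N) (FN N) E|%:R)))); last first.
  move=> N NF; rewrite ind ?expecD ?expec_cst // => E E' e.
  rewrite (reach_star aF _ _ e) //; last by rewrite !inE negb_and aF orbT.
  rewrite !inE eqxx /=; apply/negP => /(subsetP NF); exact/negP.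
rewrite -expec_sum; apply: le_expec => // E.
rewrite (bigD1 (nbr a F E)) /=; last by apply/subsetP => x; rewrite inE => /andP[].
rewrite eqxx mul1r -[leLHS]addr0; apply: lerD; last first.
  by apply: sumr_ge0 => N _; rewrite mulr_ge0 // addr_ge0.
rewrite -natrD ler_nat; apply: leq_trans (subset_leq_card (reach_step E aA dAF)) _.
by rewrite cardsU leq_subr.
Qed.

End Exploration.

(** * Expected component size in the critical window *)

Section Supersolution.

Lemma expec_pow_inter (R : realFieldType) (T : finType) (K S : {set T}) (t z : R) :
  S \subset K ->
  expec (unif K t) (fun E => z ^+ #|E :&: S|) = (1 - t * (1 - z)) ^+ #|S|.
Proof.
move=> SK.
pose c e (b : bool) := if e \in S then (if b then z else 1) else 1 : R.
rewrite (@eq_expec _ _ _ _ (fun E => \prod_e c e (e \in E))); last first.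
  move=> E; rewrite /c -big_mkcond /= -prodr_const big_mkcond [RHS]big_mkcond /=.
  by apply: eq_bigr => e _; rewrite inE; case: (e \in E); case: (e \in S).
rewrite expec_prod -prodr_const [RHS]big_mkcond; apply: eq_bigr => e _.
rewrite /c; case: ifP => eS; last by ring.
by rewrite /unif (subsetP SK) //; ring.
Qed.

Lemma expec_card_inter (R : realFieldType) (T : finType) (K S : {set T}) (t : R) :
  S \subset K ->
  expec (unif K t) (fun E => #|E :&: S|%:R) = #|S|%:R * t.
Proof.
move=> SK; rewrite (@eq_expec _ _ _ _ (fun E => \sum_(e in S) (e \in E)%:R)).
  rewrite expec_sum (eq_bigr (fun=> t)); first by rewrite sumr_const mulr_natl.
  by move=> e eS; rewrite [LHS]pr_mem /unif (subsetP SK).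
move=> E; rewrite -sum1_card natr_sum big_mkcond [RHS]big_mkcond /=.
by apply: eq_bigr => e _; rewrite inE; case: (e \in E); case: (e \in S).
Qed.

Variable R : realType.
Implicit Types (h D t s : R).

(** The binomial expansion truncated after a negative term. Passing from [n] to [n + 1] leaves the
    nonnegative excess n (n - 1) (n - 2) / 6 times x^4. *)
Lemma bernoulli3 (x : R) n : 0 <= x <= 1 ->
  1 - n%:R * x + n%:R * (n%:R - 1) / 2 * x ^+ 2
  - n%:R * (n%:R - 1) * (n%:R - 2) / 6 * x ^+ 3 <= (1 - x) ^+ n.
Proof.
move=> /andP[x0 x1]; elim: n => [|n IH]; first by rewrite !mul0r expr0; lra.
have x1' : 0 <= 1 - x by rewrite subr_ge0.
rewrite [leRHS]exprS; apply: le_trans (ler_wpM2l x1' IH).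
rewrite -subr_ge0 -[n.+1%:R]natr1; set m := n%:R.
have -> : (1 - x) * (1 - m * x + m * (m - 1) / 2 * x ^+ 2 -
    m * (m - 1) * (m - 2) / 6 * x ^+ 3) -
    (1 - (m + 1) * x + (m + 1) * (m + 1 - 1) / 2 * x ^+ 2 -
    (m + 1) * (m + 1 - 1) * (m + 1 - 2) / 6 * x ^+ 3) =
    (m * (m - 1) * (m - 2)) / 6 * x ^+ 4 by field.
rewrite mulr_ge0 ?exprn_ge0 // mulr_ge0 // /m.
case: n {IH m} => [|[|n]]; rewrite ?mul0r ?subrr ?mulr0 ?mul0r //.
Qed.

Lemma power_lower (t s : R) n : 0 < s -> s <= 1 / 32 -> 32 <= n%:R :> R ->
  0 < t -> n%:R * t = 1 + s / 8 -> 0 <= t * s <= 1 ->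
  1 - s + s ^+ 2 / 4 <= (1 - t * s) ^+ n.
Proof.
move=> s0 s1 m32 t0 mt xs; apply: le_trans (bernoulli3 n xs).
move: m32 mt; set m := n%:R => m32 mt.
have -> : m * (t * s) = (1 + s / 8) * s by rewrite mulrA mt.
have -> : m * (m - 1) / 2 * (t * s) ^+ 2 =
   ((1 + s / 8) * s) ^+ 2 / 2 - t * s * ((1 + s / 8) * s) / 2.
  by rewrite -mt; field.
have e3 : m * (m - 1) * (m - 2) / 6 * (t * s) ^+ 3 <= ((1 + s / 8) * s) ^+ 3 / 6.
  rewrite -mt -subr_ge0.
  have -> : (m * t * s) ^+ 3 / 6 - m * (m - 1) * (m - 2) / 6 * (t * s) ^+ 3 =
    m * (3 * m - 2) * (t * s) ^+ 3 / 6 by field.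
  by rewrite divr_ge0 // mulr_ge0 ?exprn_ge0 ?mulr_ge0 //; lra.
have ts : t * s <= s / 16.
  rewrite mulrC ler_pM2l //; nra.
have e4 : t * s * ((1 + s / 8) * s) / 2 <= s ^+ 2 / 16.
  have : t * s * ((1 + s / 8) * s) <= s / 16 * (2 * s).
    apply: ler_pM => //; [by rewrite mulr_ge0 // ltW|by rewrite mulr_ge0 ?ltW//; lra|].
    by rewrite ler_pM2r //; lra.
  lra.
have e5 : ((1 + s / 8) * s) ^+ 3 / 6 <= s ^+ 2 / 16.
  have e6 : ((1 + s / 8) * s) ^+ 3 <= (2 * s) ^+ 3.
    by rewrite lerXn2r ?nnegrE //; nra.
  have : (2 * s) ^+ 3 <= s ^+ 2 / 4.
    have -> : (2 * s) ^+ 3 = (8 * s) * s ^+ 2 by ring.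
    have -> : s ^+ 2 / 4 = 1 / 4 * s ^+ 2 by field.
    by rewrite ler_pM2r ?exprn_gt0 //; lra.
  have := sqr_ge0 s; lra.
have e7 : s ^+ 2 / 2 <= ((1 + s / 8) * s) ^+ 2 / 2.
  rewrite ler_pM2r // lerXn2r ?nnegrE //; nra.
have e8 : (1 + s / 8) * s = s + s ^+ 2 / 8 by field.
lra.
Qed.

Section FixedWindow.
Variables (h D : R) (n : nat).
Hypotheses (nh : n%:R = h ^+ 3) (D1 : 1 <= D) (Dh : 256 * D <= h).

Let t : R := (1 + D / h) / n%:R.
(** With this [s] the mean offspring is [1 + s / 8], so close to 1 that the quadratic term of (1 -
    s)^X, for X the number of new neighbours, outweighs the drift. [G] is the factor contributed by
    one potential edge, and [w] is chosen so that w^T (1 - s)^a, with [a] active vertices after T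
    steps, does not decrease in expectation. *)
Let s : R := 8 * D / h.
Let G : R := 1 - t * s.
Let w : R := (1 - s) / G ^+ n.

Let h0 : 0 < h. Proof. by move: D1 Dh => ? ?; lra. Qed.
Let n0 : 0 < n%:R :> R. Proof. by rewrite nh exprn_gt0. Qed.
Let s0 : 0 < s. Proof. by rewrite divr_gt0 // mulr_gt0 //; move: D1; lra. Qed.
Let s1 : s <= 1 / 32. Proof. by rewrite /s ler_pdivrMr //; move: Dh; lra. Qed.
Let hs : s * h = 8 * D. Proof. by rewrite divfK // gt_eqF. Qed.
Let Dhs : D / h = s / 8. Proof. by rewrite /s; field; rewrite gt_eqF. Qed.
Let nt : n%:R * t = 1 + s / 8.
Proof. by rewrite /t Dhs mulrCA divff ?mulr1 // gt_eqF. Qed.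
Let n32 : 32 <= n%:R :> R.
Proof.
rewrite nh; have h256 : 256 <= h by move: D1 Dh => ? ?; lra.
have : h * 1 <= h * (h * h) by rewrite ler_pM2l //; nra.
rewrite mulr1 => h3; rewrite (_ : h ^+ 3 = h * (h * h)); last by ring.
lra.
Qed.
Let t0 : 0 < t. Proof. by rewrite divr_gt0 // addr_gt0 // divr_gt0 //; move: D1; lra. Qed.
Lemma window_prob : t <= 1.
Proof. by rewrite /t ler_pdivrMr // Dhs; move: s1 n32; lra. Qed.

Let xs : 0 <= t * s <= 1.
Proof.
apply/andP; split; first by apply: mulr_ge0; exact: ltW.
apply: mulr_ile1; [exact: ltW|exact: ltW|exact: window_prob|].
by apply: le_trans s1 _; lra.
Qed.

Let G_lower : 1 - s + s ^+ 2 / 4 <= G ^+ n.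
Proof. exact: (power_lower s0 s1 n32 t0 nt xs). Qed.

Let Gn0 : 0 < G ^+ n.
Proof. apply: lt_le_trans G_lower; have := s1; have := s0; nra. Qed.

Let w_upper : w <= 1 - s ^+ 2 / 8.
Proof.
rewrite /w ler_pdivrMr //.
have h1 : 0 <= 1 - s ^+ 2 / 8 by have := s0; have := s1; nra.
by apply: le_trans (ler_wpM2l h1 G_lower); have := s0; have := s1; nra.
Qed.

(** [(1 + t * s) ^+ n] is at least [1 + s], and its product with [G ^+ n] is at most 1. *)
Let w_lower : 1 - s ^+ 2 <= w.
Proof.
rewrite /w ler_pdivlMr //.
have -> : 1 - s ^+ 2 = (1 - s) * (1 + s) by ring.
rewrite -mulrA ler_piMr //; first by have := s1; lra.
have e1 : 1 + s <= (1 + t * s) ^+ n.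
  apply: le_trans (_ : 1 + n%:R * (t * s) <= _).
    by rewrite mulrA nt lerD2l; have := s0; nra.
  have /andP[x0 _] := xs; move: (t * s) x0 => x x0.
  elim: n => [|k IH]; first by rewrite mul0r addr0 expr0.
  have x1' : 0 <= 1 + x by rewrite addr_ge0.
  rewrite [leRHS]exprS; apply: le_trans (ler_wpM2l x1' IH).
  rewrite -[k.+1%:R]natr1; have : 0 <= k%:R * x ^+ 2 by rewrite mulr_ge0 // sqr_ge0.
  lra.
apply: le_trans (ler_wpM2r (ltW Gn0) e1) _.
rewrite -exprMn /G; have -> : (1 + t * s) * (1 - t * s) = 1 - (t * s) ^+ 2 by ring.
have /andP[x0 x1] := xs; apply: exprn_ile1; nra.
Qed.

Let w0 : 0 < w. Proof. by apply: lt_le_trans w_lower; have := s1; have := s0; nra. Qed.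

(** [B] equals [2 * s ^+ 2 * ((D + 1) * h ^+ 2)], the loss in the exponent over (D + 1) h^2 steps
    when [w] is at least [expR (- (2 * s ^+ 2))]. *)
Let B : R := 128 * D ^+ 2 * (D + 1).

Let w_pow (T : nat) : T%:R <= (D + 1) * h ^+ 2 -> expR (- B) <= w ^+ T.
Proof.
move=> hT.
have e1 : expR (- (2 * s ^+ 2)) <= w.
  apply: le_trans w_lower; rewrite expRN.
  have := expR_ge1Dx (2 * s ^+ 2); set e := expR _ => he.
  have s2 : 0 <= s ^+ 2 <= 1 / 2 by have := s0; have := s1; nra.
  have e0 : 0 < e by exact: expR_gt0.
  rewrite -[X in X <= _]mul1r ler_pdivrMr //; nra.
apply: le_trans (_ : expR (- (2 * s ^+ 2)) ^+ T <= _); last first.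
  by rewrite lerXn2r ?nnegrE ?expR_ge0 // ltW.
rewrite -expRM_natl ler_expR.
have -> : B = 2 * s ^+ 2 * ((D + 1) * h ^+ 2).
  rewrite /B; have -> : 2 * s ^+ 2 * ((D + 1) * h ^+ 2) = 2 * (s * h) ^+ 2 * (D + 1) by ring.
  by rewrite hs; ring.
rewrite mulrN lerN2 mulrC; apply: ler_wpM2l => //.
by rewrite mulr_ge0 // sqr_ge0.
Qed.

(** Chosen such that [C0 * expR (- B) * (s ^+ 2 / 8)] is [D + 1], where [s ^+ 2 / 8] is a lower
    bound for [1 - w]. *)
Let C0 : R := 8 * (D + 1) / s ^+ 2 * expR B.

Let C0_ge0 : 0 <= C0.
Proof.
rewrite /C0 mulr_ge0 ?expR_ge0 // divr_ge0 ?sqr_ge0 // mulr_ge0 //; move: D1; lra.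
Qed.

(* The first term decreases in expectation at every step, by at least D + 1
   during the first (D + 1) h^2 steps; after that, so few vertices are left that
   the second term decreases by at least 1. *)
Definition potential (a f : nat) : R :=
  C0 * w ^+ (n - (a + f)) * (1 - (1 - s) ^+ a) + h * a%:R.

Variable V : finType.

Lemma expec_reach_window (A F : {set V}) : [disjoint A & F] ->
  (#|A| + #|F| <= n)%N ->
  expec (unif (pairs V) t) (fun E => #|reach A F E|%:R) + #|A|%:R
  <= potential #|A| #|F|.
Proof.
apply: expec_reach.
- by have := t0; have := window_prob; move=> ? ?; apply/andP; split=> //; exact: ltW.
- by move=> f; rewrite /potential expr0 subrr !mulr0 addr0.
move=> {A}a {}F i aF iF.
have sF := star_pairs aF; have cF := card_star aF.
have nF E : (#|nbr a F E| <= #|F|)%N.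
  by apply: subset_leq_card; apply/subsetP => x; rewrite inE => /andP[].
set T := (n - (i.+1 + #|F|))%N.
have eT : (n - (i + #|F|))%N = T.+1 by rewrite /T addSn subnSK.
(* After one step the potential is a linear combination of (1 - s)^X and X, where X counts the edges
   present in the star of [a]; both have explicit expectations. *)
have PE E : potential (i + #|nbr a F E|) (#|F| - #|nbr a F E|) =
   (C0 * w ^+ T.+1 + h * i%:R) +
   ((- (C0 * w ^+ T.+1 * (1 - s) ^+ i)) * (1 - s) ^+ #|E :&: star a F| +
    h * #|E :&: star a F|%:R).
  rewrite /potential.
  have -> : (n - (i + #|nbr a F E| + (#|F| - #|nbr a F E|)))%N = T.+1.
    by rewrite -eT -addnA subnKC.
  rewrite (card_nbr E aF) exprD natrD.
  move: C0 (w ^+ _) ((1 - s) ^+ i) ((1 - s) ^+ #|_|) => c1 c2 c3 c4; ring.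
rewrite (eq_expec _ PE) expecD expec_cst expecD !expecZ.
rewrite expec_pow_inter // expec_card_inter // cF subKr -/G /potential -/T.
have GF : G ^+ n <= G ^+ #|F|.
  have /andP[x0 x1] := xs; apply: ler_wiXn2l; rewrite /G ?subr_ge0 //.
    by rewrite lerBlDr lerDl.
  by apply: leq_trans iF; exact: leq_addl.
(* The defining property of [w], together with [#|F| <= n]. *)
have e1 : (1 - s) ^+ i.+1 <= w * (1 - s) ^+ i * G ^+ #|F|.
  apply: le_trans (_ : w * (1 - s) ^+ i * G ^+ n <= _).
    rewrite exprS /w mulrAC divfK //; exact: lt0r_neq0.
  rewrite ler_wpM2l // mulr_ge0 ?(ltW w0) // exprn_ge0 // subr_ge0.
  by apply: le_trans s1 _; lra.
have wT : 0 <= w ^+ T by rewrite exprn_ge0 // ltW.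
have e2 : C0 * w ^+ T * (1 - s) ^+ i.+1 <=
    C0 * w ^+ T * (w * (1 - s) ^+ i * G ^+ #|F|).
  by apply: ler_wpM2l e1; rewrite mulr_ge0.
have nT : #|F|%:R <= n%:R - T%:R :> R.
  rewrite -natrB; last by rewrite /T leq_subr.
  rewrite ler_nat /T subKn //; exact: leq_addl.
have T0 : 0 <= T%:R :> R by [].
(* After [T] steps at most [n - T] vertices are undiscovered, so the expected increase of the second
   term is at most [D], and it drops linearly in [T]. *)
have e3 : h * (#|F|%:R * t) <= h + D - T%:R / h ^+ 2.
  apply: le_trans (_ : h * ((n%:R - T%:R) * t) <= _).
    by rewrite ler_pM2l // ler_pM2r.
  rewrite mulrBl nt -Dhs mulrBr mulrDr mulr1 [h * (D / h)]mulrCA divff ?gt_eqF // mulr1.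
  rewrite lerD2l lerN2 /t nh.
  have -> : T%:R / h ^+ 2 = T%:R / h ^+ 2 * 1 by rewrite mulr1.
  have -> : h * (T%:R * ((1 + D / h) / h ^+ 3)) = T%:R / h ^+ 2 * (1 + D / h).
    by field; rewrite gt_eqF.
  rewrite ler_wpM2l ?divr_ge0 ?sqr_ge0 // lerDl divr_ge0 ?(ltW h0) //.
  by move: D1; lra.
(* The two phases: for [T] at least (D + 1) h^2 the second summand suffices, before that the first
   one. *)
have e4 : 1 + D <= C0 * w ^+ T * (1 - w) + T%:R / h ^+ 2.
  have h2 : 0 < h ^+ 2 by rewrite exprn_gt0.
  have w1 : s ^+ 2 / 8 <= 1 - w by move: w_upper; lra.
  have w1' : 0 <= 1 - w by apply: le_trans w1; rewrite divr_ge0 ?sqr_ge0.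
  have [Tb|Ts] := leP ((D + 1) * h ^+ 2) T%:R.
    rewrite -[leLHS]add0r; apply: lerD; first by apply: mulr_ge0 => //; apply: mulr_ge0.
    by rewrite ler_pdivlMr // [1 + D]addrC.
  rewrite -[leLHS]addr0; apply: lerD; last by rewrite divr_ge0 // ltW.
  apply: le_trans (_ : C0 * expR (- B) * (s ^+ 2 / 8) <= _).
    rewrite /C0 expRN mulfK ?gt_eqF ?expR_gt0 //.
    rewrite le_eqVlt; apply/orP; left; apply/eqP; field.
    by rewrite gt_eqF.
  apply: ler_pM => //; first by rewrite mulr_ge0 ?expR_ge0.
    by rewrite divr_ge0 ?sqr_ge0.
  by rewrite ler_wpM2l // w_pow // ltW.
rewrite (_ : h * i.+1%:R = h * i%:R + h); last by rewrite -natr1 mulrDr mulr1.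
rewrite [w ^+ T.+1]exprSr.
move: e2 e3 e4; set c := C0 * w ^+ T.
have -> : C0 * (w ^+ T * w) = c * w by rewrite mulrA.
move: (h * (_ * t)) (T%:R / _) ((1 - s) ^+ i.+1) ((1 - s) ^+ i) (G ^+ #|F|).
move=> q r y x g e2 e3 e4; rewrite -subr_ge0.
have -> : c * (1 - y) + (h * i%:R + h) -
   (c * w + h * i%:R + (- (c * w * x) * g + q) + 1) =
   (c * (w * x * g) - c * y) + (h + D - r - q) + (c * (1 - w) + r - (1 + D)) by ring.
by apply: addr_ge0; [apply: addr_ge0|]; rewrite subr_ge0.
Qed.

End FixedWindow.

(** The initial potential is [C0 * s + h]. As [C0] is of order s^(-2) and [s] of order 1/h, it is of
    order [h]. *)
Lemma expec_reach_vertex (h D : R) (n : nat) (v : 'I_n) :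
  n%:R = h ^+ 3 -> 1 <= D -> 256 * D <= h ->
  expec (unif (pairs 'I_n) ((1 + D / h) / n%:R))
    (fun E => #|reach [set v] (~: [set v]) E|%:R)
  <= (2 * expR (128 * D ^+ 2 * (D + 1)) + 1) * h.
Proof.
move=> nh D1 Dh.
have cC : #|~: [set v]| = n.-1 by rewrite cardsC1 card_ord.
have n0 : (0 < n)%N by apply: leq_ltn_trans (ltn_ord v).
have := @expec_reach_window h D n nh D1 Dh _ [set v] (~: [set v]).
rewrite cards1 cC -subn1 subnKC // -setI_eq0 setICr eqxx => /(_ isT (leqnn _)) h1.
apply: le_trans (_ : expec (unif (pairs 'I_n) ((1 + D / h) / n%:R))
    (fun E => #|reach [set v] (~: [set v]) E|%:R) + 1 <= _); first by rewrite lerDl.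
apply: le_trans h1 _; rewrite /potential subn1 add1n prednK // subnn expr0 mulr1.
rewrite expr1 subKr [h * _]mulr1 [leRHS]mulrDl mul1r lerD2r.
set e := expR _; have e0 : 0 < e by exact: expR_gt0.
have h0 : 0 < h by lra.
have -> : 8 * (D + 1) / (8 * D / h) ^+ 2 * e * (8 * D / h) = (D + 1) / D * e * h.
  by field; rewrite !gt_eqF //; lra.
rewrite !ler_pM2r // ler_pdivrMr; lra.
Qed.

End Supersolution.

(** * First moment bound below the critical window *)

Section Subcritical.
Variable (V : finType) (x0 : V).
Implicit Types (E : {set {set V}}) (s : seq V) (u v x y : V).

Definition path_edges s : seq {set V} :=
  [seq [set nth x0 s l; nth x0 s l.+1] | l <- iota 0 (size s).-1].

Definition bichord_edges s i j : {set {set V}} :=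
  [set e in [set nth x0 s 0; nth x0 s i] ::
            [set nth x0 s (size s).-1; nth x0 s j] :: path_edges s].

Lemma set2_eq u v x y : [set u; v] = [set x; y] ->
  (u = x /\ v = y) \/ (u = y /\ v = x).
Proof.
move=> e.
have : u \in [set x; y] by rewrite -e !inE eqxx.
have : v \in [set x; y] by rewrite -e !inE eqxx orbT.
have : x \in [set u; v] by rewrite e !inE eqxx.
have : y \in [set u; v] by rewrite e !inE eqxx orbT.
rewrite !inE => /orP[]/eqP-> /orP[]/eqP-> /orP[]/eqP + /orP[]/eqP; intuition.
Qed.

Lemma set2_nth_eq s a b c d : uniq s ->
  (a < size s)%N -> (b < size s)%N -> (c < size s)%N -> (d < size s)%N ->
  [set nth x0 s a; nth x0 s b] = [set nth x0 s c; nth x0 s d] ->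
  (a = c /\ b = d) \/ (a = d /\ b = c).
Proof.
move=> us ha hb hc hd /set2_eq[[/eqP + /eqP]|[/eqP + /eqP]];
  rewrite !nth_uniq // => /eqP -> /eqP ->; [by left|by right].
Qed.

(** There is one edge more than there are vertices; this surplus yields the factor [t] in
    [pr_bichord]. *)
Lemma card_bichord_edges E s i j : bichord x0 E s i j ->
  #|bichord_edges s i j| = (size s).+1.
Proof.
move=> /and5P[us _ /and4P[i1 ik jk ij] _ _].
have k0 : (0 < size s)%N by lia.
have k1 : ((size s).-1 < size s)%N by lia.
have jk' : (j < size s)%N by lia.
have nP c d : (c < size s)%N -> (d < size s)%N -> (c.+1 < d)%N || (d.+1 < c)%N ->
    [set nth x0 s c; nth x0 s d] \notin path_edges s.
  move=> hc hd cd; apply/negP => /mapP[l]; rewrite mem_iota add0n => hl.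
  have l1 : (l.+1 < size s)%N by lia.
  move=> /(set2_nth_eq us hc hd (ltnW l1) l1); lia.
have up : uniq (path_edges s).
  rewrite map_inj_in_uniq ?iota_uniq // => l l'; rewrite !mem_iota !add0n => hl hl'.
  have l1 : (l.+1 < size s)%N by lia.
  have l1' : (l'.+1 < size s)%N by lia.
  move=> /(set2_nth_eq us (ltnW l1) l1 (ltnW l1') l1'); lia.
rewrite /bichord_edges cardsE (_ : #|_| = size ([set nth x0 s 0; nth x0 s i] ::
    [set nth x0 s (size s).-1; nth x0 s j] :: path_edges s)).
  by rewrite /= size_map size_iota prednK.
apply/card_uniqP; rewrite /= up andbT in_cons negb_or !nP // ?andbT //=; try lia.
apply/eqP => /(set2_nth_eq us k0 ik k1 jk'); lia.
Qed.

Lemma bichord_edges_sub E s i j : bichord x0 E s i j -> bichord_edges s i j \subset E.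
Proof.
move=> /and5P[us ss _ h1 h2]; apply/subsetP => e.
rewrite inE !in_cons => /or3P[/eqP-> //|/eqP-> //|/mapP[l]].
rewrite mem_iota add0n => hl ->; have /(sortedP x0) := ss; apply; lia.
Qed.

Lemma sum_square_geometric (R : realFieldType) (q : R) N : 0 <= q -> q <= 1 ->
  (1 - q) ^+ 3 * \sum_(k < N) k%:R * k%:R * q ^+ k <= 2.
Proof.
(* The square k^2 is replaced by (k + 1) (k + 2), whose generating function is exactly 2 / (1 -
   q)^3. *)
move=> q0 q1; pose S N := \sum_(k < N) (k%:R + 1) * (k%:R + 2) * q ^+ k.
(* q ^+ N * r N is (1 - q) ^+ 3 times the tail of the series S. *)
pose r (N : R) := (1 - q) ^+ 2 * (N + 1) * (N + 2) + (1 - q) * (2 * N + 3) * q + q * (1 + q).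
have SE : (1 - q) ^+ 3 * S N + q ^+ N * r N%:R = 2.
  elim: N => [|N IH]; first by rewrite /S big_ord0 expr0 /r mulr0n; ring.
  have -> : S N.+1 = S N + (N%:R + 1) * (N%:R + 2) * q ^+ N by rewrite /S big_ord_recr.
  rewrite -[RHS]IH [q ^+ N.+1]exprS /r -[N.+1%:R]natr1; ring.
have rN : 0 <= q ^+ N * r N%:R.
  have N0 : 0 <= N%:R :> R by [].
  have q1' : 0 <= 1 - q by rewrite subr_ge0.
  rewrite mulr_ge0 ?exprn_ge0 // /r; apply: addr_ge0; last by rewrite mulr_ge0 ?addr_ge0.
  by move: (1 - q) q1' => e e0; do ?[apply: addr_ge0 | apply: mulr_ge0 | apply: exprn_ge0].
have q3 : 0 <= (1 - q) ^+ 3 by rewrite exprn_ge0 // subr_ge0.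
apply: le_trans (_ : (1 - q) ^+ 3 * S N <= _); last by rewrite -SE lerDl.
apply: ler_wpM2l => //; apply: ler_sum => k _; rewrite ler_wpM2r ?exprn_ge0 //.
have k0 : 0 <= k%:R :> R by []; nra.
Qed.

(** Union bound over n^k vertex sequences and k^2 positions of the chords, each of probability at
    most t^(k+1): with q = n t the sum of [t * k^2 * q^k] is at most 2 t / (1 - q)^3. *)
Lemma pr_bichord (R : realFieldType) (t : R) : 0 <= t -> #|V|%:R * t <= 1 -> t <= 1 ->
  (0 < #|V|)%N ->
  (1 - #|V|%:R * t) ^+ 3 * pr (unif (pairs V) t) (fun E => ~~ `[< outerplanar E >])
    <= 2 * t.
Proof.
move=> t0 nt t1 V0; have ht : 0 <= t <= 1 by rewrite t0.
have pp := unif_prob (pairs V) ht.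
set n := #|V|; set q := n%:R * t.
pose B (k : 'I_n.+1) (w : k.-tuple V * ('I_k * 'I_k)) : pred {set {set V}} :=
  fun E => bichord x0 E w.1 w.2.1 w.2.2.
pose A (k : 'I_n.+1) : pred {set {set V}} := fun E => [exists w, @B k w E].
have Bb k w : pr (unif (pairs V) t) (@B k w) <= t ^+ k.+1.
  have [/existsP[E0 h]|hN] := boolP [exists E, @B k w E]; last first.
    rewrite (_ : pr _ _ = 0) ?exprn_ge0 // -(expec_cst (unif (pairs V) t) 0).
    apply: eq_expec => E; move: hN; rewrite negb_exists => /forallP/(_ E).
    by move/negbTE ->.
  have card := card_bichord_edges h; rewrite size_tuple in card.
  apply: le_trans (_ : pr (unif (pairs V) t)
      (fun E => bichord_edges w.1 w.2.1 w.2.2 \subset E) <= _).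
    by apply: le_pr => // E; exact: bichord_edges_sub.
  rewrite pr_subset -card -prodr_const; apply: ler_prod => e _.
  by rewrite /unif; case: ifP; rewrite ?lexx ?t0.
have Ab k : pr (unif (pairs V) t) (@A k) <= (n ^ k * (k * k))%:R * t ^+ k.+1.
  apply: le_trans (_ : \sum_(w : k.-tuple V * ('I_k * 'I_k))
    pr (unif (pairs V) t) (@B k w) <= _).
    apply: pr_bound_sum => // E /existsP[w Bw]; apply/hasP.
    by exists w; [exact: mem_index_enum|exact: Bw].
  apply: le_trans (ler_sum _ (fun w _ => Bb k w)) _.
  by rewrite sumr_const !card_prod card_tuple !card_ord mulr_natl.
have h : pr (unif (pairs V) t) (fun E => ~~ `[< outerplanar E >]) <=
    \sum_(k < n.+1) pr (unif (pairs V) t) (@A k).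
  rewrite -expec_sum; apply: ler_sum => E _.
  have [EK|/weight_unif0->] := boolP (E \subset pairs V); last by rewrite !mul0r.
  apply: ler_wpM2l; first exact: weight_ge0.
  have [/existsP[k Ak]|hN] := boolP [exists k, @A k E].
    by rewrite (bigD1 k) //= Ak; case: asboolP => _; rewrite ?lerDl ?addr_ge0 ?sumr_ge0.
  rewrite (_ : `[< _ >] = true) ?sumr_ge0 //; apply/asboolP.
  apply: (@nobichord_outerplanar _ x0).
    by apply/forall_inP => e /(subsetP EK); rewrite inE.
  move=> s i j; apply/negP => bs; move/negP: hN; apply.
  have /and5P[us _ /and4P[i1 ik jk ij] _ _] := bs.
  have sn : (size s < n.+1)%N by rewrite ltnS /n -(card_uniqP us) max_card.
  have jk' : (j < size s)%N by lia.
  apply/existsP; exists (Ordinal sn); apply/existsP.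
  by exists (in_tuple s, (Ordinal ik, Ordinal jk')).
have q0 : 0 <= q by rewrite mulr_ge0.
apply: le_trans (ler_wpM2l _ h) _; first by rewrite exprn_ge0 // subr_ge0.
apply: le_trans (_ : (1 - q) ^+ 3 * (t * \sum_(k < n.+1) k%:R * k%:R * q ^+ k) <= _).
  rewrite ler_wpM2l ?exprn_ge0 ?subr_ge0 // mulr_sumr; apply: ler_sum => k _.
  apply: le_trans (Ab k) _; rewrite le_eqVlt; apply/orP; left; apply/eqP.
  by rewrite !natrM natrX /q exprMn exprS; ring.
rewrite mulrCA [2 * t]mulrC; apply: ler_wpM2l => //.
exact: sum_square_geometric.
Qed.

End Subcritical.

(** * Drawings on the parabola throughout the critical window *)

Section CriticalWindow.
Variable R : realType.

Lemma connect_reach (V : finType) (E : {set {set V}}) u v :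
  u != v -> connect (adj E) u v -> v \in reach [set u] (~: [set u]) E.
Proof.
move=> uv cuv.
pose Z := [set u] :|: reach [set u] (~: [set u]) E.
have clo x y : x \in Z -> adj E x y -> y \in Z.
  move=> xZ xy; rewrite in_setU in_set1.
  have [//|yu] := eqVneq y u.
  have yF : y \in ~: [set u] by rewrite !inE.
  rewrite inE yF /=; apply/existsP; exists u; rewrite in_set1 eqxx /=.
  move: xZ; rewrite in_setU in_set1 => /orP[/eqP xu|].
    by rewrite xu in xy; apply: connect1; rewrite /radj xy yF in_setU set11.
  rewrite inE => /andP[xF /existsP[b /andP[]]]; rewrite in_set1 => /eqP -> cux.
  by apply: connect_trans cux (connect1 _); rewrite /radj xy yF in_setU xF orbT.
have : v \in Z by apply: connect_invariant clo _ cuv; rewrite !inE eqxx.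
by rewrite in_setU in_set1 eq_sym (negbTE uv).
Qed.

(* The edges outside of pairs V never appear, so they may be declared joining. *)
Definition joins (V : finType) (e : {set V}) : pred {set {set V}} := fun E =>
  (e \notin pairs V) ||
  [exists u in e, exists v in e, (u != v) && connect (adj E) u v].

Lemma joins_up (V : finType) (e : {set V}) : up_closed (joins e).
Proof.
move=> E E' EE' /orP[h|]; first by rewrite /joins h.
move=> /existsP[u /andP[ue /existsP[v /andP[ve /andP[uv cuv]]]]].
apply/orP; right; apply/existsP; exists u; rewrite ue; apply/existsP; exists v.
rewrite ve uv /=; apply: connect_sub cuv => x y xy; apply: connect1.
exact: sub_adj xy.
Qed.

Lemma outerplanar_joins (V : finType) (E : {set {set V}}) e :
  `[< outerplanar E >] -> ~~ `[< outerplanar (e |: E) >] -> joins e E.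
Proof.
move=> /asboolP oE; apply: contraR; rewrite negb_or negbK inE.
move=> /andP[/cards2P[u [v [uv ->]]] nj]; apply/asboolP.
apply: outerplanar_bridge => //; apply: contra nj => cuv.
apply/existsP; exists u; rewrite !inE eqxx; apply/existsP; exists v.
by rewrite !inE eqxx orbT uv.
Qed.

Lemma outerplanar_down (V : finType) :
  down_closed (fun E : {set {set V}} => `[< outerplanar E >]).
Proof.
by move=> E E' EE' /asboolP h; apply/asboolP; apply: outerplanar_sub h.
Qed.

Lemma sum_pr_joins (V : finType) (t : R) : 0 <= t <= 1 ->
  \sum_(e in pairs V) pr (unif (pairs V) t) (joins e) <=
  \sum_u expec (unif (pairs V) t) (fun E => #|reach [set u] (~: [set u]) E|%:R).
Proof.
move=> ht; have pp := unif_prob (pairs V) ht.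
apply: (@le_trans _ _ (\sum_(w : V * V | w.1 != w.2)
   pr (unif (pairs V) t) (fun E => connect (adj E) w.1 w.2))).
  rewrite [leRHS](partition_big (fun w => [set w.1; w.2]) (mem (pairs V))) /=; last first.
    by move=> [u v] /= uv; rewrite inE cards2 uv.
  apply: ler_sum => e ep; apply: pr_bound_sum => // E.
  rewrite /joins ep /= => /existsP[u /andP[ue /existsP[v /andP[ve /andP[uv cuv]]]]].
  apply/hasP; exists (u, v); first exact: mem_index_enum.
  rewrite /= uv cuv andbT /= eqEcard subUset !sub1set ue ve /=.
  by move: ep; rewrite inE => /eqP ->; rewrite cards2 uv.
rewrite (eq_bigr (fun w => pr (unif (pairs V) t)
  (fun E => connect (adj E) (w.1, w.2).1 (w.1, w.2).2))) //.
rewrite -(pair_big_dep xpredT (fun u v => u != v) (fun u v => pr (unif (pairs V) t)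
  (fun E => connect (adj E) u v))) /=.
apply: ler_sum => u _; rewrite -expec_sum; apply: le_expec => // E.
rewrite -natr_sum ler_nat -sum1_card.
rewrite [leqLHS]big_mkcond [leqRHS]big_mkcond /=; apply: leq_sum => v _.
case: ifP => // uv; case: (boolP (connect (adj E) u v)) => // cuv.
by rewrite connect_reach.
Qed.

Lemma prod_1B_ge (I : finType) (x : I -> R) :
  (forall i, 0 <= x i <= 1 / 2) -> expR (- (2 * \sum_i x i)) <= \prod_i (1 - x i).
Proof.
move=> hx; rewrite mulr_sumr -sumrN expR_sum; apply: ler_prod => i _.
rewrite expR_ge0 /=; have /andP[x0 x1] := hx i.
rewrite expRN; have := expR_ge1Dx (2 * x i); set e := expR _ => he.
have e0 : 0 < e by exact: expR_gt0.
rewrite -[X in X <= _]mul1r ler_pdivrMr //; nra.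
Qed.

(** 3/4 is the probability at the start of the sprinkling. The exponent is twice a bound for the
    total cost of the sprinkling, by [1 - x >= expR (- (2 * x))] on [0, 1/2]. *)
Definition window_cst (D : R) : R :=
  3 / 4 * expR (- (4 * (D + 2) * (2 * expR (128 * D ^+ 2 * (D + 1)) + 1))).

Lemma pr_outerplanar_window (h D : R) (n : nat) :
  n%:R = h ^+ 3 -> 1 <= D -> 256 * D <= h ->
  window_cst D <= pr (unif (pairs 'I_n) ((1 + D / h) / n%:R))
                     (fun E => `[< outerplanar E >]).
Proof.
move=> nh D1 Dh; set t1 := _ / _.
have h0 : 0 < h by lra.
have n0 : 0 < n%:R :> R by rewrite nh exprn_gt0.
have n32 : 32 <= n%:R :> R.
  have h256 : 256 <= h by lra.
  have : h * 1 <= h * (h * h) by rewrite ler_pM2l //; nra.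
  by rewrite mulr1 => h3; rewrite nh (_ : h ^+ 3 = h * (h * h)); [lra|ring].
have t1_1 : t1 <= 1 by exact: window_prob.
have t1_0 : 0 <= t1 by rewrite divr_ge0 ?addr_ge0 ?divr_ge0 //; lra.
have ht1 : 0 <= t1 <= 1 by rewrite t1_0.
(* The constant 2 is such that [2 * t0] is at most (2 / h)^3 / 4, so that [pr_bichord] bounds the
   failure probability by 1/4. *)
pose t0 : R := (1 - 2 / h) / n%:R.
have h2 : 0 < 2 / h <= 1 / 2 by rewrite divr_gt0 //= ler_pdivrMr //; lra.
have nt0 : n%:R * t0 = 1 - 2 / h by rewrite /t0 mulrC divfK // gt_eqF.
have t0_0 : 0 <= t0 by rewrite divr_ge0 //; lra.
have t0_2 : t0 <= 1 / 2 by rewrite /t0 ler_pdivrMr //; lra.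
have ht0 : 0 <= t0 <= 1 by rewrite t0_0; lra.
have p0 := unif_prob (pairs 'I_n) ht0; have p1 := unif_prob (pairs 'I_n) ht1.
have v0 : 'I_n by case: (n) n0 => [|k _]; [rewrite ltxx|exact: ord0].
have sub : 3 / 4 <= pr (unif (pairs 'I_n) t0) (fun E => `[< outerplanar E >]).
  have := @pr_bichord _ v0 R t0 t0_0; rewrite card_ord nt0.
  have c1 : 1 - 2 / h <= 1 by lra.
  have c2 : t0 <= 1 by lra.
  have c3 : (0 < n)%N by rewrite -(ltr_nat R).
  move=> /(_ c1 c2 c3); rewrite prC subKr.
  have -> : 2 * t0 = (2 / h) ^+ 3 * (1 / 4 * (1 - 2 / h)).
    by rewrite /t0 nh; field; rewrite gt_eqF.
  by rewrite ler_pM2l ?exprn_gt0 //; lra.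
pose K : R := 2 * expR (128 * D ^+ 2 * (D + 1)) + 1.
have K0 : 0 < K by rewrite /K ltr_pwDr // mulr_ge0 ?expR_ge0.
pose x e := (unif (pairs 'I_n) t1 e - unif (pairs 'I_n) t0 e) /
  (1 - unif (pairs 'I_n) t0 e) * pr (unif (pairs 'I_n) t1) (joins e).
have t10 : t1 - t0 = (D + 2) / h / n%:R by rewrite /t1 /t0; field; rewrite !gt_eqF.
have t01 : t0 <= t1.
  by rewrite -subr_ge0 t10; apply: divr_ge0; [apply: divr_ge0|]; lra.
have t10s : t1 - t0 <= 1 / 4.
  rewrite t10 ler_pdivrMr // ler_pdivrMr //; nra.
have xb e : 0 <= x e <= (if e \in pairs 'I_n then
    2 * (t1 - t0) * pr (unif (pairs 'I_n) t1) (joins e) else 0).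
  rewrite /x /unif; case: ifP => _; last by rewrite subrr !mul0r lexx.
  have pj := pr_ge0 (joins e) p1.
  have c1 : 0 < 1 - t0 by lra.
  rewrite mulr_ge0 ?divr_ge0 ?subr_ge0 //=; last by lra.
  rewrite ler_wpM2r // ler_pdivrMr //; nra.
have x12 e : 0 <= x e <= 1 / 2.
  have /andP[-> h1] := xb e; apply: le_trans h1 _; case: ifP => _; last by lra.
  have pj := pr_ge0 (joins e) p1; have pj1 := pr_le1 (joins e) p1.
  nra.
(* The increment [t1 - t0] is (D + 2) / (h n), and each of the [n] vertices is joined to at most
   [K * h] others in expectation: the powers of [h] and [n] cancel. *)
have sumx : \sum_e x e <= 2 * (D + 2) * K.
  apply: le_trans (ler_sum _ (fun e _ => (andP (xb e)).2)) _.
  rewrite -big_mkcond /= -mulr_sumr.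
  apply: le_trans (_ : 2 * (t1 - t0) * (n%:R * (K * h)) <= _); last first.
    rewrite t10 le_eqVlt; apply/orP; left; apply/eqP; field; by rewrite !gt_eqF.
  apply: ler_wpM2l; first by rewrite mulr_ge0 // subr_ge0.
  apply: le_trans (sum_pr_joins _ ht1) _.
  apply: le_trans (ler_sum _ (fun u _ => expec_reach_vertex u nh D1 Dh)) _.
  by rewrite -/t1 -/K sumr_const card_ord mulr_natl.
apply: le_trans (_ : pr (unif (pairs 'I_n) t0) (fun E => `[< outerplanar E >]) *
    \prod_e (1 - x e) <= _); last first.
  apply: sprinkling => //.
  - by move=> e; rewrite /unif; case: ifP.
  - by move=> e; rewrite /unif; case: ifP => _; lra.
  - exact: outerplanar_down.
  - move=> e; exact: joins_up.
  - move=> E e; exact: outerplanar_joins.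
  - by move=> e; have /andP[_ h1] := x12 e; apply: le_trans h1 _; lra.
rewrite /window_cst; apply: ler_pM => //.
apply: le_trans (prod_1B_ge x12); rewrite ler_expR lerN2 -/K.
have -> : 4 * (D + 2) * K = 2 * (2 * (D + 2) * K) by ring.
by rewrite ler_pM2l.
Qed.

Lemma card_pairs n : #|pairs 'I_n| = 'C(n, 2).
Proof.
rewrite -[in RHS](card_ord n) -cardsT -cards_draws.
by apply: eq_card => e; rewrite !inE subsetT.
Qed.

Lemma natr_bin2 (n : nat) : 'C(n, 2)%:R = n%:R * (n%:R - 1) / 2 :> R.
Proof.
elim: n => [|n IH]; first by rewrite bin0n mul0r mul0r.
by rewrite binS bin1 natrD IH -[n.+1%:R]natr1; field.
Qed.

Lemma draw_pr_outerplanar (h C : R) (n m : nat) :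
  n%:R = h ^+ 3 -> 0 <= C -> 256 * (2 * C + 4) <= h ->
  m%:R <= n%:R / 2 + C * h ^+ 2 ->
  (m <= #|pairs 'I_n|)%N /\
  window_cst (2 * C + 4) - 1 / h
  <= draw_pr R (pairs 'I_n) m (fun E => `[< outerplanar E >]).
Proof.
move=> nh C0 Ch mn; set D := 2 * C + 4 in Ch *.
have D1 : 1 <= D by rewrite /D; lra.
have h0 : 0 < h by lra.
have h256 : 1024 <= h by rewrite /D in Ch; lra.
have n0 : 0 < n%:R :> R by rewrite nh exprn_gt0.
have h1 : h <= h ^+ 2 by rewrite expr2 ler_peMl //; lra.
set t := (1 + D / h) / n%:R.
have t1 : t <= 1 by exact: window_prob.
have t0 : 0 <= t by rewrite divr_ge0 ?addr_ge0 ?divr_ge0 //; lra.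
have ht : 0 <= t <= 1 by rewrite t0.
have Nt : #|pairs 'I_n|%:R * t = (h ^+ 3 + D * h ^+ 2 - 1 - D / h) / 2.
  by rewrite card_pairs natr_bin2 /t nh; field; rewrite !gt_eqF.
have Dh1 : D / h <= 1 by rewrite ler_pdivrMr //; lra.
have Dh0 : 0 <= D / h by rewrite divr_ge0 //; lra.
(* The mean number of edges is about h^3 / 2 + (C + 2) h^2. It exceeds [m] by at least h^2, while
   the variance is at most of order h^3, so Chebyshev's inequality gives the error 1/h. *)
have dev : m%:R + h ^+ 2 <= #|pairs 'I_n|%:R * t.
  rewrite Nt; rewrite nh in mn; rewrite /D in Dh1 *; lra.
have NK : #|pairs 'I_n|%:R * t <= #|pairs 'I_n|%:R by rewrite ler_piMr.
have mK : (m <= #|pairs 'I_n|)%N.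
  rewrite -(ler_nat R); apply: le_trans NK; apply: le_trans dev.
  by rewrite lerDl sqr_ge0.
split=> //.
have := pr_le_draw ht (@outerplanar_down _) mK.
have := pr_outerplanar_window nh D1 Ch; rewrite -/t => e1 e2.
rewrite lerBlDl; apply: le_trans e1 (le_trans e2 _); rewrite lerD2r.
apply: le_trans (pr_card_dev (a := h ^+ 2) ht _ _) _; first by rewrite exprn_gt0.
  move=> E _ /= Em; rewrite distrC ler_normr; apply/orP; left.
  rewrite lerBrDr addrC; apply: le_trans dev; rewrite lerD2r ler_nat; exact: ltnW.
rewrite ler_pdivrMr ?exprn_gt0 // Nt.
have -> : 1 / h * (h ^+ 2) ^+ 2 = h ^+ 3 by field; rewrite gt_eqF.
have : D * h ^+ 2 <= h * h ^+ 2 by rewrite ler_wpM2r ?sqr_ge0 //; lra.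
by rewrite -exprS; lra.
Qed.

End CriticalWindow.

(** * Upper tail of the maximum degree *)

Section UpperTail.
Variable R : realType.

Lemma bin_ratio_le (N m d : nat) : (d <= m)%N -> (m <= N)%N ->
  'C(N - d, m - d)%:R <= (m%:R / N%:R) ^+ d * 'C(N, m)%:R :> R.
Proof.
elim: d m N => [|d IH] [|m] [|N] //; first by rewrite !subn0 expr0 mul1r.
  by rewrite !subn0 expr0 mul1r.
  by rewrite !subn0 expr0 mul1r.
rewrite !ltnS => dm mN; rewrite !subSS; apply: le_trans (IH m N dm mN) _.
have e : 'C(N, m)%:R = m.+1%:R / N.+1%:R * 'C(N.+1, m.+1)%:R :> R.
  have /(congr1 (fun k => k%:R : R)) := mul_bin_diag N.+1 m; rewrite /= !natrM => h.
  by rewrite mulrAC -h mulrAC divff ?mul1r // pnatr_eq0.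
rewrite e mulrA exprSr ler_wpM2r // ler_wpM2r ?divr_ge0 //.
apply: lerXn2r; rewrite ?nnegrE ?divr_ge0 //.
have [->|N0] := posnP N; first by rewrite invr0 mulr0 divr_ge0.
rewrite ler_pdivrMr ?ltr0n // mulrAC ler_pdivlMr ?ltr0n // -!natrM ler_nat.
by rewrite !mulnS !mulSn; move: mN; rewrite mulnC => mN; lia.
Qed.

Lemma draw_pr_sub_le (T : finType) (K D : {set T}) (m : nat) :
  D \subset K -> (m <= #|K|)%N ->
  draw_pr R K m (fun E => D \subset E) <= (m%:R / #|K|%:R) ^+ #|D|.
Proof.
move=> DK mK; rewrite /draw_pr ler_pdivrMr ?draws_gt0 // card_draws_bin.
have [dm|md] := leqP #|D| m; last first.
  rewrite (_ : [set E in draws K m | D \subset E] = set0).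
    by rewrite cards0 mulr_ge0 ?exprn_ge0 ?divr_ge0.
  apply/setP => E; rewrite !inE; apply/negbTE/negP => /andP[/andP[_ /eqP Em]].
  by move=> /subset_leq_card; rewrite Em leqNgt md.
apply: le_trans (bin_ratio_le dm mK); rewrite ler_nat.
have -> : (#|K| - #|D| = #|K :\: D|)%N by rewrite cardsD (setIidPr DK).
rewrite -card_draws_bin -(card_in_imset (f := fun E => E :\: D)).
  apply: subset_leq_card; apply/subsetP => _ /imsetP[E + ->].
  rewrite !inE => /andP[/andP[EK /eqP Em] DE]; rewrite setSD //=.
  by rewrite cardsD (setIidPr DE) Em.
move=> E E'; rewrite !inE => /andP[_ DE] /andP[_ DE'] e.
by rewrite -(setID E D) -(setID E' D) e (setIidPr DE) (setIidPr DE').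
Qed.

Lemma draw_pr_bound_sum (T : finType) (K : {set T}) (m : nat) (I : finType)
    (P : pred I) (A : pred {set T}) (B : I -> pred {set T}) :
  (forall E : {set T}, E \in draws K m -> A E -> exists i, P i && B i E) ->
  draw_pr R K m A <= \sum_(i | P i) draw_pr R K m (B i).
Proof.
move=> AB; rewrite /draw_pr -mulr_suml ler_wpM2r ?invr_ge0 //.
rewrite -natr_sum ler_nat.
apply: leq_trans (_ : #|\bigcup_(i | P i) [set E in draws K m | B i E]| <= _)%N.
  apply: subset_leq_card; apply/subsetP => E; rewrite inE => /andP[Ed AE].
  have [i /andP[Pi Bi]] := AB E Ed AE.
  by apply/bigcupP; exists i => //; rewrite inE Ed.
elim/big_ind2: _ => //; first by rewrite cards0.
move=> A1 n1 A2 n2 h1 h2; apply: leq_trans (leq_card_setU _ _) _; exact: leq_add.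
Qed.

Definition star_at (V : finType) (v : V) : {set {set V}} := star v (~: [set v]).

Lemma star_at_pairs (V : finType) (v : V) : star_at v \subset pairs V.
Proof. by apply: star_pairs; rewrite !inE eqxx. Qed.

Lemma card_star_at n (v : 'I_n) : #|star_at v| = n.-1.
Proof. by rewrite card_star ?cardsC1 ?card_ord // !inE eqxx. Qed.

Lemma in_star_at (V : finType) (e : {set V}) v :
  e \in pairs V -> (e \in star_at v) = (v \in e).
Proof.
rewrite inE => /cards2P[x [y [xy ->]]]; apply/imsetP/idP => [[z _ ->]|].
  by rewrite !inE eqxx.
rewrite !inE => /orP[]/eqP->; first by exists y; rewrite // !inE eq_sym.
by exists x; rewrite ?inE // setUC.
Qed.

Lemma degree_star (V : finType) (E : {set {set V}}) v : E \subset pairs V ->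
  degree E v = #|E :&: star_at v|.
Proof.
move=> EK; apply: eq_card => e; rewrite !inE.
by case: (boolP (e \in E)) => //= eE; rewrite in_star_at // (subsetP EK).
Qed.

Lemma max_degree_geP (V : finType) (E : {set {set V}}) d : (0 < d)%N ->
  (d <= max_degree E)%N -> exists v, (d <= degree E v)%N.
Proof.
move=> d0; rewrite /max_degree => h; apply/existsP; move: h; apply: contraLR.
rewrite negb_exists => /forallP h; rewrite -ltnNge.
by rewrite -(prednK d0) ltnS; apply/bigmax_leqP => v _; have := h v; lia.
Qed.

Definition rate (n m d : nat) : R := n%:R * (2 * m%:R / n%:R) ^+ d / d`!%:R.

(** Union bound over a vertex and [d] edges at it, carried out directly for uniform draws. *)
Lemma draw_pr_max_degree_ge (n m d : nat) : (1 < n)%N -> (0 < d)%N ->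
  (m <= #|pairs 'I_n|)%N ->
  draw_pr R (pairs 'I_n) m (fun E => (d <= max_degree E)%N) <= rate n m d.
Proof.
move=> n1 d0 mK; set K := pairs 'I_n.
apply: (@le_trans _ _ (\sum_(w : 'I_n * {set {set 'I_n}} |
    (w.2 \subset star_at w.1) && (#|w.2| == d)) draw_pr R K m (fun E => w.2 \subset E))).
  apply: draw_pr_bound_sum => E; rewrite inE => /andP[EK _] /(max_degree_geP d0)[v].
  rewrite degree_star // => hd.
  have : (0 < #|[set D : {set {set 'I_n}} | D \subset E :&: star_at v & #|D| == d]|)%N.
    by rewrite cards_draws bin_gt0.
  rewrite card_gt0 => /set0Pn[D]; rewrite inE subsetI => /andP[/andP[DE DS] Dd].
  by exists (v, D); rewrite /= DS Dd.
apply: (@le_trans _ _ (\sum_(w : 'I_n * {set {set 'I_n}} |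
    (w.2 \subset star_at w.1) && (#|w.2| == d)) (m%:R / #|K|%:R) ^+ d)).
  apply: ler_sum => -[v D] /= /andP[DS /eqP Dd]; rewrite -[X in _ ^+ X]Dd.
  by apply: draw_pr_sub_le => //; apply: subset_trans DS (star_at_pairs v).
rewrite sumr_const [X in _ *+ X](_ : _ = n * 'C(n.-1, d))%N; last first.
  transitivity (\sum_(v : 'I_n) \sum_(D : {set {set 'I_n}} |
      (D \subset star_at v) && (#|D| == d)) 1)%N.
    by rewrite pair_big_dep -[LHS]sum1_card; apply: eq_bigl.
  rewrite (eq_bigr (fun=> 'C(n.-1, d))); first by rewrite sum_nat_const card_ord.
  move=> v _; rewrite -[in RHS](card_star_at v) -cards_draws -sum1_card.
  by apply: eq_bigl => D; rewrite inE.
rewrite -[leLHS]mulr_natl natrM -mulrA /rate -mulrA ler_wpM2l //.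
have n0 : 0 < n%:R :> R by rewrite ltr0n ltnW.
have n10 : 0 < n%:R - 1 :> R by rewrite subr_gt0 ltr1n.
rewrite ler_pdivlMr ?ltr0n ?fact_gt0 // [leLHS]mulrAC -(natrM _ 'C(_, _)) bin_ffact.
have -> : (2 * m%:R / n%:R) ^+ d = (n.-1 ^ d)%:R * (m%:R / #|K|%:R) ^+ d :> R.
  rewrite natrX -exprMn; congr (_ ^+ _); rewrite card_pairs natr_bin2 -subn1 natrB 1?ltnW //.
  by field; rewrite !gt_eqF.
rewrite ler_wpM2r ?exprn_ge0 ?divr_ge0 // ler_nat ffact_prod.
rewrite -[X in (_ <= _ ^ X)%N](card_ord d).
by rewrite -prod_nat_const; apply: leq_prod => i _; exact: leq_subr.
Qed.

End UpperTail.

(** * Second moment method for the binomial random graph *)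

Section LowerTail.
Variable R : realType.

Lemma pr_card_inter_le (T : finType) (K S : {set T}) (t : R) j : 0 <= t <= 1 ->
  pr (unif K t) (fun E => #|E :&: S| == j) <= 'C(#|S|, j)%:R * t ^+ j.
Proof.
move=> ht; have pp := unif_prob K ht; have /andP[t0 _] := ht.
apply: (@le_trans _ _ (\sum_(D : {set T} | (D \subset S) && (#|D| == j))
    pr (unif K t) (fun E => D \subset E))).
  apply: pr_bound_sum => // E /eqP Ej; apply/hasP.
  exists (E :&: S); first exact: mem_index_enum.
  by rewrite subsetIr Ej eqxx subsetIl.
apply: (@le_trans _ _ (\sum_(D : {set T} | (D \subset S) && (#|D| == j)) t ^+ j)).
  apply: ler_sum => D /andP[_ /eqP <-]; rewrite pr_subset -prodr_const.
  by apply: ler_prod => e _; rewrite /unif; case: ifP; rewrite ?lexx ?t0.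
rewrite sumr_const -[leLHS]mulr_natl ler_wpM2r ?exprn_ge0 // ler_nat.
rewrite -cards_draws; apply: subset_leq_card; apply/subsetP => D.
by rewrite inE.
Qed.

Lemma pr_card_inter_ge (T : finType) (K S : {set T}) (t : R) d : 0 <= t <= 1 ->
  S \subset K ->
  'C(#|S|, d)%:R * t ^+ d * (1 - t) ^+ #|S| <= pr (unif K t) (fun E => d <= #|E :&: S|)%N.
Proof.
move=> ht SK; have pp := unif_prob K ht; have /andP[t0 t1] := ht.
apply: (@le_trans _ _ (\sum_(D : {set T} | (D \subset S) && (#|D| == d))
    pr (unif K t) (fun E => E :&: S == D))).
  apply: (@le_trans _ _ (\sum_(D : {set T} | (D \subset S) && (#|D| == d))
     (t ^+ d * (1 - t) ^+ #|S|))).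
    rewrite sumr_const -[leRHS]mulr_natl -mulrA ler_wpM2r.
    - by [].
    - by rewrite mulr_ge0 ?exprn_ge0 // subr_ge0.
    rewrite ler_nat -cards_draws; apply: subset_leq_card; apply/subsetP => D.
    by rewrite inE.
  apply: ler_sum => D /andP[DS /eqP <-]; rewrite pr_inter //.
  rewrite (bigID (mem D)) /=; apply: ler_pM.
  - by rewrite exprn_ge0.
  - by rewrite exprn_ge0 // subr_ge0.
  - rewrite -prodr_const le_eqVlt; apply/orP; left; apply/eqP.
    apply: eq_big => [e|e eD].
      by case: (boolP (e \in D)) => eD; rewrite ?andbF // (subsetP DS).
    by rewrite eD /unif (subsetP SK) // (subsetP DS).
  rewrite (eq_bigr (fun=> 1 - t)); last first.
    by move=> e /andP[eS /negbTE ->]; rewrite /unif (subsetP SK).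
  rewrite prodr_const; apply: ler_wiXn2l; rewrite ?subr_ge0 //; first by rewrite gerBl.
  by apply: subset_leq_card; apply/subsetP => e /andP[].
rewrite -expec_sum; apply: le_expec => // E.
have [Ed|Ed] := eqVneq #|E :&: S| d.
  rewrite (bigD1 (E :&: S)) /=; last by rewrite subsetIr Ed eqxx.
  rewrite eqxx Ed leqnn big1 ?addr0 //.
  by move=> D /andP[_ DE]; rewrite eq_sym (negbTE DE).
rewrite big1 // => D /andP[_ /eqP Dd]; case: eqP => // ED.
by rewrite ED Dd eqxx in Ed.
Qed.

Section SecondMoment.
Variables (n d : nat) (t : R).
Hypotheses (ht : 0 <= t <= 1) (d0 : (0 < d)%N) (n1 : (1 < n)%N).
Let V := 'I_n.
Let K := pairs V.
Let p := unif K t.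
Let X (v : V) : pred {set {set V}} := fun E => (d <= #|E :&: star_at v|)%N.
Let pp : is_prob p := unif_prob K ht.

Lemma setU1_inter (T : finType) (e : T) (E S : {set T}) : e \in S ->
  #|(e |: E) :&: S| = #|E :&: (S :\ e)|.+1.
Proof.
move=> eS; rewrite (cardsD1 e) !inE eqxx eS add1n; congr _.+1; apply: eq_card => x.
by rewrite !inE; case: (x == e); rewrite ?andbF.
Qed.

Lemma setD1_inter (T : finType) (e : T) (E S : {set T}) :
  #|(E :\ e) :&: S| = #|E :&: (S :\ e)|.
Proof. by apply: eq_card => x; rewrite !inE; case: (x == e); rewrite ?andbF. Qed.

(** The probability of at least [k] edges at [u] besides [uv]; the presence of [uv] lowers the
    required number from [d] to [d.-1]. *)
Let a (u v : V) k := pr p (fun E => k <= #|E :&: (star_at u :\ [set u; v])|)%N.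

Lemma pair_edge (u v : V) : u != v ->
  [/\ [set u; v] \in K, [set u; v] \in star_at u & [set u; v] \in star_at v].
Proof.
move=> uv; have eK : [set u; v] \in K by rewrite inE cards2 uv.
by rewrite eK !in_star_at // !inE !eqxx orbT.
Qed.

Lemma pr_star_split (u v : V) : u != v ->
  pr p (X u) = t * a u v d.-1 + (1 - t) * a u v d.
Proof.
move=> uv; have [eK eu _] := pair_edge uv.
rewrite /pr (expec_split _ [set u; v]) /p {1 3}/unif eK.
congr (_ * _ + _ * _); apply: eq_expec => E; rewrite /X.
  by rewrite setU1_inter // -{1}(prednK d0) ltnS.
by rewrite setD1_inter.
Qed.

(* Conditionally on the state of the edge uv, the degrees of u and v are
   independent. *)
Lemma pr_star_pair_split (u v : V) : u != v ->
  pr p (fun E => X u E && X v E) =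
  t * (a u v d.-1 * a v u d.-1) + (1 - t) * (a u v d * a v u d).
Proof.
move=> uv; have [eK eu ev] := pair_edge uv.
pose S := star_at u :\ [set u; v].
have ind k : pr p (fun E => (k <= #|E :&: (star_at u :\ [set u; v])|) &&
      (k <= #|E :&: (star_at v :\ [set v; u])|))%N = a u v k * a v u k.
  rewrite /pr (@eq_expec _ _ _ _ (fun E => (k <= #|E :&: (star_at u :\ [set u; v])|)%N%:R *
      (k <= #|E :&: (star_at v :\ [set v; u])|)%N%:R)); last first.
    by move=> E; case: (k <= _)%N; rewrite /= ?mul1r ?mul0r.
  apply: (@expec_indep _ _ _ S) => E E' e; first by rewrite -/S e.
  have sub F : F :&: (star_at v :\ [set v; u]) = (F :\: S) :&: (star_at v :\ [set v; u]).
    apply/setP => x; rewrite !inE.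
    case: (boolP (x \in star_at v)) => xv; last by rewrite !andbF.
    case: (boolP (x == [set v; u])) => xvu; first by rewrite !andbF.
    rewrite setUC xvu /=; case: (boolP (x \in star_at u)) => //= xu.
    exfalso; have xK := subsetP (star_at_pairs v) x xv.
    rewrite in_star_at // in xv; rewrite in_star_at // in xu.
    move/negP: xvu; apply; rewrite eq_sym eqEcard subUset !sub1set xu xv /=.
    by move: xK; rewrite inE => /eqP ->; rewrite cards2 eq_sym uv.
  by rewrite (sub E) (sub E') e.
rewrite -!ind /pr (expec_split _ [set u; v]) /p {1 3}/unif eK.
congr (_ * _ + _ * _); apply: eq_expec => E; rewrite /X.
  rewrite !setU1_inter // [[set v; u]]setUC.
  have hd k : (d <= k.+1)%N = (d.-1 <= k)%N by rewrite -{1}(prednK d0).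
  by rewrite !hd.
by rewrite !setD1_inter [[set v; u]]setUC.
Qed.

Lemma card_star_D1 (u v : V) : u != v -> #|star_at u :\ [set u; v]| = n.-2.
Proof.
move=> uv; have [_ eu _] := pair_edge uv.
by have := card_star_at u; rewrite (cardsD1 [set u; v]) eu => <-.
Qed.

(** The difference is the probability that [u] has exactly [d.-1] other edges, which is when [uv]
    decides whether its degree reaches [d]. *)
Lemma diff_le (u v : V) : u != v ->
  0 <= a u v d.-1 - a u v d <= 'C(n.-2, d.-1)%:R * t ^+ d.-1.
Proof.
move=> uv; rewrite subr_ge0 -(card_star_D1 uv); apply/andP; split.
  by apply: le_pr => // E; apply: leq_trans; exact: leq_pred.
apply: le_trans (pr_card_inter_le K _ _ ht); rewrite lerBlDr /a /pr -expecD.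
apply: le_expec => // E; rewrite -natrD ler_nat.
move: #|_| => k; rewrite -(prednK d0) /=; case: (ltngtP d.-1 k) => //.
Qed.

Let q v := pr p (X v).
Let Q := \sum_v q v.
Let amax : R := 'C(n.-2, d.-1)%:R * t ^+ d.-1.

Lemma second_moment_le :
  expec p (fun E => (\sum_v ((X v E)%:R - q v)) ^+ 2) <= Q + n%:R ^+ 2 * (t * amax ^+ 2).
Proof.
have /andP[t0 t1] := ht.
under eq_expec do rewrite expr2 mulr_suml; rewrite expec_sum.
have -> : Q + n%:R ^+ 2 * (t * amax ^+ 2) = \sum_v (q v + n%:R * (t * amax ^+ 2)).
  rewrite big_split /= sumr_const card_ord; congr (_ + _).
  by rewrite -[RHS]mulr_natl [RHS]mulrA -expr2.
apply: ler_sum => u _.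
under eq_expec do rewrite mulr_sumr; rewrite expec_sum (bigD1 u) //=; apply: lerD.
  rewrite (@eq_expec _ _ _ _ (fun E => (1 - 2 * q u) * (X u E)%:R + q u ^+ 2)).
    rewrite expecD expecZ -/(pr p (X u)) -/(q u) expec_cst.
    have := sqr_ge0 (q u); lra.
  by move=> E; case: (X u E) => /=; ring.
apply: (@le_trans _ _ (\sum_(v | v != u) t * amax ^+ 2)); last first.
  rewrite sumr_const -[leLHS]mulr_natl; apply: ler_wpM2r.
    by apply: mulr_ge0 => //; exact: sqr_ge0.
  rewrite ler_nat.
  by rewrite -[leqRHS](card_ord n) max_card.
apply: ler_sum => v vu; have uv : u != v by rewrite eq_sym.
rewrite (@eq_expec _ _ _ _ (fun E => (X u E && X v E)%:R + ((- q v) * (X u E)%:R +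
   ((- q u) * (X v E)%:R + q u * q v)))); last first.
  by move=> E; case: (X u E); case: (X v E) => /=; ring.
rewrite !expecD !expecZ -!/(pr p _) expec_cst -!/(q _) pr_star_pair_split //.
rewrite /q (pr_star_split uv) (pr_star_split vu).
have /andP[h1 h2] := diff_le uv; have /andP[h3 h4] := diff_le vu.
set a1 := a u v d.-1 in h1 h2 *; set a2 := a u v d in h1 h2 *.
set b1 := a v u d.-1 in h3 h4 *; set b2 := a v u d in h3 h4 *.
(* The covariance of the two events is the variance of the edge [uv] times its influence on each of
   them. *)
have -> : t * (a1 * b1) + (1 - t) * (a2 * b2) +
   (- (t * b1 + (1 - t) * b2) * (t * a1 + (1 - t) * a2) +
    (- (t * a1 + (1 - t) * a2) * (t * b1 + (1 - t) * b2) +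
     (t * a1 + (1 - t) * a2) * (t * b1 + (1 - t) * b2))) =
   t * ((1 - t) * ((a1 - a2) * (b1 - b2))) by ring.
rewrite ler_wpM2l // expr2.
apply: le_trans (_ : 1 * ((a1 - a2) * (b1 - b2)) <= _).
  by rewrite ler_wpM2r ?mulr_ge0 // gerBl.
by rewrite mul1r; apply: ler_pM.
Qed.

Let qmin : R := 'C(n.-1, d)%:R * t ^+ d * (1 - t) ^+ n.-1.

(** If no vertex has degree [d], the centred sum of the indicators equals [- Q], so the second
    moment is divided by [Q ^+ 2], and [Q] is at least [n%:R * qmin]. *)
Lemma pr_max_degree_lt : 0 < qmin ->
  pr p (fun E => max_degree E < d)%N <= 1 / (n%:R * qmin) + t * amax ^+ 2 / qmin ^+ 2.
Proof.
move=> q0; have /andP[t0 t1] := ht.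
have n0 : 0 < n%:R :> R by rewrite ltr0n ltnW.
have qv v : qmin <= q v.
  by rewrite /qmin -(card_star_at v); apply: pr_card_inter_ge (star_at_pairs v).
have Qq : n%:R * qmin <= Q.
  rewrite -[n in n%:R](card_ord n) mulr_natl -sumr_const; exact: ler_sum.
have Q0 : 0 < Q by apply: lt_le_trans Qq; rewrite mulr_gt0.
have nq0 : 0 < n%:R * qmin by rewrite mulr_gt0.
apply: (@le_trans _ _ (pr p (fun E => Q ^+ 2 <= (\sum_v ((X v E)%:R - q v)) ^+ 2))).
  apply: ler_sum => E _; have [EK|/weight_unif0] := boolP (E \subset K); last first.
    by rewrite /p => ->; rewrite !mul0r.
  rewrite ler_wpM2l ?weight_ge0 // ler_nat.
  case: (ltnP (max_degree E) d) => // hE; rewrite lt0b.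
  rewrite sumrB big1 ?sub0r ?sqrrN //.
  move=> v _; rewrite /X -degree_star // leqNgt.
  by rewrite (leq_ltn_trans _ hE) //; exact: (leq_bigmax v).
apply: le_trans (pr_markov (f := fun E => (\sum_v ((X v E)%:R - q v)) ^+ 2) pp _ _) _.
- by rewrite exprn_gt0.
- by move=> E; exact: sqr_ge0.
apply: le_trans (ler_wpM2r _ second_moment_le) _; first by rewrite invr_ge0 sqr_ge0.
rewrite mulrDl; apply: lerD.
  rewrite expr2 invfM mulrA divff ?gt_eqF // !mul1r lef_pV2 ?posrE //.
rewrite ler_pdivrMr ?exprn_gt0 //.
apply: le_trans (_ : t * amax ^+ 2 / qmin ^+ 2 * (n%:R * qmin) ^+ 2 <= _).
  rewrite le_eqVlt; apply/orP; left; apply/eqP; field; exact: lt0r_neq0.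
apply: ler_wpM2l.
  by apply: divr_ge0; [apply: mulr_ge0 => //; exact: sqr_ge0|exact: sqr_ge0].
by rewrite lerXn2r ?nnegrE // ltW.
Qed.

End SecondMoment.
End LowerTail.

(** * Lower tail of the maximum degree for uniform draws *)

Section LowerTailBound.
Variable R : realType.

Lemma onem_pow_ge (x : R) k : 0 <= x <= 1 / 2 -> expR (- (2 * x * k%:R)) <= (1 - x) ^+ k.
Proof.
move=> /andP[x0 x1].
have -> : - (2 * x * k%:R) = k%:R * (- (2 * x)) by ring.
rewrite expRM_natl lerXn2r ?nnegrE ?expR_ge0 ?subr_ge0 //; first by lra.
rewrite expRN; have := expR_ge1Dx (2 * x); set e := expR _ => he.
have e0 : 0 < e by exact: expR_gt0.
rewrite -[X in X <= _]mul1r ler_pdivrMr //; nra.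
Qed.

Lemma bernoulli1 (y : R) k : 0 <= y <= 1 -> 1 - k%:R * y <= (1 - y) ^+ k.
Proof.
move=> /andP[y0 y1]; have y1' : 0 <= 1 - y by rewrite subr_ge0.
elim: k => [|k IH]; first by rewrite mul0r subr0 expr0.
rewrite exprS; apply: le_trans (ler_wpM2l y1' IH).
rewrite -[k.+1%:R]natr1; have : 0 <= k%:R * y ^+ 2 by rewrite mulr_ge0 // sqr_ge0.
lra.
Qed.

(** All [d] factors are at least [n.-1 - d], and by Bernoulli's inequality the loss is at most the
    proportion d^2 / (n - 1) <= 1/2. *)
Lemma ffact_ge (n d : nat) : (1 < n)%N -> (2 * d ^ 2 < n)%N ->
  (n.-1 ^ d)%:R / 2 <= (n.-1 ^_ d)%:R :> R.
Proof.
move=> n1 dn.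
have n10 : 0 < n%:R - 1 :> R by rewrite subr_gt0 ltr1n.
have en : n.-1%:R = n%:R - 1 :> R by rewrite -subn1 natrB // ltnW.
have dn' : 2 * d%:R ^+ 2 <= n%:R - 1 :> R.
  by rewrite -en -natrX -natrM ler_nat; lia.
have dn1 : d%:R <= n%:R - 1 :> R.
  by apply: le_trans dn'; rewrite -natrX -natrM ler_nat; nia.
apply: (@le_trans _ _ ((n.-1 - d) ^ d)%:R); last first.
  rewrite ler_nat ffact_prod -[X in (_ ^ X <= _)%N](card_ord d) -prod_nat_const.
  by apply: leq_prod => i _; apply: leq_sub2l; exact: ltnW.
have e1 : (n.-1 - d)%:R = (n%:R - 1) * (1 - d%:R / (n%:R - 1)) :> R.
  rewrite natrB ?en; first by field; rewrite gt_eqF.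
  by rewrite -(ler_nat R) en.
rewrite !natrX e1 exprMn en ler_wpM2l ?exprn_ge0 ?(ltW n10) //.
set x := d%:R / _; have x0 : 0 <= x by rewrite divr_ge0 // ltW.
have x1 : x <= 1 by rewrite /x ler_pdivrMr // mul1r.
have dx : d%:R * x <= 1 / 2.
  by rewrite /x mulrA ler_pdivrMr // -expr2; lra.
apply: le_trans (_ : 1 - d%:R * x <= _); first by lra.
by apply: bernoulli1; rewrite x0.
Qed.

Section Bound.
Variables (n m d : nat).
Hypotheses (n5 : (5 <= n)%N) (m0 : (0 < m)%N) (mn : (m <= n)%N) (d2 : (2 <= d)%N).
Hypotheses (dn : (2 * d ^ 2 < n)%N) (dm : (2 * d ^ 2 <= m)%N).

Let N : R := n%:R * (n%:R - 1) / 2.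
(* The factor 1 - 1 / d makes it likely that at most m edges are present, and
   costs only a constant factor in t ^+ d. *)
Let t : R := m%:R / N * (1 - 1 / d%:R).

Let n5' : 5 <= n%:R :> R. Proof. by rewrite ler_nat. Qed.
Let n10 : 0 < n%:R - 1 :> R. Proof. by move: n5' => ?; lra. Qed.
Let n0 : 0 < n%:R :> R. Proof. by move: n5' => ?; lra. Qed.
Let N0 : 0 < N. Proof. by rewrite /N divr_gt0 // mulr_gt0. Qed.
Let m0' : 0 < m%:R :> R. Proof. by rewrite ltr0n. Qed.
Let d2' : 2 <= d%:R :> R. Proof. by rewrite ler_nat. Qed.
Let d0 : 0 < d%:R :> R. Proof. by move: d2' => ?; lra. Qed.
Let dinv : 1 / d%:R <= 1 / 2 :> R.
Proof. by rewrite ler_pdivrMr // mulrAC ler_pdivlMr //; move: d2' => ?; lra. Qed.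
Let dinv0 : 0 < 1 / d%:R :> R. Proof. by rewrite divr_gt0. Qed.
Let en : n.-1%:R = n%:R - 1 :> R.
Proof. by rewrite -subn1 natrB // (leq_trans _ n5). Qed.

Let t_upper : t * (n%:R - 1) <= 2.
Proof.
apply: le_trans (_ : m%:R / N * (n%:R - 1) <= _).
  apply: ler_wpM2r; first exact: ltW.
  apply: ler_piMr; first by rewrite divr_ge0 // ltW.
  by rewrite gerBl ltW.
have -> : m%:R / N * (n%:R - 1) = 2 * m%:R / n%:R.
  by rewrite /N; field; rewrite !gt_eqF.
by rewrite ler_pdivrMr // ler_wpM2l // ler_nat.
Qed.

Let t_pos : 0 < t.
Proof.
apply: mulr_gt0; first exact: divr_gt0.
by rewrite subr_gt0 (le_lt_trans dinv) // ltr_pdivrMr //; lra.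
Qed.

Let t_half : t <= 1 / 2.
Proof.
rewrite ler_pdivlMr //; apply: le_trans (_ : t * (n%:R - 1) / 2 <= _); last first.
  by move: t_upper => ?; lra.
by rewrite ler_pdivlMr // -mulrA ler_wpM2l ?(ltW t_pos) //; move: n5' => ?; lra.
Qed.

Let ht : 0 <= t <= 1.
Proof. by rewrite ltW //= (le_trans t_half) // ler_pdivrMr //; lra. Qed.

Let tail_pow : expR (- 4) <= (1 - t) ^+ n.-1.
Proof.
apply: le_trans (onem_pow_ge _ _); last by rewrite ltW.
by rewrite ler_expR lerN2 en -mulrA; move: t_upper => ?; lra.
Qed.

Let qmin : R := 'C(n.-1, d)%:R * t ^+ d * (1 - t) ^+ n.-1.
Let amax : R := 'C(n.-2, d.-1)%:R * t ^+ d.-1.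

(** The constants: 1/2 for the falling factorial, [expR (- 2)] for the factor 1 - 1/d in [t], and
    [expR (- 4)] for the absent edges. *)
Let qmin_rate : rate R n m d * expR (- 6) / 2 <= n%:R * qmin.
Proof.
have f0 : 0 < d`!%:R :> R by rewrite ltr0n fact_gt0.
have eC : 'C(n.-1, d)%:R = (n.-1 ^_ d)%:R / d`!%:R :> R.
  by rewrite -bin_ffact natrM mulfK // gt_eqF.
have h1 := ffact_ge (leq_trans (isT : 1 < 5)%N n5) dn.
have h2 : expR (- 2) <= (1 - 1 / d%:R) ^+ d :> R.
  apply: le_trans (onem_pow_ge _ _); last by rewrite ltW //= dinv.
  rewrite ler_expR lerN2.
  by have -> : 2 * (1 / d%:R) * d%:R = 2 :> R by field; rewrite gt_eqF.
have -> : rate R n m d * expR (- 6) / 2 = n%:R / d`!%:R *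
   ((n.-1 ^ d)%:R / 2 * ((m%:R / N) ^+ d * expR (- 2)) * expR (- 4)).
  have -> : - 6 = - 2 + - 4 :> R by ring.
  rewrite expRD /rate.
  have -> : 2 * m%:R / n%:R = n.-1%:R * (m%:R / N) :> R.
    by rewrite en /N; field; rewrite !gt_eqF.
  by rewrite exprMn natrX; field; rewrite gt_eqF.
have -> : n%:R * qmin = n%:R / d`!%:R *
   ((n.-1 ^_ d)%:R * ((m%:R / N) ^+ d * (1 - 1 / d%:R) ^+ d) * (1 - t) ^+ n.-1).
  by rewrite /qmin eC {1}/t exprMn; field; rewrite gt_eqF.
have mN0 : 0 <= (m%:R / N) ^+ d by rewrite exprn_ge0 // divr_ge0 // ltW.
apply: ler_wpM2l; first by rewrite divr_ge0 // ltW.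
apply: ler_pM; last exact: tail_pow; rewrite ?expR_ge0 //.
  by rewrite mulr_ge0 // mulr_ge0 ?expR_ge0.
apply: ler_pM => //; first by rewrite mulr_ge0 ?expR_ge0.
by rewrite ler_wpM2l.
Qed.

Let rate_pos : 0 < rate R n m d.
Proof.
rewrite /rate divr_gt0 ?ltr0n ?fact_gt0 // mulr_gt0 // exprn_gt0 //.
by rewrite divr_gt0 // mulr_gt0.
Qed.

Let qmin_pos : 0 < qmin.
Proof.
have : 0 < n%:R * qmin.
  by apply: lt_le_trans qmin_rate; rewrite divr_gt0 // mulr_gt0 // expR_gt0.
by rewrite pmulr_rgt0.
Qed.

(** The ratio of [qmin] to [amax] is [n.-1%:R / d%:R * t] up to the power [g], which is bounded
    below; and n^2 t is of order [m]. *)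
Let amax_qmin : t * amax ^+ 2 / qmin ^+ 2 <= 2 * expR 8 * (d%:R ^+ 2 / m%:R).
Proof.
have t1 : 0 < 1 - t by rewrite subr_gt0 (le_lt_trans t_half) // ltr_pdivrMr //; lra.
set g := (1 - t) ^+ n.-1; have g0 : 0 < g by rewrite exprn_gt0.
have eC : 'C(n.-1, d)%:R = n.-1%:R / d%:R * 'C(n.-2, d.-1)%:R :> R.
  have := mul_bin_diag n.-1 d.-1; rewrite prednK ?(ltnW d2) //.
  move/(congr1 (fun k => k%:R : R)); rewrite !natrM => h.
  by rewrite mulrAC h mulrAC divff ?mul1r // gt_eqF.
have eq : qmin = n.-1%:R / d%:R * t * g * amax.
  have et : t ^+ d = t * t ^+ d.-1 by rewrite -exprS prednK // ltnW.
  by rewrite /qmin eC /amax -/g et; ring.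
have a0 : amax != 0.
  by apply/eqP => a0; move: qmin_pos; rewrite eq a0 mulr0 ltxx.
have -> : t * amax ^+ 2 / qmin ^+ 2 = d%:R ^+ 2 / ((n%:R - 1) ^+ 2 * t) / g ^+ 2.
  by rewrite eq en; field; rewrite a0 !gt_eqF.
have gi : (g ^+ 2)^-1 <= expR 8.
  rewrite -(invrK (expR 8)) lef_pV2 ?posrE ?invr_gt0 ?expR_gt0 ?exprn_gt0 //.
  rewrite -expRN (_ : - 8 = - 4 + - 4 :> R); last by ring.
  by rewrite expRD -expr2 lerXn2r ?nnegrE ?expR_ge0 // ltW.
have tl : m%:R / 2 <= (n%:R - 1) ^+ 2 * t.
  have -> : (n%:R - 1) ^+ 2 * t = m%:R * (2 * ((n%:R - 1) / n%:R) * (1 - 1 / d%:R)).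
    by rewrite /t /N; field; rewrite !gt_eqF.
  apply: ler_wpM2l => //.
  have h1 : 1 / 2 <= (n%:R - 1) / n%:R :> R.
    by rewrite ler_pdivlMr //; move: n5' => ?; lra.
  have h2 : 1 / 2 <= 1 - 1 / d%:R :> R by move: dinv => ?; lra.
  have -> : 2^-1 = 2 * (1 / 2) * (1 / 2) :> R by field.
  by apply: ler_pM => //; rewrite ler_wpM2l.
apply: le_trans (_ : d%:R ^+ 2 / (m%:R / 2) * expR 8 <= _); last first.
  by rewrite le_eqVlt; apply/orP; left; apply/eqP; field; rewrite gt_eqF.
have b0 : 0 < (n%:R - 1) ^+ 2 * t by rewrite mulr_gt0 ?exprn_gt0.
apply: ler_pM => //.
- by rewrite divr_ge0 ?sqr_ge0 // ltW.
- by rewrite invr_ge0 exprn_ge0 // ltW.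
by rewrite ler_wpM2l ?sqr_ge0 // lef_pV2 ?posrE ?divr_gt0.
Qed.

Lemma draw_pr_max_degree_lt : (m <= #|pairs 'I_n|)%N ->
  draw_pr R (pairs 'I_n) m (fun E => max_degree E < d)%N <=
  4 * expR 6 / rate R n m d + 4 * expR 8 * (d%:R ^+ 2 / m%:R).
Proof.
move=> mK; set K := pairs 'I_n.
have NK : #|K|%:R = N by rewrite card_pairs natr_bin2.
have dA : down_closed (fun E : {set {set 'I_n}} => max_degree E < d)%N.
  move=> E E' EE'; apply: leq_ltn_trans; apply/bigmax_leqP => v _.
  apply: leq_trans (leq_bigmax v); apply: subset_leq_card; apply/subsetP => e.
  by rewrite !inE => /andP[/(subsetP EE') -> ->].
have h1 := draw_pr_le ht dA mK.
have dm' : d%:R ^+ 2 / m%:R <= 1 / 2 :> R.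
  by rewrite ler_pdivrMr // mulrAC ler_pdivlMr // mul1r mulrC -natrX -natrM ler_nat.
(* The mean number of edges is m - m/d and the variance at most [m], so more than [m] edges have
   probability at most d^2 / m. Dividing by this 1/2 doubles the bound [h3]. *)
have h2 : 1 / 2 <= pr (unif K t) (fun E => #|E| <= m)%N.
  have := prC (unif K t) (fun E : {set {set 'I_n}} => #|E| <= m)%N => h3.
  suff : pr (unif K t) (fun E => ~~ (#|E| <= m)%N) <= 1 / 2 by rewrite h3; lra.
  apply: le_trans (_ : _ <= N * t / (m%:R / d%:R) ^+ 2) _.
    rewrite -NK; apply: pr_card_dev => //; first by rewrite divr_gt0.
    move=> E _; rewrite -ltnNge => Em; rewrite ler_normr; apply/orP; left.
    have -> : #|K|%:R * t = m%:R - m%:R / d%:R.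
      by rewrite NK /t; field; rewrite !gt_eqF.
    rewrite -subr_ge0 (_ : _ - _ = #|E|%:R - m%:R); last by ring.
    by rewrite subr_ge0 ler_nat ltnW.
  have -> : N * t / (m%:R / d%:R) ^+ 2 = d%:R ^+ 2 / m%:R * (1 - 1 / d%:R).
    by rewrite /t; field; rewrite !gt_eqF.
  apply: le_trans dm'; apply: ler_piMr; first by rewrite divr_ge0 ?sqr_ge0.
  by rewrite gerBl ltW.
have h3 : pr (unif K t) (fun E => max_degree E < d)%N <=
    2 * expR 6 / rate R n m d + 2 * expR 8 * (d%:R ^+ 2 / m%:R).
  apply: le_trans (pr_max_degree_lt ht (ltnW d2) (leq_trans (isT : 1 < 5)%N n5) qmin_pos) _.
  apply: lerD; last exact: amax_qmin.
  apply: le_trans (_ : 1 / (rate R n m d * expR (- 6) / 2) <= _).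
    rewrite !div1r lef_pV2 ?posrE //.
      by rewrite mulr_gt0.
    by rewrite divr_gt0 // mulr_gt0 // expR_gt0.
  rewrite expRN le_eqVlt; apply/orP; left; apply/eqP; field.
  by rewrite gt_eqF ?expR_gt0 // gt_eqF.
set P := draw_pr _ _ _ _ in h1 *.
have P0 : 0 <= P by apply: draw_pr_ge0.
have h4 : 1 / 2 * P <= 2 * expR 6 / rate R n m d + 2 * expR 8 * (d%:R ^+ 2 / m%:R).
  by apply: le_trans h3; apply: le_trans h1; rewrite ler_wpM2r.
have -> : 4 * expR 6 / rate R n m d = 2 * (2 * expR 6 / rate R n m d) by ring.
have -> : 4 * expR 8 * (d%:R ^+ 2 / m%:R) = 2 * (2 * expR 8 * (d%:R ^+ 2 / m%:R)) :> R.
  by ring.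
by move: h4; set u := _ / rate R n m d; set v := 2 * expR 8 * _; clearbody u v P; lra.
Qed.

End Bound.
End LowerTailBound.

(** * Stirling's formula with explicit error *)

Section Stirling.
Variable R : realType.

Lemma ln_taylor_bounds (u : R) : 1 <= u ->
  (u - 1) - (u - 1) ^+ 2 / 2 <= ln u <= (u - 1) - (u - 1) ^+ 2 / 2 + (u - 1) ^+ 3 / 3.
Proof.
move=> u1.
(* The polynomial (y - 1) - (y - 1)^2 / 2 + e (y - 1)^3 in expanded form. The mean value theorem is
   applied to [ln - p e], whose derivative has constant sign on y >= 1 for e = 0 and for e = 1/3. *)
pose p (e : R) (y : R) := (- (3 / 2) - e) + (2 + 3 * e) * y + (- (1 / 2) - 3 * e) * y ^+ 2 +
  e * y ^+ 3.
pose dp (e : R) (y : R) := (2 + 3 * e) + (- (1 / 2) - 3 * e) * (2 * y) + e * (3 * y ^+ 2).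
have dp_lnp e (y : R) : 0 < y -> is_derive y 1 (fun y => @ln R y - p e y) (y^-1 - dp e y).
  move=> y0; have dln := is_derive1_ln y0.
  by apply: is_derive_eq; rewrite /dp /GRing.scale /=; ring.
have lnp e : exists2 c, c \in `[1, u] & (ln u - p e u) = (c^-1 - dp e c) * (u - 1).
  have := @MVT_segment R (fun y => @ln R y - p e y) (fun y => y^-1 - dp e y) 1 u u1.
  have p1 : p e 1 = 0 by rewrite /p; field.
  rewrite ln1 p1 !subr0; apply.
    by move=> y /itvP yu; apply: dp_lnp; apply: (@lt_trans _ _ 1) => //; rewrite yu.
  apply: continuous_in_subspaceT => y; rewrite in_setE /= => /itvP yu.
  apply/differentiable_continuous/derivable1_diffP.
  by have [] := dp_lnp e y (lt_le_trans ltr01 _); rewrite ?yu.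
apply/andP; split.
  have [c /itvP cu] := lnp 0; rewrite /p /dp => h.
  have c0 : 0 < c by apply: lt_le_trans ltr01 _; rewrite cu.
  suff : 0 <= (c^-1 -
      (2 + 3 * 0 + (- (1 / 2) - 3 * 0) * (2 * c) + 0 * (3 * c ^+ 2))) * (u - 1).
    by rewrite -h; lra.
  rewrite mulr_ge0 ?subr_ge0 //.
  have -> : 2 + 3 * 0 + (- (1 / 2) - 3 * 0) * (2 * c) + 0 * (3 * c ^+ 2) =
     c^-1 - (c - 1) ^+ 2 / c by field; rewrite gt_eqF.
  by rewrite lerBlDr lerDl divr_ge0 ?sqr_ge0 // ltW.
have [c /itvP cu] := lnp (1 / 3); rewrite /p /dp => h.
have c0 : 0 < c by apply: lt_le_trans ltr01 _; rewrite cu.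
suff : (c^-1 - (2 + 3 * (1 / 3) + (- (1 / 2) - 3 * (1 / 3)) * (2 * c) +
    (1 / 3) * (3 * c ^+ 2))) * (u - 1) <= 0.
  by rewrite -h; lra.
rewrite mulr_le0_ge0 ?subr_ge0 //.
have -> : 2 + 3 * (1 / 3) + (- (1 / 2) - 3 * (1 / 3)) * (2 * c) + (1 / 3) * (3 * c ^+ 2) =
   c^-1 + (c - 1) ^+ 3 / c by field; rewrite gt_eqF.
by rewrite subr_le0 lerDl divr_ge0 ?exprn_ge0 ?subr_ge0 ?cu // ltW.
Qed.

Lemma stirling_bounds (d : nat) : (0 < d)%N ->
  (d%:R + 1 / 2) * ln d%:R - d%:R + 1 / 2 <= ln (d`!%:R : R)
  <= (d%:R + 1 / 2) * ln d%:R - d%:R + 3 / 2.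
Proof.
move=> d0.
(* The error term is 1 at [d = 1] and changes by at most 1 / (4 k^2) from [k] to [k + 1]. This is
   below half of 1/k - 1/(k + 1), so the strengthened bound telescopes. *)
suff : `|ln (d`!%:R : R) - ((d%:R + 1 / 2) * ln d%:R - d%:R) - 1| <=
    1 / 2 * (1 - 1 / d%:R).
  have : 0 < 1 / d%:R :> R by rewrite divr_gt0 // ltr0n.
  by rewrite ler_norml => i0 /andP[h1 h2]; apply/andP; split; lra.
elim: d d0 => // -[_ _|d IH _].
  rewrite (_ : 1`! = 1%N) // (_ : 1%:R = 1 :> R) // ln1 mulr0.
  by rewrite (_ : 0 - (0 - 1) - 1 = 0) ?normr0; [lra|ring].
have {}IH := IH isT; set k := d.+1 in IH *.
have k0 : 0 < k%:R :> R by rewrite ltr0n.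
have k10 : 0 < k.+1%:R :> R by rewrite ltr0n.
have k1 : k.+1%:R = k%:R + 1 :> R by rewrite natr1.
have fk : 0 < k`!%:R :> R by rewrite ltr0n fact_gt0.
have lnu : ln (k.+1%:R : R) = ln k%:R + ln (k.+1%:R / k%:R).
  by rewrite ln_div ?posrE // addrC subrK.
have eu : k.+1%:R / k%:R - 1 = 1 / k%:R :> R by rewrite k1; field; rewrite gt_eqF.
have u1 : 1 <= k.+1%:R / k%:R :> R by rewrite ler_pdivlMr // mul1r ler_nat.
have := ln_taylor_bounds u1; rewrite eu; set l := ln (_ / _) in lnu *.
set x := 1 / k%:R => /andP[l1 l2].
have kx : k%:R * x = 1 by rewrite /x mul1r divff // gt_eqF.
have x0 : 0 < x by rewrite divr_gt0.
have x1 : x <= 1 by rewrite ler_pdivrMr // mul1r ler1n.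
have kx' : k%:R = x^-1 by rewrite /x div1r invrK.
have dev : `|(k%:R + 1 / 2) * l - 1| <= x ^+ 2 / 4.
  have h1 : (k%:R + 1 / 2) * (x - x ^+ 2 / 2) = 1 - x ^+ 2 / 4.
    by rewrite kx'; field; rewrite gt_eqF.
  have h2 : (k%:R + 1 / 2) * (x - x ^+ 2 / 2 + x ^+ 3 / 3) = 1 + x ^+ 2 / 12 + x ^+ 3 / 6.
    by rewrite kx'; field; rewrite gt_eqF.
  have kp : 0 <= k%:R + 1 / 2 :> R by lra.
  have := ler_wpM2l kp l1; have := ler_wpM2l kp l2; rewrite h1 h2.
  have x32 : x ^+ 3 <= x ^+ 2 by rewrite exprS ler_piMl ?sqr_ge0.
  have := sqr_ge0 x.
  by rewrite ler_norml => ? ? ?; apply/andP; split; lra.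
have x2 : x ^+ 2 / 4 <= 1 / 2 * (x - 1 / k.+1%:R).
  have -> : 1 / k.+1%:R = x / (1 + x) :> R.
    by rewrite k1 kx'; field; rewrite !gt_eqF //; lra.
  have -> : 1 / 2 * (x - x / (1 + x)) = x ^+ 2 / 4 * (2 / (1 + x)).
    by field; rewrite gt_eqF //; lra.
  rewrite ler_peMr ?divr_ge0 ?sqr_ge0 // ler_pdivlMr; lra.
rewrite factS natrM lnM ?posrE // k1.
have -> : ln (k%:R + 1) + ln k`!%:R - ((k%:R + 1 + 1 / 2) * ln (k%:R + 1) - (k%:R + 1)) - 1 =
   (ln k`!%:R - ((k%:R + 1 / 2) * ln k%:R - k%:R) - 1) - ((k%:R + 1 / 2) * l - 1).
  by rewrite -k1 lnu k1; ring.
apply: le_trans (ler_normB _ _) _; rewrite -k1; move: dev IH x2.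
rewrite -/x; move: `|_| `|_| (1 / k.+1%:R) (x ^+ 2) => a b c e; lra.
Qed.

End Stirling.

(** * The function [nu_fun] near its zero *)

Section NuAsymptotics.
Variable R : realType.

(** The origin of [nu_fun]: it is the logarithm of [rate] with the logarithm of the factorial
    replaced by (d + 1/2) ln d - d. *)
Lemma ln_rate (n m d : nat) : (0 < n)%N -> (0 < m)%N -> (0 < d)%N ->
  nu_fun n (2 * m) d%:R - 3 / 2 <= ln (rate R n m d) <= nu_fun n (2 * m) (d%:R : R) - 1 / 2.
Proof.
move=> n0 m0 d0.
have n0' : 0 < n%:R :> R by rewrite ltr0n.
have m0' : 0 < (2 * m)%N%:R :> R by rewrite ltr0n muln_gt0.
have f0 : 0 < d`!%:R :> R by rewrite ltr0n fact_gt0.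
have q0 : 0 < 2 * m%:R / n%:R :> R by rewrite -natrM divr_gt0.
have -> : ln (rate R n m d) = ln n%:R + d%:R * (ln (2 * m)%N%:R - ln n%:R) - ln d`!%:R.
  rewrite /rate ln_div ?posrE ?mulr_gt0 ?exprn_gt0 // lnM ?posrE ?exprn_gt0 //.
  by rewrite lnXn // -natrM ln_div ?posrE // mulr_natl.
have /andP[s1 s2] := @stirling_bounds R d d0.
rewrite /nu_fun; apply/andP; split.
  have -> : ln n%:R + d%:R * (ln (2 * m)%N%:R - ln n%:R) - ln d`!%:R =
    (d%:R * ln (2 * m)%N%:R + d%:R - (d%:R + 1 / 2) * ln d%:R - (d%:R - 1) * ln n%:R) +
    ((d%:R + 1 / 2) * ln d%:R - d%:R - ln d`!%:R) :> R by ring.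
  by rewrite lerD2l; lra.
have -> : ln n%:R + d%:R * (ln (2 * m)%N%:R - ln n%:R) - ln d`!%:R =
  (d%:R * ln (2 * m)%N%:R + d%:R - (d%:R + 1 / 2) * ln d%:R - (d%:R - 1) * ln n%:R) +
  ((d%:R + 1 / 2) * ln d%:R - d%:R - ln d`!%:R) :> R by ring.
by rewrite lerD2l; lra.
Qed.

Lemma rate_gt0 (n m d : nat) : (0 < n)%N -> (0 < m)%N -> 0 < rate R n m d.
Proof.
move=> n0 m0; rewrite /rate divr_gt0 ?ltr0n ?fact_gt0 // mulr_gt0 ?ltr0n // exprn_gt0 //.
by rewrite divr_gt0 ?mulr_gt0 ?ltr0n.
Qed.

Lemma sub_le_mulB_ln (x y : R) : 0 < x -> 0 < y -> y - x <= y * (ln y - ln x).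
Proof.
move=> x0 y0; have xy0 : 0 < x / y by rewrite divr_gt0.
have h : ln x - ln y <= x / y - 1.
  rewrite -ln_div ?posrE // -[X in ln X](subrKC 1); apply: le_ln1Dx; lra.
have : y * (ln x - ln y) <= y * (x / y - 1) by rewrite ler_pM2l.
have -> : y * (x / y - 1) = x - y by field; rewrite gt_eqF.
lra.
Qed.

Section FixedParameters.
Variables (n k : nat).
Hypotheses (n0 : (0 < n)%N) (k0 : (0 < k)%N).
Let v : R := nu R n k.
(* Up to lower order terms, minus the slope of nu_fun at its zero. *)
Definition nu_scale : R := ln v + ln n%:R - ln k%:R.

Lemma nu_fun_above (y : R) : v <= y -> nu_fun n k y <= - ((y - v) * nu_scale).
Proof.
move=> vy; have v0 : 0 < v by exact: nu_gt0.
have fv : nu_fun n k v = 0 by exact: nu_root.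
have y0 : 0 < y by apply: lt_le_trans vy.
have h1 := sub_le_mulB_ln v0 y0.
have h2 : ln v <= ln y by rewrite ler_ln ?posrE.
have e : nu_fun n k y - nu_fun n k v = (y - v) * (ln k%:R + 1 - ln n%:R) -
   (y * (ln y - ln v) + (y - v) * ln v) - 1 / 2 * (ln y - ln v).
  by rewrite /nu_fun; ring.
rewrite fv subr0 in e; rewrite e /nu_scale; lra.
Qed.

(** The condition [v <= 2 * y] keeps [ln v - ln y] at most 1, and hence the loss in the slope. *)
Lemma nu_fun_below (y : R) : 0 < y -> y <= v -> v <= 2 * y ->
  (v - y) * (nu_scale - 1) <= nu_fun n k y.
Proof.
move=> y0 yv v2; have v0 : 0 < v by exact: nu_gt0.
have fv : nu_fun n k v = 0 by exact: nu_root.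
have h1 := sub_le_mulB_ln y0 v0.
have h2 : ln y <= ln v by rewrite ler_ln ?posrE.
have h3 : ln v - ln y <= 1.
  rewrite -ln_div ?posrE // -[X in ln X](subrKC 1).
  apply: le_trans (le_ln1Dx _) _.
    by have := divr_gt0 v0 y0; lra.
  by rewrite lerBlDr ler_pdivrMr //; lra.
have e : nu_fun n k y - nu_fun n k v = (v - y) * (ln n%:R - ln k%:R - 1) +
   (v * (ln v - ln y) + (v - y) * ln y) + 1 / 2 * (ln v - ln y).
  by rewrite /nu_fun; ring.
rewrite fv subr0 in e.
have h4 : (v - y) * (ln v - ln y) <= (v - y) * 1 by rewrite ler_wpM2l // subr_ge0.
rewrite e /nu_scale; lra.
Qed.

(** With L = [nu_scale], v = e^L k / n is at most 2 e^L, while the equation for the zero gives ln n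
    <= v L. A bounded L would thus bound ln n. *)
Lemma nu_scale_ge (A : R) : 0 < A -> (k <= 2 * n)%N ->
  2 * expR A * A < ln n%:R -> A <= nu_scale.
Proof.
move=> A0 kn lnn; rewrite leNgt; apply/negP => LA.
have v0 : 0 < v by exact: nu_gt0.
have fv : nu_fun n k v = 0 by exact: nu_root.
have n0' : 0 < n%:R :> R by rewrite ltr0n.
have k0' : 0 < k%:R :> R by rewrite ltr0n.
have lnv : ln v <= v by apply/ltW/ln_sublinear.
have e : ln n%:R = v * nu_scale - v + 1 / 2 * ln v.
  by move: fv; rewrite /nu_fun /nu_scale; lra.
have ev : v = expR nu_scale * (k%:R / n%:R).
  by rewrite /nu_scale expRB expRD !lnK ?posrE //; field; rewrite !gt_eqF.
have kn' : k%:R / n%:R <= 2 :> R by rewrite ler_pdivrMr // -natrM ler_nat.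
have v2 : v <= 2 * expR A.
  rewrite ev mulrC; apply: ler_pM => //; rewrite ?divr_ge0 ?expR_ge0 //.
  by rewrite ler_expR ltW.
have h1 : v * nu_scale <= v * A by rewrite ler_pM2l // ltW.
have h2 : v * A <= 2 * expR A * A by rewrite ler_pM2r.
lra.
Qed.

End FixedParameters.

Lemma floor_nat (x : R) : 0 <= x -> exists d : nat,
  [/\ Num.floor x = d%:Z, d%:R <= x & x < d%:R + 1].
Proof.
move=> x0; have : (0 <= Num.floor x)%R by rewrite floor_ge_int ?mulr0z.
case e : (Num.floor x) => [d|//] _; exists d; split=> //.
  have : d%:Z <= Num.floor x by rewrite e.
  by rewrite floor_ge_int ?mulr0z.
have : Num.floor x < d.+1%:Z by rewrite e ltz_nat.
by rewrite floor_lt_int /= -[(_.+1)%:~R]/(d.+1%:R) -natr1.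
Qed.

End NuAsymptotics.

(** * Concentration for the uniform random graph *)

Section Concentration.
Variable R : realType.

(** This controls the error d^2 / m of the second moment method. For d >= 2 the sign condition
    forces d <= ln n and makes 2 m at least n^(1/2) / e, which exceeds a multiple of (ln n)^3. *)
Lemma nu_fun_ge0_bounds (n m d : nat) : (0 < n)%N -> (0 < m)%N -> (m <= n)%N ->
  (2 <= d)%N -> expR 3 <= ln n%:R :> R -> 0 <= nu_fun n (2 * m) (d%:R : R) ->
  d%:R ^+ 2 / m%:R <= 96 * expR 1 / ln n%:R :> R.
Proof.
move=> n0 m0 mn d2 n3 f0.
have n0' : 0 < n%:R :> R by rewrite ltr0n.
have m0' : 0 < m%:R :> R by rewrite ltr0n.
have k0' : 0 < (2 * m)%N%:R :> R by rewrite ltr0n muln_gt0.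
have d2' : 2 <= d%:R :> R by rewrite ler_nat.
have d0' : 0 < d%:R :> R by lra.
have e30 : 0 < expR 3 :> R by exact: expR_gt0.
have lnn0 : 0 < ln n%:R :> R by lra.
have lnd0 : 0 <= ln d%:R :> R by apply: ln_ge0; lra.
have ln2 : ln 2 <= 1 :> R.
  by rewrite -[X in ln X](subrKC 1); apply: le_trans (le_ln1Dx _) _; lra.
have lnk : ln (2 * m)%N%:R <= ln n%:R + 1 :> R.
  apply: le_trans (_ : ln (2 * n%:R) <= _).
    by rewrite ler_ln ?posrE ?mulr_gt0 // -natrM ler_nat leq_mul2l mn orbT.
  by rewrite lnM ?posrE //; lra.
set k := (2 * m)%N%:R in f0 lnk k0' *.
set y := ln n%:R in n3 lnn0 lnk f0 *.
move: f0; rewrite /nu_fun -/k -/y => f0.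
have h1 : d%:R * ln k <= d%:R * (y + 1) by rewrite ler_pM2l.
have dy : d%:R <= y.
  rewrite leNgt; apply/negP => yd.
  have : 3 <= ln d%:R :> R.
    rewrite -[3 in X in X <= _]expRK ler_ln ?posrE //; lra.
  move=> l3; have : d%:R * 3 <= d%:R * ln d%:R :> R by rewrite ler_pM2l.
  lra.
have hk : y / 2 - 1 <= ln k.
  have : d%:R * (y / 2 - 1) <= d%:R * ln k.
    have : 0 <= d%:R * ln d%:R :> R by rewrite mulr_ge0 // ltW.
    have : 0 <= (d%:R - 2) * y by rewrite mulr_ge0 ?subr_ge0 // ltW.
    lra.
  by rewrite ler_pM2l.
have km : k = 2 * m%:R by rewrite /k natrM.
have hk2 : y ^+ 3 <= 48 * expR 1 * k.
  have e1 : (y / 2) ^+ 3 / 6 <= expR (y / 2).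
    have y20 : 0 <= y / 2 by lra.
    by have := @expR_ge1Dxn R (y / 2) 2 y20; rewrite (_ : 3`! = 6)%N //; lra.
  have e2 : expR (y / 2) <= expR 1 * k.
    by rewrite -(@lnK R k) ?posrE // -expRD ler_expR; lra.
  have -> : y ^+ 3 = 48 * ((y / 2) ^+ 3 / 6) by field.
  by rewrite -mulrA ler_pM2l //; apply: le_trans e1 e2.
rewrite ler_pdivrMr // mulrAC ler_pdivlMr //.
apply: le_trans (_ : y ^+ 2 * y <= _).
  by rewrite ler_pM2r // lerXn2r ?nnegrE // ltW.
rewrite -exprSr; apply: le_trans hk2 _; rewrite km.
by rewrite le_eqVlt; apply/orP; left; apply/eqP; ring.
Qed.

Lemma max_degree_gt0 n m (E : {set {set 'I_n}}) : (0 < m)%N ->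
  E \in draws (pairs 'I_n) m -> (0 < max_degree E)%N.
Proof.
move=> m0; rewrite inE => /andP[EK /eqP Em].
have : (0 < #|E|)%N by rewrite Em.
rewrite card_gt0 => /set0Pn[e eE].
have := subsetP EK e eE; rewrite inE => /cards2P[u [v [_ euv]]].
apply: leq_trans (leq_bigmax u); rewrite card_gt0; apply/set0Pn; exists e.
by rewrite inE eE euv !inE eqxx.
Qed.

Lemma square_room (s m n : nat) : (4 <= s)%N -> (4 * s <= m)%N -> (m <= n)%N ->
  [/\ 5 <= n, 2 * s < n & 2 * s <= m]%N.
Proof. by move=> *; split; lia. Qed.

Definition near_nu (eps : R) (n m : nat) (P : {set {set 'I_n}}) : bool :=
  Num.floor (nu R n (2 * m) - eps) <= (max_degree P)%:Z
     <= Num.floor (nu R n (2 * m) + eps).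

Lemma degree_concentration (eps eta : R) : 0 < eps <= 1 -> 0 < eta ->
  exists B : R, forall n m, (0 < m)%N -> (m <= n)%N -> (m <= #|pairs 'I_n|)%N ->
    B <= ln n%:R ->
    draw_pr R (pairs 'I_n) m (fun E => ~~ near_nu eps m E) <= eta.
Proof.
move=> /andP[eps0 eps1] eta0.
(* [W] is the required size of |nu_fun|, so that [expR (- W) <= 1 / W] is small compared with [eta];
   [A] is the slope that produces it over the distance [eps]. [M] bounds m / d^2 from below. *)
pose W : R := 16 * expR 8 / eta.
have e80 : 0 < expR 8 :> R by exact: expR_gt0.
have W0 : 0 < W by rewrite divr_gt0 // mulr_gt0.
pose A : R := 1 + W / eps.
have We : 0 < W / eps by rewrite divr_gt0.
have A1 : 1 <= A by rewrite /A; lra.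
have AW : eps * (A - 1) = W by rewrite /A; field; rewrite gt_eqF.
have expW : expR (- W) <= eta / (16 * expR 8).
  have -> : eta / (16 * expR 8) = W^-1 by rewrite /W invf_div.
  rewrite expRN lef_pV2 ?posrE ?expR_gt0 //; have := expR_ge1Dx W; lra.
pose M : R := 4 + 16 * expR 8 / eta.
have M0 : 0 < M by rewrite /M; have := W0; rewrite /W; lra.
exists (2 * expR A * A + 1 + expR 3 + 96 * expR 1 * M) => n m m0 mn mK hn.
have p1 : 0 <= 2 * expR A * A by rewrite !mulr_ge0 ?expR_ge0 //; lra.
have p2 : 0 < expR 3 :> R by exact: expR_gt0.
have p3 : 0 < 96 * expR 1 * M by rewrite !mulr_gt0 // expR_gt0.
have n0 : (0 < n)%N by apply: leq_trans mn.
have lnn : 0 < ln n%:R :> R by lra.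
have k0 : (0 < 2 * m)%N by rewrite muln_gt0.
have kn : (2 * m <= 2 * n)%N by rewrite leq_mul2l mn orbT.
have A0 : 0 < A by lra.
have LA : A <= nu_scale R n (2 * m) by apply: nu_scale_ge => //; lra.
set v := nu R n (2 * m); have v0 : 0 < v by exact: nu_gt0.
have n1 : (1 < n)%N.
  rewrite ltnNge; apply/negP => n1; have n1' : n = 1%N by apply/eqP; rewrite eqn_leq n1 n0.
  by move: lnn; rewrite n1' ln1 ltxx.
have rp d := rate_gt0 R d n0 m0.
have [d1 [fd1 _ vd1]] := @floor_nat R (v + eps) (ltW (addr_gt0 v0 eps0)).
have up : draw_pr R (pairs 'I_n) m (fun E => d1 < max_degree E)%N <= eta / 2.
  apply: le_trans (draw_pr_max_degree_ge _ n1 (ltn0Sn d1) mK) _.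
  have /andP[_ h1] := ln_rate R n0 m0 (ltn0Sn d1).
  have vd : v + eps <= d1.+1%:R by rewrite -natr1 ltW.
  have h2 : nu_fun n (2 * m) (d1.+1%:R : R) <= - W.
    apply: le_trans (nu_fun_above n0 k0 _) _; first by rewrite -/v; lra.
    rewrite lerN2 -AW -/v; apply: ler_pM; rewrite ?(ltW eps0) ?subr_ge0 //.
      by rewrite lerBrDl.
    by apply: le_trans LA; rewrite gerBl.
  rewrite -[rate _ _ _ _]lnK ?posrE //.
  apply: le_trans (_ : expR (- W) <= _); first by rewrite ler_expR; lra.
  apply: le_trans expW _; rewrite ler_pM2l // lef_pV2 ?posrE ?mulr_gt0 //.
  by have := expR_ge1Dx (8 : R); lra.
have low (d : nat) : d%:R <= v - eps -> v - eps < d%:R + 1 -> (2 <= d)%N ->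
    draw_pr R (pairs 'I_n) m (fun E => max_degree E < d)%N <= eta / 2.
  move=> dv vd d2; have d2' : 2 <= d%:R :> R by rewrite ler_nat.
  have d0 : (0 < d)%N by apply: leq_trans d2.
  have h2 : W <= nu_fun n (2 * m) (d%:R : R).
    have d0' : 0 < d%:R :> R by rewrite ltr0n.
    have dv' : d%:R <= v by apply: le_trans dv _; rewrite gerBl ltW.
    (* Here [eps <= 1] and [2 <= d] enter: v < d + 1 + eps <= d + 2 <= 2 d. *)
    have v2d : v <= 2 * d%:R by lra.
    apply: le_trans (nu_fun_below n0 k0 d0' dv' v2d).
    rewrite -AW -/v; apply: ler_pM; rewrite ?(ltW eps0) ?subr_ge0 ?lerD2r //.
    by rewrite lerBrDr addrC -lerBrDr.
  have /andP[h1 _] := ln_rate R n0 m0 d0.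
  have f0 : 0 <= nu_fun n (2 * m) (d%:R : R) by lra.
  have n3 : expR 3 <= ln n%:R :> R by lra.
  have h3 := nu_fun_ge0_bounds n0 m0 mn d2 n3 f0.
  have h4 : d%:R ^+ 2 / m%:R <= M^-1 :> R.
    apply: le_trans h3 _; rewrite ler_pdivrMr // [leRHS]mulrC ler_pdivlMr //; lra.
  have m0' : 0 < m%:R :> R by rewrite ltr0n.
  have h5 : (4 * d ^ 2 <= m)%N.
    have : d%:R ^+ 2 / m%:R <= 4^-1 :> R.
      apply: le_trans h4 _; rewrite lef_pV2 ?posrE // /M lerDl ltW //.
    by rewrite ler_pdivrMr // [leRHS]mulrC ler_pdivlMr // -natrX -natrM ler_nat mulnC.
  have d4 : (4 <= d ^ 2)%N by rewrite -[4%N]/(2 ^ 2)%N leq_exp2r.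
  have [n5 dn dm] := square_room d4 h5 mn.
  apply: le_trans (draw_pr_max_degree_lt R n5 m0 mn d2 dn dm mK) _.
  have h6 : 4 * expR 6 / rate R n m d <= eta / 4.
    have e1 : (rate R n m d)^-1 <= expR (3 / 2 - W).
      rewrite -[rate _ _ _ _]lnK ?posrE // -expRN ler_expR; lra.
    apply: le_trans (_ : 4 * expR 6 * (expR (3 / 2 - W)) <= _).
      by rewrite ler_wpM2l // mulr_ge0 ?expR_ge0.
    apply: le_trans (_ : 4 * expR 8 * expR (- W) <= _).
      by rewrite -!mulrA ler_pM2l // -!expRD ler_expR; lra.
    apply: le_trans (_ : 4 * expR 8 * (eta / (16 * expR 8)) <= _).
      by rewrite ler_wpM2l // mulr_ge0 // ltW.
    by rewrite le_eqVlt; apply/orP; left; apply/eqP; field; rewrite gt_eqF.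
  have h7 : 4 * expR 8 * (d%:R ^+ 2 / m%:R) <= eta / 4.
    apply: le_trans (_ : 4 * expR 8 * M^-1 <= _).
      by rewrite ler_wpM2l // mulr_ge0 // ltW.
    rewrite ler_pdivrMr // /M.
    have -> : eta / 4 * (4 + 16 * expR 8 / eta) = eta + 4 * expR 8.
      by field; rewrite gt_eqF.
    lra.
  lra.
have nearE (E : {set {set 'I_n}}) : ~~ near_nu eps m E ->
    (Num.floor (v - eps) > (max_degree E)%:Z) || (d1 < max_degree E)%N.
  by rewrite /near_nu -/v fd1 negb_and -!ltNge ltz_nat.
(* If the lower bound is at most 1, it holds because the graph has an edge; this covers small
   [m]. *)
have [z1|z1] := leP (Num.floor (v - eps)) 1.
  apply: le_trans (_ : eta / 2 <= _); last by lra.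
  apply: le_trans up.
  apply: le_trans (draw_pr_bound_sum R (I := unit) (P := xpredT)
     (B := fun _ => fun E => (d1 < max_degree E)%N) _) _.
    move=> E Ed /nearE /orP[|h]; last by exists tt.
    move=> h; have := lt_le_trans h z1; rewrite -[1%R]/(1%:Z) ltz_nat ltnS leqn0 => /eqP h0.
    by have := max_degree_gt0 m0 Ed; rewrite h0.
  by rewrite (big_pred1 tt) // => -[].
have ve0 : 0 <= v - eps.
  have : 0 <= Num.floor (v - eps) by apply: le_trans (ltW z1).
  by rewrite floor_ge_int mulr0z.
have [d [fd dv vd]] := floor_nat ve0.
have d2 : (2 <= d)%N by move: z1; rewrite fd ltz_nat.
apply: le_trans (_ : eta / 2 + eta / 2 <= _); last by lra.
apply: le_trans (lerD (low d dv vd d2) up).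
apply: le_trans (draw_pr_bound_sum R (I := bool) (P := xpredT)
     (B := fun b E => if b then (max_degree E < d)%N else (d1 < max_degree E)%N) _) _.
  move=> E Ed /nearE; rewrite fd ltz_nat => /orP[h|h]; [by exists true|by exists false].
by rewrite big_bool.
Qed.

End Concentration.

(** * Transfer to random planar graphs *)

Section Planar.
Variable R : realType.

Lemma planar_graphsE n m : planar_graphs R n m =
  [set E in draws (pairs 'I_n) m | `[< planar R E >]].
Proof.
apply/setP => E; rewrite !inE andbA; congr (_ && _ && _).
apply/forall_inP/subsetP => h e /h; by rewrite inE.
Qed.

Lemma cube_root (n : nat) : (0 < n)%N ->
  exists h : R, [/\ 0 < h, n%:R = h ^+ 3 & n%:R `^ (2 / 3) = h ^+ 2].
Proof.
move=> n0; exists (n%:R `^ (1 / 3)).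
have n0' : 0 < n%:R :> R by rewrite ltr0n.
split; first exact: powR_gt0.
- by rewrite -powR_mulrn ?powR_ge0 // -powRrM div1r mulVf ?powRr1 ?ltW // pnatr_eq0.
- by rewrite -powR_mulrn ?powR_ge0 // -powRrM; congr (_ `^ _); field.
Qed.

Lemma uniform_pr_planar (C eps eta : R) : 0 <= C -> 0 < eps <= 1 -> 0 < eta ->
  exists B : R, forall n m (A : pred {set {set 'I_n}}), (0 < m)%N -> B <= n%:R ->
    m%:R <= n%:R / 2 + C * n%:R `^ (2 / 3) ->
    (forall P, near_nu eps m P -> A P) ->
    `|1 - uniform_pr R (planar_graphs R n m) A| <= eta.
Proof.
move=> C0 heps eta0; pose c := window_cst (2 * C + 4).
have c0 : 0 < c by rewrite /c /window_cst mulr_gt0 ?expR_gt0.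
(* Planar graphs make up at least the proportion [c / 2] of all graphs, so restricting to them
   increases the failure probability by at most the factor [2 / c]. *)
have [B hB] := degree_concentration heps (mulr_gt0 eta0 (divr_gt0 c0 (ltr0Sn R 1))).
pose H : R := 256 * (2 * C + 4) + 2 / c.
have c2 : 0 < 2 / c by rewrite divr_gt0.
have H0 : 0 < H by rewrite /H; lra.
have H3 : 0 < H ^+ 3 by rewrite exprn_gt0.
exists (H ^+ 3 + expR B) => n m A m0 hn mn hA.
have eB0 : 0 < expR B by exact: expR_gt0.
have n0' : 0 < n%:R :> R by lra.
have n0 : (0 < n)%N by rewrite -(ltr_nat R).
have [h [h0 nh nh2]] := cube_root n0.
have Hh : H <= h.
  rewrite leNgt; apply/negP => hH.
  have : h ^+ 3 < H ^+ 3 by rewrite ltrXn2r // ?nnegrE ltW.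
  by rewrite -nh; lra.
have lnB : B <= ln n%:R by rewrite -[B]expRK ler_ln ?posrE //; lra.
rewrite nh2 in mn.
have Dh : 256 * (2 * C + 4) <= h by apply: le_trans Hh; rewrite /H; lra.
have mn' : (m <= n)%N.
  rewrite -(ler_nat R); apply: le_trans mn _; rewrite nh.
  have : C * h ^+ 2 <= h / 2 * h ^+ 2 by rewrite ler_wpM2r ?sqr_ge0 //; lra.
  rewrite (_ : h / 2 * h ^+ 2 = h ^+ 3 / 2); last by field.
  lra.
have [mK ho] := draw_pr_outerplanar nh C0 Dh mn.
have hc : c / 2 <= draw_pr R (pairs 'I_n) m (fun E => `[< outerplanar E >]).
  apply: le_trans ho; rewrite -/c.
  have : 1 / h <= c / 2.
    rewrite ler_pdivrMr // mulrC mulrA ler_pdivlMr // mul1r -ler_pdivrMr //.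
    by apply: le_trans Hh; rewrite /H; lra.
  lra.
have hb := hB n m m0 mn' mK lnB.
have N0 := draws_gt0 R mK.
set S := planar_graphs R n m.
set bad := #|[set E in draws (pairs 'I_n) m | ~~ near_nu eps m E]|.
have S1 : c / 2 * #|draws (pairs 'I_n) m|%:R <= #|S|%:R.
  apply: le_trans (_ : #|[set E in draws (pairs 'I_n) m | `[< outerplanar E >]]|%:R <= _).
    by rewrite -ler_pdivlMr.
  rewrite ler_nat; apply: subset_leq_card; apply/subsetP => E; rewrite /S planar_graphsE !inE.
  move=> /andP[/andP[EK ->] /asboolP oE]; rewrite EK /=; apply/asboolP.
  apply: outerplanar_planar => //; apply/forall_inP => e /(subsetP EK).
  by rewrite inE.
have S0 : 0 < #|S|%:R :> R by apply: lt_le_trans S1; rewrite mulr_gt0 // divr_gt0.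
have bad1 : bad%:R <= eta * #|S|%:R.
  apply: le_trans (_ : eta * (c / 2 * #|draws (pairs 'I_n) m|%:R) <= _).
    by rewrite mulrA -ler_pdivrMr.
  by rewrite ler_pM2l.
have cS : (#|S| <= #|[set x in S | A x]%SET| + bad)%N.
  rewrite -(cardsID [set x | A x] S); apply: leq_add; apply: subset_leq_card.
    by apply/subsetP => E; rewrite !inE.
  apply/subsetP => E; rewrite /S planar_graphsE !inE => /andP[nA /andP[-> _]] /=.
  by apply: contra nA => /hA.
have cS2 : (#|[set x in S | A x]%SET| <= #|S|)%N.
  by apply: subset_leq_card; apply/subsetP => E; rewrite inE => /andP[].
rewrite /uniform_pr -/S ger0_norm.
  rewrite lerBlDr -lerBlDl ler_pdivlMr // mulrBl mul1r lerBlDr.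
  apply: le_trans (_ : #|[set x in S | A x]%SET|%:R + bad%:R <= _); last by rewrite lerD2l.
  by rewrite -natrD ler_nat.
by rewrite subr_ge0 ler_pdivrMr // mul1r ler_nat.
Qed.

End Planar.

Local Open Scope classical_set_scope.

Theorem theorem1p3 (R : realType) (m : nat -> nat)
    (m_gt0 : forall n : nat, (0 < m n)%N)
    (m_le : exists C : R, \forall n \near \oo,
       (m n)%:R <= n%:R / 2 + C * n%:R `^ (2 / 3)) :
  (forall eps : R, 0 < eps ->
     uniform_pr R (planar_graphs R n (m n))
       (fun P => Num.floor (nu R n (2 * m n) - eps)
                   <= (max_degree P)%:Z
                   <= Num.floor (nu R n (2 * m n) + eps))
       @[n --> \oo] --> (1 : R))
  /\
  (let D (n : nat) : int := Num.floor (nu R n (2 * m n) - 1 / 3) in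
   uniform_pr R (planar_graphs R n (m n))
     (fun P => ((max_degree P)%:Z == D n) || ((max_degree P)%:Z == D n + 1))
     @[n --> \oo] --> (1 : R)).
Proof.
case: m_le => C hC.
have main (e : R) (A : forall n, pred {set {set 'I_n}}) : 0 < e <= 1 ->
    (forall n P, near_nu e (m n) P -> A n P) ->
    uniform_pr R (planar_graphs R n (m n)) (A n) @[n --> \oo] --> (1 : R).
  move=> he hA; apply/cvgrPdist_le => eta eta0.
  (* The given constant may be negative, whereas the estimates assume it is not. *)
  have C0 : 0 <= Num.max C 0 by rewrite le_max lexx orbT.
  have [B hB] := uniform_pr_planar C0 he eta0.
  near=> n; apply: hB => //.
  - by near: n; exact: nbhs_infty_ger.
  - apply: (@le_trans _ _ (n%:R / 2 + C * n%:R `^ (2 / 3))); first by near: n.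
    by rewrite lerD2l ler_wpM2r ?powR_ge0 // le_max lexx.
  - exact: hA.
split.
  (* A smaller [eps] gives a narrower interval, so [eps] may be capped at 1. *)
  move=> eps eps0; apply: (main (Num.min eps 1)).
    by rewrite lt_min eps0 ltr01 ge_min lexx orbT.
  move=> n P /andP[h1 h2]; apply/andP; split.
    apply: le_trans h1; apply: le_floor; rewrite lerD2l lerN2 ge_min lexx //.
  by apply: le_trans h2 _; apply: le_floor; rewrite lerD2l ge_min lexx.
apply: (main (1 / 3)); first by lra.
move=> n P; rewrite /near_nu; set v := nu _ _ _ => /andP[h1 h2].
(* The two arguments differ by 2/3 < 1, so the interval contains at most the two integers [D n] and
   [D n + 1]. *)
have h3 : Num.floor (v + 1 / 3) <= Num.floor (v - 1 / 3) + 1.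
  rewrite -ltzD1 floor_lt_int !rmorphD /=.
  have := floor_lt_int (v - 1 / 3) (Num.floor (v - 1 / 3) + 1).
  rewrite ltzD1 lexx => /esym; rewrite rmorphD /=; lra.
move: h1 h2 h3; move: (Num.floor _) (Num.floor _) (max_degree P) => a b d; lia.
Unshelve. all: by end_near.
Qed.
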